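(* Let $p,q$ be positive integers and let $v:[p]\to[C]$ and $w:[q]\to[C]$ be cyclically alternating words in a set of colours $[C]$. To each colour $c\in[C]$ associate an ensemble of random matrices $\{X_c^{(\lambda)}\}_{\lambda\in\Lambda_c}$ satisfying condition (G) with data $(PM_c,f_c)$, the ensembles associated with distinct colours being independent. Let $m_1,\ldots,m_p$ and $n_1,\ldots,n_q$ be positive integers, $m:=m_1+\cdots+m_p$, $n:=n_1+\cdots+n_q$, and let $\varepsilon:[m+n]\to\{1,-1\}$. For each $k\in[p]$ and $i\in[m_1+\cdots+m_{k-1}+1,\,m_1+\cdots+m_k]$ let $\lambda_i\in\Lambda_{v(k)}$, and for each $k\in[q]$ and $i\in[m+n_1+\cdots+n_{k-1}+1,\,m+n_1+\cdots+n_k]$ let $\lambda_i\in\Lambda_{w(k)}$. Put $$A_k=\prod_{i=m_1+\cdots+m_{k-1}+1}^{m_1+\cdots+m_k}X_{v(k)}^{(\varepsilon(i)\lambda_i)}\quad(k\in[p]),\qquad B_k=\prod_{i=m+n_1+\cdots+n_{k-1}+1}^{m+n_1+\cdots+n_k}X_{w(k)}^{(\varepsilon(i)\lambda_i)}\quad(k\in[q]).$$ If $p\neq q$, then $$\lim_{N\to\infty}k_2\left(\mathrm{Tr}(\mathring{A}_1\cdots\mathring{A}_p),\mathrm{Tr}(\mathring{B}_1\cdots\mathring{B}_q)\right)=0,$$ and if $p=q\geq 2$, then $$\begin{aligned}\lim_{N\to\infty}k_2\left(\mathrm{Tr}(\mathring{A}_1\cdots\mathring{A}_p),\mathrm{Tr}(\mathring{B}_1\cdots\mathring{B}_p)\right)={}&\sum_{k=0}^{p-1}\prod_{i=1}^{p}\lim_{N\to\infty}\left(\mathbb{E}(\mathrm{tr}(A_iB_{k-i}))-\mathbb{E}(\mathrm{tr}(A_i))\,\mathbb{E}(\mathrm{tr}(B_{k-i}))\right)\\&+\sum_{k=0}^{p-1}\prod_{i=1}^{p}\lim_{N\to\infty}\left(\mathbb{E}(\mathrm{tr}(A_iB_{k+i}^{T}))-\mathbb{E}(\mathrm{tr}(A_i))\,\mathbb{E}(\mathrm{tr}(B_{k+i}^{T}))\right),\end{aligned}$$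 where the indices of the $B$'s are taken modulo $p$ (with representatives in $[p]$).
   Context: **Words and matrices.** $[n]=\{1,\ldots,n\}$ and $[a,b]=\{a,\ldots,b\}$. A word $w:[p]\to[C]$ is cyclically alternating if $w(1)\neq w(2)\neq\cdots\neq w(p)$ and $w(p)\neq w(1)$. $\mathrm{Tr}$ is the usual trace and $\mathrm{tr}=\frac1N\mathrm{Tr}$, where $N$ is the matrix size. $X_c^{(-\lambda)}:=(X_c^{(\lambda)})^T$, so $X_c^{(\varepsilon\lambda)}$ is $X_c^{(\lambda)}$ if $\varepsilon=1$ and its transpose if $\varepsilon=-1$. For a random matrix $X$, $\mathring{X}:=X-\mathbb{E}(\mathrm{tr}(X))I_N$. $k_2(X,Y)=\mathbb{E}(XY)-\mathbb{E}(X)\mathbb{E}(Y)$. **Permutations.** For a finite set $I$ of nonzero integers, $-I=\{-k:k\in I\}$, $\pm I=I\cup(-I)$, $S(I)$ is the group of permutations of $I$, products act from right to left, a permutation acts trivially outside its domain, and $\#(\pi)$ is the number of cycles of $\pi$ (on its domain, fixed points included). $\delta:k\mapsto-k$. A premap on $\pm I$ is $\pi\in S(\pm I)$ such that $\pi(k)=-\pi^{-1}(-k)$ for all $k$ and no cycle of $\pi$ contains both $k$ and $-k$; the set of premaps is $PM(\pm I)$. If $I$ does not contain both $k$ and $-k$ for any $k$, and $\gamma\in S(I)$, then $\gamma_+\in S(\pm I)$ is $\gamma$ extended by the identity on $-I$, $\gamma_-:=\delta\gamma_+\delta$, and for $\pi\in PM(\pm I)$ $$\chi(\gamma,\pi):=\#(\gamma_+\gamma_-^{-1})/2+\#(\pi)/2+\#(\gamma_+^{-1}\pi^{-1}\gamma_-)/2-|I|$$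 (in all three counts the domain is $\pm I$). A cycle is particular if its element of smallest absolute value is positive; for a premap $\pi$, $\pi/2$ is the permutation formed by the particular cycles of $\pi$, on the set of elements of those cycles. Given $\varepsilon:I\to\{1,-1\}$ with $I$ a set of positive integers, put $\varepsilon(-k)=\varepsilon(k)$ and $\delta_\varepsilon:k\mapsto\varepsilon(k)k$. **Trace along a permutation.** For matrices $X_k$ put $X^{(k)}=X_k$ and $X^{(-k)}=X_k^T$. For a permutation $\sigma$ of a finite set of nonzero integers, $\mathrm{tr}_\sigma(\ldots)$ is the product over the cycles $(c_1,\ldots,c_s)$ of $\sigma$ of $\mathrm{tr}(X^{(c_1)}\cdots X^{(c_s)})$. **Condition (G).** A family $\{X_\lambda\}_{\lambda\in\Lambda}$ of $N\times N$ random matrices, given for every $N$ (with $X_\lambda^{(1)}=X_\lambda$, $X_\lambda^{(-1)}=X_\lambda^T$), satisfies (G) with data $(PM_c,f_c)$ if: (i) for each finite set $I$ of positive integers, $PM_c(\pm I)\subseteq PM(\pm I)$ is a subset such that, for every $J\subseteq I$, the $\pi\in PM_c(\pm I)$ which do not connect $\pm J$ and $\pm(I\setminus J)$ (no cycle meets both) are exactly the products $\pi_1\pi_2$ with $\pi_1\in PM_c(\pm J)$, $\pi_2\in PM_c(\pm(I\setminus J))$; (ii) $f_c$ is a complex-valued function on $\bigcup_I PM_c(\pm I)$ (its value on $\pi\in PM_c(\pm I)$ may depend on $N$ and on the indices $\lambda_k$, $k\in I$) such that $\lim_{N\to\infty}f_c(\pi)$ exists for every $\pi$; (iii) for every finite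 set $I=\{i_1<\cdots<i_s\}$ of positive integers, $\gamma\in S(I)$, $\varepsilon:I\to\{1,-1\}$, $\lambda_k\in\Lambda$ ($k\in I$), and $N\times N$ random matrices $Y_k$ ($k\in I$) independent from the family $\{X_\lambda\}$ (all expectations existing), $$\mathbb{E}\left(\mathrm{tr}_\gamma(X_{\lambda_{i_1}}^{(\varepsilon(i_1))}Y_{i_1},\ldots,X_{\lambda_{i_s}}^{(\varepsilon(i_s))}Y_{i_s})\right)=\sum_{\pi\in PM_c(\pm I)}N^{\chi(\gamma,\delta_\varepsilon\pi\delta_\varepsilon)-2\#(\gamma)}f_c(\pi)\,\mathbb{E}\left(\mathrm{tr}_{\gamma_-^{-1}\delta_\varepsilon\pi\delta_\varepsilon\gamma_+/2}(Y_{i_1},\ldots,Y_{i_s})\right);$$ (iv) (multiplicativity) if $\pi\in PM_c(\pm I)$ does not connect $\pm J$ and $\pm(I\setminus J)$, then $f_c(\pi)=f_c(\pi|_{\pm J})f_c(\pi|_{\pm(I\setminus J)})$. For $I=\emptyset$, $PM_c$ consists of the empty permutation, with $f_c=1$. The paper's instances of (G): real Ginibre matrices ($PM_c(\pm I)=\{\rho\delta\rho:\rho\text{ a pairing of }I\}$, $f_c=1$), GOE matrices ($PM_c(\pm I)$ the premaps on $\pm I$ that are pairings, $f_c=1$), and real Wishart matrices $X^TD_\lambda X$ ($PM_c(\pm I)=PM(\pm I)$, $f_c(\pi)=\mathrm{tr}_{\pi^{-1}/2}(D_{\lambda_k})_{k\in I}$). *)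

(* Defs.v *)
From HB Require Import structures.
From mathcomp Require Import all_boot all_order all_algebra all_fingroup finmap.
From mathcomp Require Import complex.
From mathcomp Require Import all_classical all_reals all_analysis.

Set Implicit Arguments.
Unset Strict Implicit.
Unset Printing Implicit Defensive.

Import Order.TTheory GRing.Theory Num.Theory.
Import numFieldNormedType.Exports.

Local Open Scope classical_set_scope.
Local Open Scope ring_scope.

(** * Limits of complex sequences *)

(* [R[i]^o] carries the topology of the complex modulus. *)
Definition ccvg_to (R : realType) (u : nat -> R[i]) (l : R[i]) : Prop :=
  (u : nat -> R[i]^o) @ \oo --> (l : R[i]^o).

Definition ccvg (R : realType) (u : nat -> R[i]) : Prop :=
  cvg ((u : nat -> R[i]^o) @ \oo).

Definition clim (R : realType) (u : nat -> R[i]) : R[i] :=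
  lim ((u : nat -> R[i]^o) @ \oo).

(** * Complex random variables and random matrices *)

Definition cmeasurable (R : realType) (d : measure_display)
    (T : measurableType d) (Z : T -> R[i]) : Prop :=
  measurable_fun setT (fun w => complex.Re (Z w)) /\
  measurable_fun setT (fun w => complex.Im (Z w)).

Definition cintegrable (R : realType) (d : measure_display)
    (T : measurableType d) (P : probability T R) (Z : T -> R[i]) : Prop :=
  P.-integrable setT (fun w => (complex.Re (Z w))%:E) /\
  P.-integrable setT (fun w => (complex.Im (Z w))%:E).

Definition cexp (R : realType) (d : measure_display)
    (T : measurableType d) (P : probability T R) (Z : T -> R[i]) : R[i] :=
  Complex (fine 'E_P[fun w => complex.Re (Z w)])
          (fine 'E_P[fun w => complex.Im (Z w)]).

Definition k2 (R : realType) (d : measure_display)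
    (T : measurableType d) (P : probability T R) (Z W : T -> R[i]) : R[i] :=
  cexp P (fun w => Z w * W w) - cexp P Z * cexp P W.

Definition random_matrix (R : realType) (d : measure_display)
    (T : measurableType d) (N : nat) (M : T -> 'M[R[i]]_N) : Prop :=
  forall a b, cmeasurable (fun w => M w a b).

(* sigma-algebra generated by a family of random matrices *)
Definition sigma_mx (R : realType) (d : measure_display)
    (T : measurableType d) (N : nat) (J : Type)
    (M : J -> T -> 'M[R[i]]_N) : set (set T) :=
  <<s [set A | exists (j : J) (a b : 'I_N) (B : set R), measurable B /\
        (A = (fun w => complex.Re (M j w a b)) @^-1` B \/
         A = (fun w => complex.Im (M j w a b)) @^-1` B)] >>.

Definition indep2 (R : realType) (d : measure_display)
    (T : measurableType d) (P : probability T R) (F G : set (set T)) : Prop :=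
  forall A B, F A -> G B -> P (A `&` B) = (P A * P B)%E.

Definition mutually_indep (R : realType) (d : measure_display)
    (T : measurableType d) (P : probability T R) (I : finType)
    (F : I -> set (set T)) : Prop :=
  forall (J : {set I}) (A : I -> set T),
    (forall i, i \in J -> F i (A i)) ->
    P (\bigcap_(i in [set i | i \in J]) A i) = (\prod_(i in J) P (A i))%E.

(* the usual trace is [\tr]; this is the normalized one *)
Definition ntr (F : fieldType) (N : nat) (M : 'M[F]_N) : F :=
  N%:R^-1 * \tr M.

Definition centered (R : realType) (d : measure_display)
    (T : measurableType d) (P : probability T R) (N : nat)
    (M : T -> 'M[R[i]]_N) : T -> 'M[R[i]]_N :=
  fun w => M w - (cexp P (fun t => ntr (M t)))%:M.

(** * Signs *)

(* A sign is a boolean, [true] standing for -1. *)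
Definition sgn_mx (F : Type) (N : nat) (s : bool) (M : 'M[F]_N) : 'M[F]_N :=
  if s then M^T else M.

(* For a finite set [I] of positive integers, [(k, false)] stands for the
   element [k] of [I] and [(k, true)] for the element [-k] of [-I]. *)
Definition pmset (I : {fset nat}) : finType := (I * bool)%type.

Definition delta_eps_fun (I : {fset nat}) (eps : I -> bool)
    (x : pmset I) : pmset I := (x.1, x.2 (+) eps x.1).

Lemma delta_eps_inj (I : {fset nat}) (eps : I -> bool) :
  injective (delta_eps_fun eps).
Proof.
by apply: (can_inj (g := delta_eps_fun eps)) => -[k b];
  rewrite /delta_eps_fun /= addbK.
Qed.

Definition delta_eps (I : {fset nat}) (eps : I -> bool) : {perm (pmset I)} :=
  perm (@delta_eps_inj I eps).

Definition delta (I : {fset nat}) : {perm (pmset I)} :=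
  delta_eps (fun=> true).

(** * Permutations and premaps

   The product of [{perm _}] acts from left to right, whereas the paper's
   products act from right to left: the factors appear in reverse order. *)

Definition ncycles (T : finType) (s : {perm T}) : nat := #|porbits s|.

Definition plus_fun (I : {fset nat}) (g : {perm I}) (x : pmset I) : pmset I :=
  if x.2 then x else (g x.1, false).

Lemma plus_inj (I : {fset nat}) (g : {perm I}) : injective (plus_fun g).
Proof.
by move=> [k []] [l []] //= [] // /perm_inj ->.
Qed.

(* gamma_+ *)
Definition gplus (I : {fset nat}) (g : {perm I}) : {perm (pmset I)} :=
  perm (@plus_inj I g).

(* gamma_- *)
Definition gminus (I : {fset nat}) (g : {perm I}) : {perm (pmset I)} :=
  (delta I * gplus g * delta I)%g.

Definition premaps (I : {fset nat}) : {set {perm (pmset I)}} :=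
  [set s : {perm (pmset I)} |
     [forall x, s x == delta I (s^-1%g (delta I x))] &&
     [forall x, delta I x \notin porbit s x]].

(* The three numbers of cycles are even when [s] is a premap. *)
Definition chi (I : {fset nat}) (g : {perm I}) (s : {perm (pmset I)}) : int :=
  ((ncycles ((gminus g)^-1 * gplus g)%g)./2
   + (ncycles s)./2
   + (ncycles (gminus g * s^-1 * (gplus g)^-1)%g)./2)%N%:Z - #|` I|%:Z.

Definition particular (I : {fset nat}) (O : {set (pmset I)}) : bool :=
  [exists x in O, ~~ x.2 && [forall y in O, val x.1 <= val y.1]%N].

(* the domain of pi/2 *)
Definition half_dom (I : {fset nat}) (s : {perm (pmset I)}) : {set (pmset I)} :=
  [set x | particular (porbit s x)].

(* gamma_-^-1 delta_eps pi delta_eps gamma_+ *)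
Definition kreweras (I : {fset nat}) (g : {perm I}) (eps : I -> bool)
    (s : {perm (pmset I)}) : {perm (pmset I)} :=
  (gplus g * (delta_eps eps * s * delta_eps eps) * (gminus g)^-1)%g.

(* No cycle meets both +-J and +-(I \ J). *)
Definition not_connecting (I : {fset nat}) (J : {fset nat})
    (s : {perm (pmset I)}) : Prop :=
  forall x y, y \in porbit s x -> (val x.1 \in J) = (val y.1 \in J).

(* action on all signed integers, trivial outside the domain *)
Definition pact (I : {fset nat}) (s : {perm (pmset I)}) (x : nat * bool) :
    nat * bool :=
  if insub x.1 is Some k then
    let y := s ((k : I), x.2) in (val y.1, y.2)
  else x.

Definition is_product (I J K : {fset nat}) (s : {perm (pmset I)})
    (s1 : {perm (pmset J)}) (s2 : {perm (pmset K)}) : Prop :=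
  pact s =1 pact s1 \o pact s2.

(* s1 is the restriction of s to +-J *)
Definition is_restriction (I J : {fset nat}) (s : {perm (pmset I)})
    (s1 : {perm (pmset J)}) : Prop :=
  forall x : nat * bool, x.1 \in J -> pact s1 x = pact s x.

(** * Traces along permutations *)

Definition cycle_seq (T : finType) (s : {perm T}) (O : {set T}) : seq T :=
  if [pick x in O] is Some x then fingraph.orbit s x else [::].

(* The trace along the permutation of [D] induced by [s], where [D] is a
   union of cycles of [s]. *)
Definition tr_along (F : fieldType) (N : nat) (T : finType) (s : {perm T})
    (D : {set T}) (M : T -> 'M[F]_N) : F :=
  \prod_(O in porbits s | O \subset D) ntr (\prod_(x <- cycle_seq s O) M x).

Definition tr_perm (F : fieldType) (N : nat) (I : {fset nat}) (g : {perm I})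
    (M : I -> 'M[F]_N) : F :=
  tr_along g [set: I]%SET M.

Definition tr_half (F : fieldType) (N : nat) (I : {fset nat})
    (s : {perm (pmset I)}) (M : I -> 'M[F]_N) : F :=
  tr_along s (half_dom s) (fun x => sgn_mx x.2 (M x.1)).

(** * Condition (G) *)

Definition premap_data : Type :=
  forall I : {fset nat}, {set {perm (pmset I)}}.

(* f_c may depend on N and on the indices lambda_k, k in I. *)
Definition weight_data (R : realType) (Lam : Type) : Type :=
  forall (N : nat) (I : {fset nat}), (I -> Lam) -> {perm (pmset I)} -> R[i].

(* The matrices have moments of all orders. *)
Definition all_moments (R : realType) (d : measure_display)
    (T : measurableType d) (P : probability T R) (N : nat) (Lam : Type)
    (X : Lam -> T -> 'M[R[i]]_N) : Prop :=
  forall s : seq (Lam * ('I_N * 'I_N)),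
    cintegrable P (fun w => \prod_(t <- s) X t.1 w t.2.1 t.2.2).

Definition G_premaps (PM : premap_data) : Prop :=
  forall I : {fset nat}, 0%N \notin I ->
    PM I \subset premaps I /\
    (forall J : {fset nat}, (J `<=` I)%fset ->
       forall s : {perm (pmset I)},
         (s \in PM I /\ not_connecting J s) <->
         (exists (s1 : {perm (pmset J)}) (s2 : {perm (pmset (I `\` J)%fset)}),
            [/\ s1 \in PM J, s2 \in PM (I `\` J)%fset & is_product s s1 s2])).

Definition G_limits (R : realType) (Lam : Type) (PM : premap_data)
    (f : weight_data R Lam) : Prop :=
  forall (I : {fset nat}) (lam : I -> Lam) (s : {perm (pmset I)}),
    0%N \notin I -> s \in PM I -> ccvg (fun N => f N I lam s).

Definition G_expansion (R : realType) (d : measure_display)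
    (T : measurableType d) (P : probability T R) (N : nat) (Lam : Type)
    (X : Lam -> T -> 'M[R[i]]_N) (PM : premap_data)
    (f : weight_data R Lam) : Prop :=
  forall (I : {fset nat}) (g : {perm I}) (eps : I -> bool) (lam : I -> Lam)
         (Y : I -> T -> 'M[R[i]]_N),
    0%N \notin I ->
    (forall k, random_matrix (Y k)) ->
    indep2 P (sigma_mx X) (sigma_mx Y) ->
    cintegrable P (fun w =>
      tr_perm g (fun k => sgn_mx (eps k) (X (lam k) w) *m Y k w)) ->
    (forall s, s \in PM I ->
       cintegrable P (fun w => tr_half (kreweras g eps s) (fun k => Y k w))) ->
    cexp P (fun w =>
      tr_perm g (fun k => sgn_mx (eps k) (X (lam k) w) *m Y k w))
    = \sum_(s in PM I)
        N%:R ^ (chi g (delta_eps eps * s * delta_eps eps)%g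
                - (2 * ncycles g)%N%:Z)
        * f N I lam s
        * cexp P (fun w => tr_half (kreweras g eps s) (fun k => Y k w)).

Definition G_multiplicative (R : realType) (Lam : Type) (PM : premap_data)
    (f : weight_data R Lam) : Prop :=
  forall (N : nat) (I J : {fset nat}) (sJI : (J `<=` I)%fset)
         (lam : I -> Lam) (s : {perm (pmset I)})
         (s1 : {perm (pmset J)}) (s2 : {perm (pmset (I `\` J)%fset)}),
    (0 < N)%N -> 0%N \notin I -> s \in PM I -> not_connecting J s ->
    is_restriction s s1 -> is_restriction s s2 ->
    f N I lam s = f N J (fun k => lam (fincl sJI k)) s1
                  * f N (I `\` J)%fset
                        (fun k => lam (fincl (fsubsetDl I J) k)) s2.

Definition G_empty (R : realType) (Lam : Type) (PM : premap_data)
    (f : weight_data R Lam) : Prop :=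
  PM fset0 = [set 1%g]%SET /\
  (forall (N : nat) (lam : (fset0 : {fset nat}) -> Lam),
     (0 < N)%N -> f N fset0 lam 1%g = 1).

Definition condition_G (R : realType) (d : nat -> measure_display)
    (T : forall N : nat, measurableType (d N))
    (P : forall N : nat, probability (T N) R) (Lam : Type)
    (X : forall N : nat, Lam -> T N -> 'M[R[i]]_N)
    (PM : premap_data) (f : weight_data R Lam) : Prop :=
  [/\ forall N, (0 < N)%N ->
        (forall l, random_matrix (X N l)) /\ all_moments (P N) (X N),
      G_premaps PM /\ G_limits PM f,
      forall N, (0 < N)%N -> G_expansion (P N) (X N) PM f,
      G_multiplicative PM f
    & G_empty PM f].

(** * Words *)

(* [ordS] is the cyclic successor. *)
Definition cyclically_alternating (p C : nat) (w : 'I_p -> 'I_C) : Prop :=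
  forall k, w k != w (ordS k).

(* product of [len] consecutive matrices of one ensemble, or transposes *)
Definition block (F : nzRingType) (N : nat) (Lam : Type) (len : nat)
    (X : Lam -> 'M[F]_N) (eps : 'I_len -> bool) (lam : 'I_len -> Lam) :
    'M[F]_N :=
  \prod_(j < len) sgn_mx (eps j) (X (lam j)).

(* Tr (A°_1 ... A°_p) *)
Definition centered_trace (R : realType) (d : measure_display)
    (T : measurableType d) (P : probability T R) (N p : nat)
    (A : 'I_p -> T -> 'M[R[i]]_N) : T -> R[i] :=
  fun w => \tr (\prod_(k < p) centered P (A k) w).

(* E (tr (A B)) - E (tr A) E (tr B) *)
Definition tr_cov (R : realType) (d : measure_display)
    (T : measurableType d) (P : probability T R) (N : nat)
    (A B : T -> 'M[R[i]]_N) : R[i] :=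
  cexp P (fun w => ntr (A w *m B w))
  - cexp P (fun w => ntr (A w)) * cexp P (fun w => ntr (B w)).

Lemma cyc_idx_subproof (p : nat) (z : int) :
  (0 < p)%N -> (`|((z - 1) %% p%:Z)%Z|%N < p)%N.
Proof.
move=> p0; rewrite -ltz_nat gez0_abs ?modz_ge0 ?ltz_pmod //.
by rewrite eqz_nat -lt0n.
Qed.

(* The element of [p] congruent to [z] modulo [p]; ordinals being numbered
   from 0, the element a of [p] is the ordinal of value a - 1. *)
Definition cyc_idx (p : nat) (p0 : (0 < p)%N) (z : int) : 'I_p :=
  Ordinal (cyc_idx_subproof z p0).

(* Main.v *)
Require Import Defs.
From HB Require Import structures.
From mathcomp Require Import all_boot all_order all_algebra all_fingroup finmap.
From mathcomp Require Import complex zify.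
From mathcomp Require Import all_classical all_reals all_analysis measurable_realfun.

Set Implicit Arguments.
Unset Strict Implicit.
Unset Printing Implicit Defensive.

Import Order.TTheory GRing.Theory Num.Theory.
Import numFieldNormedType.Exports.

Local Open Scope ring_scope.

(** Power counting for sums over premaps.

    Let [L] be the disjoint union of the index sets of the blocks $A_k$ and
    $B_k$.  The block [k] has two ends, its row index [(k, false)] and its
    column index [(k, true)].

    Moments of one ensemble.  Condition (G) is used with $\gamma$ running
    cyclically through each block, and with $Y_k$ the identity except after
    the last factor of a block, where a unit matrix reads off an entry of the
    block ([tr_blocks]).  The traces on the right of (G) become indicators
    that certain ends carry equal indices ([tr_half_units]).  Collecting the
    premaps by their shadows, which record the ties between ends and the
    components of blocks, one gets
      E (prod_k A_k (phi (k, false)) (phi (k, true)))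
        = sum_sh W sh * [phi is constant along the ties of sh].
    Four properties of the weights W matter afterwards, the fields of
    [weights]: this expansion, multiplicativity over disjoint sets of blocks,
    vanishing unless the shadow is valid, and the convergence of
    $N^{|S| + l - 2r} W$, where [r] is the number of components and [l] the
    number of classes of blocks that ties connect.  The last one combines
    Euler's inequality for permutations ([porbits_euler], [chi_bound]) with a
    count of loops ([loops_bound]).  Independence extends the four properties
    to blocks of several colours ([cexp_prod_indep], [colour_weights]).

    Covariance.  Centering the blocks removes the shadows in which a block
    forms a component of its own ([centered_moment]), and subtracting the
    product of the two expectations removes those in which no component meets
    both words ([cov_product]).  A remaining shadow contributes $N^c W$, where
    [c] is the number of classes of indices that its ties leave free
    ([cov_expansion]).

    Power counting.  Two ends at the same index belong to consecutive blocks,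
    of different colours, hence are never tied; so every class of indices has
    at least two elements and $2c \le p + q$.  There are no lone blocks, so
    $2r \le p + q$, and $r \le l$ since ties stay inside components.  The
    exponent $c + 2r - l - (p + q)$ is therefore at most 0 ([excess_le0]).
    Equality forces a perfect matching of the blocks under which neighbours
    are matched with neighbours ([lead_next]).  If some block of the first
    word is matched with a block of the second one, then $p = q$
    ([lead_same_length]) and the matching is one of the $2p$ spoke diagrams
    $i \mapsto k - i$ and $i \mapsto k + i$ ([lead_spoke]).

    Limit.  The weight of a spoke diagram is the product of the weights of its
    pairs ([spoke_term]), and $N$ times the weight of a pair has the same limit
    as the covariance of normalised traces $E(tr(A_i B_j)) - E(tr(A_i))
    E(tr(B_j))$, or the same with $B_j^T$, according to the sense of the spoke
    ([pair_limit]). *)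

(** * Counting classes *)

Lemma even_card_involution (T : finType) (A : {set T}) (g : T -> T) :
  involutive g -> {in A, forall x, (g x \in A) && (g x != x)} -> ~~ odd #|A|.
Proof.
move=> gK; have [n] := ubnP #|A|; elim: n A => // n IH A leA hA.
have [->|[x xA]] := set_0Vmem A; first by rewrite cards0.
have /andP[gxA gxx] := hA x xA.
have cE : #|A| = #|(A :\ x) :\ g x|.+2.
  by rewrite (cardsD1 x A) xA (cardsD1 (g x) (A :\ x)) !inE gxx gxA.
rewrite cE /= negbK; apply: IH => [|y]; first by lia.
rewrite !inE => /and3P[y1 y2 yA]; have /andP[gyA ->] := hA y yA.
rewrite gyA !andbT (inj_eq (can_inj gK)) y2 /=.
by apply: contraNneq y1 => <-; rewrite gK.
Qed.

Lemma porbit_fconnect (T : finType) (s : {perm T}) x y :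
  (y \in porbit s x) = fconnect s x y.
Proof.
apply/porbitP/idP => [[i ->]|/iter_findex <-].
  by rewrite permX fconnect_iter.
by exists (findex s x y); rewrite permX.
Qed.

Lemma card_porbits (T : finType) (s : {perm T}) : #|porbits s| = fcard s T.
Proof.
have ss : connect_sym (frel s) := fconnect_sym (@perm_inj _ s).
have -> : porbits s = porbit s @: [set x | froots s x].
  apply/setP => O; apply/imsetP/imsetP => [[x _ ->]|[x _ ->]]; last by exists x.
  exists (froot s x); first by rewrite inE; apply: roots_root.
  by apply/eqP; rewrite eq_porbit_mem porbit_sym porbit_fconnect connect_root.
rewrite card_in_imset; first by apply: eq_card => x; rewrite !inE andbT.
move=> x y; rewrite !inE => /eqP rx /eqP ry /eqP.
by rewrite eq_porbit_mem porbit_fconnect => /(fingraph.rootP ss); rewrite rx ry => ->.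
Qed.

(** [h] sends distinct classes of [e'] into distinct classes of [e].  All
    comparisons of numbers of classes go through this lemma, [h] being the
    identity, a sign change or a choice of representatives. *)
Lemma n_comp_le (T T' : finType) (e : rel T) (e' : rel T') (a : {pred T})
    (a' : {pred T'}) (h : T' -> T) :
  connect_sym e -> connect_sym e' -> fingraph.closed e a ->
  (forall x, x \in a' -> h x \in a) ->
  {in a' &, forall x y, connect e (h x) (h y) -> connect e' x y} ->
  (n_comp e' a' <= n_comp e a)%N.
Proof.
move=> se se' cl ha hc.
have inj : {in predI (roots e') a' &, injective (fingraph.root e \o h)}.
  move=> x y /andP[/eqP rx ax] /andP[/eqP ry ay] /= /(fingraph.rootP se) /(hc _ _ ax ay).
  by move/(fingraph.rootP se'); rewrite rx ry.
rewrite /n_comp_mem -(card_in_image inj); apply: subset_leq_card.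
apply/fintype.subsetP=> _ /fintype.imageP[x /andP[_ ax] ->] /=.
apply/andP; split; first by rewrite /= roots_root.
by have := ha x ax; rewrite (closed_connect cl (connect_root e _)).
Qed.

Definition joint_orbits (T : finType) (a s : {perm T}) : rel T :=
  relU (frel a) (frel s).

Lemma joint_orbits_sym (T : finType) (a s : {perm T}) :
  connect_sym (joint_orbits a s).
Proof. by apply: relU_sym; apply: fconnect_sym; apply: perm_inj. Qed.

Lemma joint_orbits1 (T : finType) (a s : {perm T}) x :
  connect (joint_orbits a s) x (a x) /\ connect (joint_orbits a s) x (s x).
Proof. by split; apply: connect1; apply/orP; [left|right]; apply: eqxx. Qed.

(** The genus of a pair of permutations is nonnegative.  Write [a = t * b]
    with [t] a transposition that joins two cycles of [b].  If [t] acts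
    inside one joint orbit of [b] and [s], then [a * s] has at most one cycle
    more than [b * s] and the joint orbits are the same; otherwise [t] joins
    two cycles of [b * s] and at most two joint orbits.  In both cases the
    inequality passes from [b] to [a]. *)
Lemma porbits_euler (T : finType) (a s : {perm T}) :
  (#|porbits a| + #|porbits s| + #|porbits (a * s)| <=
   #|T| + 2 * n_comp (joint_orbits a s) T)%N.
Proof.
have lec (b : {perm T}) : (#|porbits b| <= #|T|)%N.
  by rewrite card_porbits; apply: max_card.
have [n] := ubnP (#|T| - #|porbits a|)%N.
elim: n a => // n IH a lea.
have [/forallP a1|] := boolP [forall x, a x == x].
  have -> : a = 1%g by apply/permP => x; rewrite perm1; apply/eqP.
  rewrite mul1g.
  suff le : (#|porbits s| <= n_comp (joint_orbits 1 s) T)%N by have := lec 1%g; lia.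
  rewrite card_porbits; apply: (@n_comp_le _ _ _ _ _ _ id) => //.
  - exact: joint_orbits_sym.
  - exact/fconnect_sym/perm_inj.
  move=> x y _ _; apply: connect_sub => {x y} x y /orP[] /eqP <-.
    by rewrite perm1.
  exact: fconnect1.
move=> /forallPn[x axx]; pose y := a x; pose t := tperm x y; pose b := (t * a)%g.
have xy : x != y by rewrite eq_sym.
have pE : #|porbits b| = (#|porbits a|).+1.
  have := porbits_mul_tperm a x y.
  by rewrite porbit_sym porbit_fconnect fconnect1 xy /= -/b addn0 addn1.
have aE : a = (t * b)%g by rewrite /b mulgA tperm2 mul1g.
have asE : (a * s = t * (b * s))%g by rewrite aE !mulgA.
have lb : (#|T| - #|porbits b| < n)%N by have := lec b; lia.
have {lb}IHb := IH b lb.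
have := porbits_mul_tperm (b * s)%g x y; rewrite /= -/t -asE xy => tE.
have sb := joint_orbits_sym b s; have sa := joint_orbits_sym a s.
have stepP z w : joint_orbits a s z w ->
    connect (joint_orbits b s) z w \/
    ((z \in [:: x; y]) && ((connect (joint_orbits b s) x w) ||
       connect (joint_orbits b s) y w)).
  case/orP => /eqP <-; last by left; apply: (joint_orbits1 b s z).2.
  rewrite aE permM; have bc u : connect (joint_orbits b s) u (b u).
    exact: (joint_orbits1 b s u).1.
  by rewrite /t; case: tpermP => [->|->|_ _]; [right|right|left];
     rewrite ?inE ?eqxx ?bc ?orbT ?bc.
have [cxy|ncxy] := boolP (connect (joint_orbits b s) x y).
  have le : (n_comp (joint_orbits b s) T <= n_comp (joint_orbits a s) T)%N; last first.
    have h : (#|porbits (a * s)| <= #|porbits (b * s)| + 1)%N by rewrite -tE leq_addr.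
    have ar (pa ps pb pbs pas T0 nb na : nat) : pb = pa.+1 -> (pas <= pbs + 1)%N ->
      (nb <= na)%N -> (pb + ps + pbs <= T0 + 2 * nb)%N ->
      (pa + ps + pas <= T0 + 2 * na)%N by lia.
    exact: ar pE h le IHb.
  apply: (@n_comp_le _ _ _ _ _ _ id) => // u v _ _.
  apply: connect_sub => {u v} z w /stepP [//|/andP[]].
  rewrite !inE => /orP[]/eqP-> /orP[]; rewrite -/y => h //.
    by apply: connect_trans h.
  by rewrite sb in cxy; apply: connect_trans h.
have nx : x \notin porbit (b * s)%g y.
  apply: contra ncxy; rewrite porbit_sym porbit_fconnect.
  apply: connect_sub => u v /eqP <-; rewrite permM.
  by apply: (connect_trans (joint_orbits1 b s u).1); apply: (joint_orbits1 b s _).2.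
rewrite nx /= in tE.
have le : (n_comp (joint_orbits b s) T <= (n_comp (joint_orbits a s) T).+1)%N; last first.
  have h : (#|porbits (a * s)| + 2 = #|porbits (b * s)| + 1)%N by exact: tE.
  have ar (pa ps pb pbs pas T0 nb na : nat) : pb = pa.+1 -> (pas + 2 = pbs + 1)%N ->
    (nb <= na.+1)%N -> (pb + ps + pbs <= T0 + 2 * nb)%N ->
    (pa + ps + pas <= T0 + 2 * na)%N by lia.
  exact: ar pE h le IHb.
rewrite (n_compC (connect (joint_orbits b s) x)) n_comp_connect // add1n ltnS.
pose m z := connect (joint_orbits b s) x z || connect (joint_orbits b s) y z.
have cP z w : connect (joint_orbits a s) z w ->
    connect (joint_orbits b s) z w \/ m z /\ m w.
  case/connectP => p; elim: p z => [z _ -> |u p IHp z /=]; first by left.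
  case/andP => /stepP zu pp wE.
  have {}IHp := IHp u pp wE.
  have mtr u1 u2 : connect (joint_orbits b s) u1 u2 -> m u1 = m u2.
    by move=> h; rewrite /m !(same_connect_r sb h).
  case: zu => [zu|/andP[zxy mu]].
    case: IHp => [uw|[mu mw]]; first by left; apply: connect_trans uw.
    by right; rewrite (mtr _ _ zu).
  have mz : m z by move: zxy; rewrite !inE /m => /orP[]/eqP->; rewrite connect0 ?orbT.
  case: IHp => [uw|[_ mw]]; last by right.
  by right; split=> //; rewrite -(mtr _ _ uw).
apply: (@n_comp_le _ _ _ _ _ _ id) => // u v /negbTE nu /negbTE nv /cP[//|[]].
have {}nu : connect (joint_orbits b s) x u = false := nu.
have {}nv : connect (joint_orbits b s) x v = false := nv.
by rewrite /m nu nv /= sb => yu yv; apply: connect_trans yv.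
Qed.

(** A premap and the sign change generate this relation: its classes are the
    cycles of the premap up to sign, two cycles for each class. *)
Definition fold_rel (T : finType) (s dl : T -> T) : rel T :=
  relU (frel s) (frel dl).

Section DoubleCover.
Variables (T : finType) (s : {perm T}) (dl : T -> T).
Hypotheses (dlK : involutive dl) (sdl : forall x, s (dl (s x)) = dl x).

Lemma fold_rel_sym : connect_sym (fold_rel s dl).
Proof.
apply: relU_sym; first exact/fconnect_sym/perm_inj.
exact/fconnect_sym/(can_inj dlK).
Qed.

Let ss : connect_sym (frel s) := fconnect_sym (@perm_inj _ s).

Lemma fconnect_fold x y : fconnect s (dl x) (dl y) = fconnect s x y.
Proof.
have imp u v : fconnect s u v -> fconnect s (dl u) (dl v).
  move=> /iter_findex <-; elim: (findex s u v) => [|i IH] /=; first exact: connect0.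
  apply: connect_trans IH _; rewrite ss; apply: connect1 => /=.
  by rewrite sdl.
by apply/idP/idP => /imp; rewrite ?dlK.
Qed.

Lemma fold_connect x y :
  connect (fold_rel s dl) x y = fconnect s x y || fconnect s (dl x) y.
Proof.
apply/idP/orP => [/connectP[p]|].
  elim: p x => [x _ ->|z p IH x /= /andP[xz pz yE]]; first by left; apply: connect0.
  have {}IH := IH z pz yE; case/orP: xz => /eqP zE; rewrite -{z}zE in pz yE IH *.
    case: IH => [h|h]; [left|right]; first exact: connect_trans (fconnect1 s x) h.
    by apply: connect_trans h; rewrite fconnect_fold fconnect1.
  by case: IH => h; [right|left; rewrite dlK in h].
have sub u v : fconnect s u v -> connect (fold_rel s dl) u v.
  by apply: connect_sub => {u v} u v uv; apply: connect1; apply/orP; left.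
case=> /sub // h; apply: connect_trans h; apply: connect1.
by apply/orP; right; apply: eqxx.
Qed.

Hypotheses (dl_neq : forall x, dl x != x) (s_neq : forall x, s x != dl x).

(** If [iter n.+2 s x = dl x], then [iter n s (s x) = dl (s x)]: the path from
    [x] to [dl x] loses a step at both ends, until its length is 0 or 1. *)
Lemma fold_disjoint x : fconnect s x (dl x) = false.
Proof.
apply/negP => /iter_findex; set n := findex _ _ _; move: n => n.
have sdl' y : dl (s y) = (s^-1)%g (dl y) by apply: (@perm_inj _ s); rewrite permKV sdl.
elim/ltn_ind: n x => -[|[|n]] IH x /=.
- by move=> h; move: (dl_neq x); rewrite -h eqxx.
- by move=> h; move: (s_neq x); rewrite -h eqxx.
move=> h; apply: (IH n _ (s x)) => //.
by rewrite sdl' -h -iterSr /= permK.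
Qed.

Lemma fcard_fold : fcard s T = (n_comp (fold_rel s dl) T).*2.
Proof.
rewrite /n_comp_mem -muln2.
pose r := froot s.
have sf := fold_rel_sym.
have -> : #|predI (froots s) T| =
    (\sum_(x in predI (froots s) T) 1)%N by rewrite sum1_card.
rewrite (partition_big (fingraph.root (fold_rel s dl))
  (mem (predI (fingraph.roots (fold_rel s dl)) T))) /=; last first.
  by move=> x _; apply/andP; split=> //; apply: roots_root.
rewrite -sum_nat_const; apply: eq_bigr => x /andP[/eqP rx _].
rewrite -[RHS](_ : #|[set r x; r (dl x)]| = 2)%N; last first.
  rewrite cards2; case: eqP => //= /(fingraph.rootP ss).
  by rewrite fold_disjoint.
rewrite -sum1_card; apply: eq_bigl => y; rewrite !inE.
apply/andP/orP => [[/andP[/eqP ry _] /eqP rE]|].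
  move: (connect_root (fold_rel s dl) y); rewrite rE sf fold_connect.
  by case/orP => /(fingraph.rootP ss); rewrite ry /r => <-; rewrite eqxx; [left|right].
move=> yE; have : froots s y by case: yE => /eqP->; apply: roots_root.
move=> -> ; split=> //; rewrite -rx; apply/eqP/(fingraph.rootP sf).
rewrite sf fold_connect.
by case: yE => /eqP->; rewrite connect_root ?orbT.
Qed.

End DoubleCover.

Definition unmarked (T : finType) (e : rel T) (A : {pred T}) : {pred T} :=
  [pred x | [forall a in A, ~~ connect e x a]].

Lemma unmarked_closed (T : finType) (e : rel T) (A : {pred T}) :
  connect_sym e -> fingraph.closed e (unmarked e A).
Proof.
move=> se x y xy; rewrite !inE; apply: eq_forallb => a.
by rewrite (same_connect1 se xy).
Qed.

Lemma n_comp_sum (T T1 T2 : finType) (h1 : T1 -> T) (h2 : T2 -> T)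
    (e : rel T) (e1 : rel T1) (e2 : rel T2) (P : {pred T}) :
  connect_sym e -> connect_sym e1 -> connect_sym e2 ->
  injective h1 -> injective h2 -> fingraph.closed e (codom h1) ->
  (forall x, (x \in codom h2) = (x \notin codom h1)) ->
  (forall x y, e (h1 x) (h1 y) = e1 x y) ->
  (forall x y, e (h2 x) (h2 y) = e2 x y) -> fingraph.closed e P ->
  n_comp e P = (n_comp e1 [preim h1 of P] + n_comp e2 [preim h2 of P])%N.
Proof.
move=> se se1 se2 i1 i2 cl1 cl2 E1 E2 clP.
pose P1 := [predI P & codom h1]; pose P2 := [predI P & codom h2].
have c1 : fingraph.closed e P1.
  by move=> x y xy; rewrite !inE (clP x y) // (cl1 x y).
have c2 : fingraph.closed e P2.
  by move=> x y xy; rewrite !inE (clP x y) // !cl2 (cl1 x y).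
have -> : n_comp e P = (n_comp e P1 + n_comp e P2)%N.
  rewrite /n_comp_mem -(cardID (mem (codom h1)) (predI _ P)); congr (_ + _)%N;
    apply: eq_card => x; rewrite !inE ?cl2; first by rewrite -andbA.
  by rewrite andbC -andbA.
have a1 := @strict_adjunction _ _ h1 e e1 se1 P1 c1 i1.
have a2 := @strict_adjunction _ _ h2 e e2 se2 P2 c2 i2.
rewrite (@adjunction_n_comp _ _ _ _ _ se se1 _ c1 (a1 _ _)); last first.
- by move=> x y _; rewrite E1.
- by apply/fintype.subsetP => x /andP[].
rewrite (@adjunction_n_comp _ _ _ _ _ se se2 _ c2 (a2 _ _)); last first.
- by move=> x y _; rewrite E2.
- by apply/fintype.subsetP => x /andP[].
by congr (_ + _)%N; apply: eq_n_comp_r => x; rewrite !inE codom_f andbT.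
Qed.

(** A map that is constant on the classes and prescribed on [A] is free on
    the classes that avoid [A], and only there. *)
Lemma card_class_maps (T : finType) (e : rel T) (A : {pred T}) (N : nat)
    (psi : T -> 'I_N) :
  connect_sym e -> (0 < N)%N ->
  #|[set phi : {ffun T -> 'I_N} | [forall x, forall y, e x y ==> (phi x == phi y)]
       && [forall x in A, phi x == psi x]]| =
  if [forall x in A, forall y in A, connect e x y ==> (psi x == psi y)]
  then (N ^ n_comp e (unmarked e A))%N else 0%N.
Proof.
move=> se N0; case: ifP => [/forall_inP cpt|/negbT ncpt]; last first.
  apply: eq_card0 => phi; rewrite !inE; apply: contraNF ncpt => /andP[/forallP h /forall_inP h'].
  apply/forall_inP => x xA; apply/forall_inP => y yA; apply/implyP => xy.
  rewrite -(eqP (h' x xA)) -(eqP (h' y yA)).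
  case/connectP: xy => p; elim: p x {xA} => [x _ -> //|z p IH x /= /andP[xz pz] yE].
  by rewrite (eqP (implyP (forallP (h x) z) xz)) IH.
pose i0 := Ordinal N0.
pose D := [pred x | fingraph.roots e x & unmarked e A x].
rewrite -[in RHS](card_ord N) -[n_comp e _](_ : #|D| = _) //.
rewrite -(card_pffun_on i0 D predT).
pose ext (f : {ffun T -> 'I_N}) := [ffun x => if [pick a | (a \in A) && connect e x a]
  is Some a then psi a else f (fingraph.root e x)].
have extA f x : x \in A -> ext f x = psi x.
  move=> xA; rewrite ffunE; case: pickP => [a /andP[aA xa]|/(_ x)]; last first.
    by rewrite xA connect0.
  by apply/esym/eqP; have /forall_inP/(_ a aA)/implyP := cpt x xA; apply.
have extD f x : D x -> ext f x = f x.
  case/andP => /eqP rx /forall_inP un; rewrite ffunE; case: pickP => [a|]; last by rewrite rx.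
  by case/andP => /un /negbTE ->.
have inj : {in pffun_on i0 D predT &, injective ext}.
  move=> f g /pffun_onP[fD _] /pffun_onP[gD _] fg; apply/ffunP => x.
  have [xD|xD] := boolP (D x); first by rewrite -(extD f) // -(extD g) // fg.
  have off (k : {ffun T -> 'I_N}) : i0.-support k \subset D -> k x = i0.
    move=> /fintype.subsetP/(_ x); rewrite !inE => kD; apply/eqP/negPn/negP => /kD.
    by move=> h; case/negP: xD.
  by rewrite !off.
rewrite -(card_in_image inj); apply: eq_card => phi; apply/idP/fintype.imageP.
  rewrite inE => /andP[/forallP h /forall_inP h'].
  exists [ffun x => if D x then phi x else i0].
    apply/pffun_onP; split=> //; apply/fintype.subsetP => x; rewrite !inE ffunE.
    by case: ifP => //; rewrite eqxx.
  have cst x y : connect e x y -> phi x = phi y.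
    case/connectP => p; elim: p x => [x _ -> //|z p IH x /= /andP[xz pz] yE].
    by rewrite (eqP (implyP (forallP (h x) z) xz)) IH.
  apply/ffunP => x; rewrite ffunE; case: pickP => [a /andP[aA xa]|un].
    by rewrite (cst _ _ xa); apply/eqP; apply: h'.
  rewrite ffunE ifT; first by apply: cst; apply: connect_root.
  apply/andP; split; first exact: roots_root.
  apply/forall_inP => a aA; have := un a; rewrite aA /= => /negbT.
  by rewrite (same_connect se (connect_root e x)).
case=> f _ ->; rewrite inE; apply/andP; split; last first.
  by apply/forall_inP => x xA; rewrite extA.
apply/forallP => x; apply/forallP => y; apply/implyP => xy; rewrite !ffunE.
have rxy : fingraph.root e x = fingraph.root e y by apply/(fingraph.rootP se)/connect1.
have pE : (fun a => (a \in A) && connect e x a) =1 (fun a => (a \in A) && connect e y a).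
  by move=> a; rewrite (same_connect1 se xy).
by rewrite (eq_pick pE) rxy.
Qed.

(** * Traces along permutations as sums over index maps *)

Lemma in_bigcup_seq (T : finType) (r : seq {set T}) x :
  (x \in \bigcup_(A <- r) A) = has (fun A : {set T} => x \in A) r.
Proof. by elim: r => [|A r IH]; rewrite ?big_nil ?big_cons !inE // IH. Qed.

Section IndexSums.
Variables (F : fieldType) (N : nat) (T : finType) (M : T -> 'M[F]_N) (i0 : 'I_N).

(** Index maps live on all of [T] and take a default value outside [A]: sums
    over index maps of disjoint sets then multiply inside one type. *)
Definition supported (A : {pred T}) : {set {ffun T -> 'I_N}} :=
  [set phi : {ffun T -> 'I_N} | [forall x, (x \notin A) ==> (phi x == i0)]].

Definition update (phi : {ffun T -> 'I_N}) (y : T) (v : 'I_N) : {ffun T -> 'I_N} :=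
  [ffun x => if x == y then v else phi x].

Lemma eq_supported (A B : {pred T}) : A =i B -> supported A = supported B.
Proof.
by move=> AB; apply/setP => phi; rewrite !inE; apply: eq_forallb => x; rewrite AB.
Qed.

Lemma supported_out (A : {pred T}) phi x : phi \in supported A -> x \notin A -> phi x = i0.
Proof. by rewrite inE => /forallP/(_ x)/implyP h /h /eqP. Qed.

Lemma sum_supported_cons (y : T) (c : seq T) (G : {ffun T -> 'I_N} -> F) :
  y \notin c ->
  \sum_(phi in supported (mem (y :: c))) G phi =
  \sum_v \sum_(phi in supported (mem c)) G (update phi y v).
Proof.
move=> yc; rewrite (partition_big (fun phi : {ffun T -> 'I_N} => phi y) predT) //=.
apply: eq_bigr => v _.
rewrite (reindex_onto (fun phi => update phi y v) (fun phi => update phi y i0)) /=; last first.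
  move=> phi /andP[_ /eqP pv]; apply/ffunP => x; rewrite !ffunE.
  by case: eqP => [->|].
apply: eq_bigl => phi; apply/andP/idP => [[/andP[h _] /eqP pE]|h].
  rewrite inE; apply/forallP => x; apply/implyP => xc.
  have [->|xy] := eqVneq x y; first by rewrite -pE !ffunE eqxx.
  rewrite -pE !ffunE (negbTE xy).
  by have := supported_out h (x := x); rewrite ffunE (negbTE xy) inE (negbTE xy) /= => /(_ xc)->.
split; last first.
  by apply/eqP/ffunP => x; rewrite !ffunE; case: eqP => [->|//]; rewrite (supported_out h).
apply/andP; split; last by rewrite ffunE eqxx.
rewrite inE; apply/forallP => x; apply/implyP; rewrite inE ffunE negb_or.
by case/andP => /negbTE-> xc; apply/eqP; apply: supported_out h xc.
Qed.

Lemma supported_nil : supported (mem [::]) = [set [ffun=> i0]].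
Proof.
apply/setP => phi; rewrite !inE; apply/forallP/eqP => [h|-> x]; last by rewrite ffunE eqxx.
by apply/ffunP => x; rewrite ffunE; apply/eqP/(implyP (h x)).
Qed.

Definition local_on (A : {pred T}) (G : {ffun T -> 'I_N} -> F) :=
  forall phi phi' : {ffun T -> 'I_N}, {in A, phi =1 phi'} -> G phi = G phi'.

Lemma update_out (phi : {ffun T -> 'I_N}) y v (c : {pred T}) :
  y \notin c -> {in c, update phi y v =1 phi}.
Proof. by move=> yc x xc; rewrite ffunE; case: eqP => // xy; rewrite xy (negbTE yc) in xc. Qed.

Lemma sum_supported_cat (c d : seq T) (G H : {ffun T -> 'I_N} -> F) :
  uniq (c ++ d) -> local_on (mem c) G -> local_on (mem d) H ->
  (\sum_(phi in supported (mem c)) G phi) * (\sum_(phi in supported (mem d)) H phi) =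
  \sum_(phi in supported (mem (c ++ d))) G phi * H phi.
Proof.
elim: c G => [|y c IH] G.
  move=> _ lG _; rewrite supported_nil big_set1 mulr_sumr; apply: eq_bigr => phi _.
  by congr (_ * _); apply: lG.
rewrite cat_cons [uniq _]/= => /andP[ycd u] lG lH.
have [yc yd] : y \notin c /\ y \notin d by move: ycd; rewrite mem_cat => /norP.
rewrite !sum_supported_cons // mulr_suml; apply: eq_bigr => v _.
rewrite IH //; first by apply: eq_bigr => phi _; congr (_ * _); apply: lH => x xd;
  rewrite (update_out _ _ yd).
move=> phi phi' pp; apply: lG => x; rewrite inE !ffunE; case: eqP => //= _ xc.
exact: pp.
Qed.

Definition next_index (phi : {ffun T -> 'I_N}) (c : seq T) (b : 'I_N) :=
  if c is y :: _ then phi y else b.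

Fixpoint walk (phi : {ffun T -> 'I_N}) (c : seq T) (b : 'I_N) : F :=
  if c is x :: c' then M x (phi x) (next_index phi c' b) * walk phi c' b else 1.

Lemma walk_local (phi phi' : {ffun T -> 'I_N}) c b :
  {in c, phi =1 phi'} ->
  next_index phi c b = next_index phi' c b /\ walk phi c b = walk phi' c b.
Proof.
elim: c => //= x c IH pp; rewrite pp ?inE ?eqxx //.
by have [|-> ->] := IH; first by move=> y yc; apply: pp; rewrite inE yc orbT.
Qed.

Lemma prod_entry x c a b : uniq (x :: c) ->
  (M x *m \prod_(y <- c) M y) a b =
  \sum_(phi in supported (mem c)) M x a (next_index phi c b) * walk phi c b.
Proof.
elim: c x a => [|y c IH] x a.
  by rewrite supported_nil big_set1 big_nil mulr1 /= mulmx1.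
move=> /= /andP[_ /andP[yc u]].
rewrite big_cons mxE sum_supported_cons //; apply: eq_bigr => v _.
rewrite IH /= ?yc // mulr_sumr; apply: eq_bigr => phi _.
have [-> ->] := walk_local b (update_out phi v yc).
by rewrite ffunE eqxx.
Qed.

Lemma walk_cycle (g : T -> T) (phi : {ffun T -> 'I_N}) x c z : path (frel g) x (rcons c z) ->
  M x (phi x) (next_index phi c (phi z)) * walk phi c (phi z) =
  \prod_(y <- x :: c) M y (phi y) (phi (g y)).
Proof.
elim: c x => [|y c IH] x /=; first by rewrite andbT big_seq1 mulr1 => /eqP->.
by case/andP => /eqP gx /IH ->; rewrite [in RHS]big_cons gx.
Qed.

Lemma tr_cycle (g : T -> T) c : uniq c -> fcycle g c -> c != [::] ->
  \tr (\prod_(x <- c) M x) =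
  \sum_(phi in supported (mem c)) \prod_(x <- c) M x (phi x) (phi (g x)).
Proof.
case: c => // x c u gc _; rewrite big_cons /mxtrace.
move: (u) => /= /andP[xc _].
rewrite sum_supported_cons //; apply: eq_bigr => a _.
rewrite prod_entry //; apply: eq_bigr => phi _.
rewrite -(walk_cycle _ gc).
have [-> ->] := walk_local (update phi x a x) (update_out phi a xc).
by rewrite !ffunE eqxx.
Qed.

Lemma prod_sum_supported (r : seq {set T}) (G : {set T} -> {ffun T -> 'I_N} -> F) :
  uniq r -> (forall A B : {set T}, A \in r -> B \in r -> A != B -> [disjoint A & B]) ->
  (forall A, A \in r -> local_on (mem A) (G A)) ->
  \prod_(A <- r) \sum_(phi in supported (mem A)) G A phi =
  \sum_(phi in supported (mem (\bigcup_(A <- r) A))) \prod_(A <- r) G A phi.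
Proof.
elim: r => [|A r IH] /=.
  move=> _ _ _; rewrite !big_nil (eq_supported (B := mem [::])).
    by rewrite supported_nil big_set1 big_nil.
  by move=> x; rewrite !inE.
case/andP => Ar u dis loc.
rewrite !big_cons IH //; last 2 first.
- by move=> B C Br Cr; apply: dis; rewrite inE ?Br ?Cr orbT.
- by move=> B Br; apply: loc; rewrite inE Br orbT.
set U := \bigcup_(B <- r) B.
have dAU : [disjoint A & U].
  apply/pred0P => x /=; apply/negP => /andP[xA].
  rewrite in_bigcup_seq => /hasP[B Br xB].
  have AB : A != B by apply: contraNneq Ar => ->.
  have := dis A B; rewrite !inE eqxx Br orbT => /(_ isT isT AB).
  by move/pred0P/(_ x); rewrite /= xA xB.
have uE : uniq (enum A ++ enum U).
  rewrite cat_uniq !enum_uniq /= andbT; apply/hasPn => x; rewrite mem_enum => xU.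
  by rewrite /= mem_enum (disjointFl dAU xU).
rewrite (@eq_supported (mem A) (mem (enum A))); last by move=> x; rewrite /= mem_enum.
rewrite (@eq_supported (mem U) (mem (enum U))); last by move=> x; rewrite /= mem_enum.
rewrite sum_supported_cat //.
- rewrite (@eq_supported (mem (A :|: U)) (mem (enum A ++ enum U))).
    by apply: eq_bigr => phi _; rewrite big_cons.
  by move=> x; rewrite !inE mem_cat !mem_enum.
- move=> phi phi' pp; apply: loc; first by rewrite inE eqxx.
  by move=> x xA; apply: pp; rewrite /= mem_enum.
move=> phi phi' pp; rewrite big_seq [RHS]big_seq; apply: eq_bigr => B Br.
apply: loc; first by rewrite inE Br orbT.
move=> x xB; apply: pp; rewrite /= mem_enum /U.
by rewrite in_bigcup_seq; apply/hasP; exists B.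
Qed.

End IndexSums.

Lemma cycle_seqP (T : finType) (s : {perm T}) O : O \in porbits s ->
  [/\ uniq (cycle_seq s O), fcycle s (cycle_seq s O), cycle_seq s O != [::]
    & cycle_seq s O =i O].
Proof.
case/imsetP => x0 _ ->; rewrite /cycle_seq; case: pickP => [x|/(_ x0)]; last first.
  by rewrite porbit_id.
move=> /= xO; split.
- exact: orbit_uniq.
- exact/cycle_orbit/perm_inj.
- by rewrite -size_eq0 size_orbit -lt0n fingraph.order_gt0.
move=> y; rewrite -fconnect_orbit -porbit_fconnect.
by move: xO; rewrite -eq_porbit_mem => /eqP->.
Qed.

Lemma tr_along_sum (F : fieldType) (N : nat) (i0 : 'I_N) (T : finType)
    (s : {perm T}) (D : {set T}) (M : T -> 'M[F]_N) :
  (forall x, (s x \in D) = (x \in D)) ->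
  tr_along s D M =
  N%:R ^- #|[set O in porbits s | O \subset D]| *
  \sum_(phi in supported i0 (mem D)) \prod_(x in D) M x (phi x) (phi (s x)).
Proof.
move=> sD.
pose Q := [set O in porbits s | O \subset D].
have QE : tr_along s D M = \prod_(O in Q) ntr (\prod_(x <- cycle_seq s O) M x).
  by apply: eq_bigl => O; rewrite inE.
rewrite QE /ntr big_split /= prodr_const exprVn; congr (_ * _).
pose G (O : {set T}) (phi : {ffun T -> 'I_N}) := \prod_(x in O) M x (phi x) (phi (s x)).
have porbE O x : O \in porbits s -> (s x \in O) = (x \in O).
  case/imsetP => y _ ->; rewrite !porbit_fconnect.
  by rewrite (same_connect1r (fconnect_sym (@perm_inj _ s)) (y := s x)) //=.
transitivity (\prod_(O in Q) \sum_(phi in supported i0 (mem O)) G O phi).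
  apply: eq_bigr => O; rewrite inE => /andP[OQ _].
  have [u fc nn mE] := cycle_seqP OQ.
  rewrite (tr_cycle M i0 u fc nn) (eq_supported _ (B := mem O)); last by move=> x; apply: mE.
  apply: eq_bigr => phi _; rewrite /G big_uniq //=.
  by apply: eq_bigl => x; rewrite mE.
rewrite -big_enum prod_sum_supported ?enum_uniq //; last 2 first.
- move=> A B; rewrite !mem_enum !inE => /andP[/imsetP[x _ ->] _] /andP[/imsetP[y _ ->] _].
  apply: contraNT => /pred0Pn[z /andP[/= zx zy]].
  move: zx zy; rewrite -!eq_porbit_mem => /eqP <- /eqP <-; exact: eqxx.
- move=> A; rewrite mem_enum inE => /andP[AQ _] phi phi' pp.
  apply: eq_bigr => x xA; rewrite (pp x) // (pp (s x)) //=.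
  by rewrite porbE.
have UE : \bigcup_(A <- enum Q) A = D.
  rewrite big_enum; apply/setP => x; apply/finset.bigcupP/idP => [[B BQ]|xD].
    by move: BQ; rewrite inE => /andP[_ /fintype.subsetP h] /h.
  exists (porbit s x); last exact: porbit_id.
  rewrite inE; apply/andP; split; first exact: imset_f.
  apply/fintype.subsetP => y /porbitP[i ->]; elim: i => [|i IH]; first by rewrite expg0 perm1.
  by rewrite expgSr permM sD.
rewrite UE; apply: eq_bigr => phi _.
have tri : finset.trivIset Q.
  apply/finset.trivIsetP => A B; rewrite !inE => /andP[/imsetP[x _ ->] _] /andP[/imsetP[y _ ->] _].
  apply: contraNT => /pred0Pn[z /andP[/= zx zy]].
  by move: zx zy; rewrite -!eq_porbit_mem => /eqP <- /eqP <-; apply: eqxx.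
rewrite big_enum /G /= -(finset.big_trivIset _ tri) /=.
by apply: eq_bigl => x; rewrite /finset.cover -UE big_enum.
Qed.

(** * Traces along half of a premap *)

Definition flip (A : Type) (x : A * bool) : A * bool := (x.1, ~~ x.2).

Lemma flipK (A : Type) : involutive (@flip A).
Proof. by case=> a b; rewrite /flip /= negbK. Qed.

Lemma flip_neq (A : eqType) (x : A * bool) : flip x != x.
Proof. by case: x => a []; rewrite /flip xpair_eqE andbF. Qed.

Lemma card_porbits_in (T : finType) (s : {perm T}) (D : {set T}) :
  (forall x, (s x \in D) = (x \in D)) ->
  #|[set A in porbits s | A \subset D]| = fcard s D.
Proof.
move=> sD; have ss : connect_sym (frel s) := fconnect_sym (@perm_inj _ s).
have cl : fingraph.closed (frel s) D by move=> x _ /eqP <-; rewrite sD.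
have -> : [set A in porbits s | A \subset D] = porbit s @: [set x in D | froots s x].
  apply/setP => A; rewrite inE; apply/andP/imsetP => [[/imsetP[x _ ->] /fintype.subsetP xD]|[x]].
    exists (froot s x).
      rewrite inE; apply/andP; split; last exact: roots_root.
      by apply: xD; rewrite porbit_fconnect connect_root.
    by apply/eqP; rewrite eq_porbit_mem porbit_sym porbit_fconnect connect_root.
  rewrite inE => /andP[xD _] ->; split; first exact: imset_f.
  apply/fintype.subsetP => y; rewrite porbit_fconnect => xy.
  by rewrite -(closed_connect cl xy).
rewrite card_in_imset; first by apply: eq_card => x; rewrite !inE andbC.
move=> x y; rewrite !inE => /andP[_ /eqP rx] /andP[_ /eqP ry] /eqP.
by rewrite eq_porbit_mem porbit_fconnect => /(fingraph.rootP ss); rewrite rx ry => ->.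
Qed.

(** The ties between indices when [Y k] is the identity outside [sp]: the
    trace ties [x] to [s (flip x)], an identity matrix ties [x] to
    [flip x]. *)
Definition strand_rel (A : finType) (sp : pred A) (s : A * bool -> A * bool) :
    rel (A * bool)%type :=
  fun x y => (y == s (flip x)) || (~~ sp x.1 && (y == flip x)).

Section Half.
Variables (I : {fset nat}) (s : {perm (pmset I)}).
Hypotheses (sfl : forall x, s (flip (s x)) = flip x)
  (s_neq : forall x, s x != flip x).

Let ss : connect_sym (frel s) := fconnect_sym (@perm_inj _ s).
Let fneq (x : pmset I) : flip x != x := flip_neq x.

Lemma half_dom_perm x : (s x \in half_dom s) = (x \in half_dom s).
Proof.
rewrite !inE; congr (particular _); apply/eqP.
by rewrite eq_porbit_mem porbit_fconnect fconnect1.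
Qed.

(** A cycle and its opposite are different by [fold_disjoint], and their
    elements of smallest absolute value are opposite, so that exactly one of
    the two cycles is particular. *)
Lemma half_dom_flip x : (flip x \in half_dom s) = (x \notin half_dom s).
Proof.
have disj (y : pmset I) : fconnect s y (flip y) = false.
  exact: (fold_disjoint sfl fneq s_neq y).
have ff u v : fconnect s (flip u) v = fconnect s u (flip v).
  by rewrite -[v in LHS]flipK (fconnect_fold (@flipK _) sfl).
have x0 : x \in porbit s x by rewrite porbit_id.
rewrite !inE.
case: (@arg_minnP _ x [in porbit s x] (fun y : pmset I => val y.1) x0) => z zx zmin.
rewrite porbit_fconnect in zx.
have zmin' y : fconnect s x y -> (val z.1 <= val y.1)%N.
  by move=> xy; apply: zmin; rewrite porbit_fconnect.
(* The element of smallest absolute value is unique up to sign, and its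
   opposite lies in another cycle: its sign decides. *)
have key : particular (porbit s x) = ~~ z.2.
  apply/exists_inP/idP => [[w]|z2].
    rewrite porbit_fconnect => xw /andP[w2 /forall_inP wmin].
    have le1 : (val w.1 <= val z.1)%N by apply: wmin; rewrite porbit_fconnect.
    have /val_inj e1 : val w.1 = val z.1.
      by apply/eqP; rewrite eqn_leq le1 zmin'.
    apply/negP => z2; move: xw; have -> : w = flip z.
      by rewrite (surjective_pairing w) e1 /flip z2 (negbTE w2).
    by rewrite (same_connect ss zx) disj.
  exists z; first by rewrite porbit_fconnect.
  by rewrite z2 /=; apply/forall_inP => y; rewrite porbit_fconnect => /zmin'.
rewrite key negbK; apply/exists_inP/idP => [[w]|z2].
  rewrite porbit_fconnect ff => xw /andP[w2 /forall_inP wmin].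
  have le1 : (val w.1 <= val z.1)%N.
    by apply: (wmin (flip z)); rewrite porbit_fconnect ff flipK.
  have /val_inj e1 : val w.1 = val z.1.
    by apply/eqP; rewrite eqn_leq le1 (zmin' _ xw).
  apply/negPn/negP => z2; move: xw; have -> : w = z.
    by rewrite (surjective_pairing w) (surjective_pairing z) e1 (negbTE w2) (negbTE z2).
  by rewrite (same_connect ss zx) disj.
exists (flip z); first by rewrite porbit_fconnect ff flipK.
rewrite /flip /= z2 /=; apply/forall_inP => y; rewrite porbit_fconnect ff => h.
exact: (zmin' _ h).
Qed.

Lemma card_half_porbits :
  (#|[set A in porbits s | A \subset half_dom s]|).*2 = ncycles s.
Proof.
rewrite card_porbits_in; last exact: half_dom_perm.
rewrite /ncycles card_porbits (n_compC (mem (half_dom s))) -addnn; congr (_ + _)%N.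
have cl : fingraph.closed (frel s) (half_dom s) by move=> x _ /eqP <-; rewrite half_dom_perm.
have cl' : fingraph.closed (frel s) [predC half_dom s] by apply: predC_closed.
have inv : {in [predC half_dom s], forall x, flip x \in half_dom s}.
  by move=> x xD; rewrite half_dom_flip; exact: xD.
have inv' : {in half_dom s, forall x, flip x \in [predC half_dom s]}.
  by move=> x xD; change (flip x \notin half_dom s); rewrite half_dom_flip negbK.
apply/eqP; rewrite eqn_leq; apply/andP; split;
  by apply: (@n_comp_le _ _ _ _ _ _ (@flip I)) => // x y _ _;
     rewrite (fconnect_fold (@flipK _) sfl).
Qed.

(** An index map that is free on the particular cycles extends to the other
    half in one way, by [phi (s x) = phi (flip x)]; the indices of a
    transposed factor become those of the factor itself. *)
Lemma tr_half_sum (F : fieldType) (N : nat) (i0 : 'I_N) (Y : I -> 'M[F]_N) :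
  tr_half s Y = N%:R ^- (ncycles s)./2 *
   \sum_(phi : {ffun pmset I -> 'I_N} | [forall x, phi (s x) == phi (flip x)])
     \prod_k Y k (phi (k, false)) (phi (k, true)).
Proof.
rewrite /tr_half (tr_along_sum i0) //; last exact: half_dom_perm.
rewrite -card_half_porbits doubleK; congr (_ * _).
rewrite (reindex_onto
  (fun phi : {ffun pmset I -> 'I_N} => [ffun x => if x \in half_dom s then phi x else i0])
  (fun phi : {ffun pmset I -> 'I_N} => [ffun x => if x \in half_dom s then phi x
                                                 else phi (s (flip x))])) /=; last first.
  move=> phi h; apply/ffunP => x; rewrite !ffunE.
  case: ifP => xD; first by rewrite ?xD.
  by rewrite (supported_out h (x := x)) //= xD.
have outside (phi : {ffun pmset I -> 'I_N}) :
    [ffun x => if x \in half_dom s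
       then [ffun x => if x \in half_dom s then phi x else i0] x
       else [ffun x => if x \in half_dom s then phi x else i0] (s (flip x))] = phi ->
    forall x, x \notin half_dom s -> phi x = phi (s (flip x)).
  move=> pE x xD; have := congr1 (fun g : {ffun pmset I -> 'I_N} => g x) pE.
  by rewrite /= !ffunE (negbTE xD) half_dom_perm half_dom_flip xD => <-.
apply: eq_big => phi.
  apply/andP/forallP => [[_ /eqP /outside pE] x|h]; last split.
  - have [xD|xD] := boolP (x \in half_dom s).
      by rewrite (pE (flip x)) ?flipK // half_dom_flip negbK.
    by rewrite (pE (s x)) ?sfl // half_dom_perm.
  - rewrite inE; apply/forallP => x; apply/implyP; rewrite /= ffunE => /negbTE.
    by move->; rewrite eqxx.
  apply/eqP/ffunP => x; rewrite !ffunE half_dom_perm half_dom_flip.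
  by case: (x \in half_dom s) => //=; rewrite (eqP (h (flip x))) flipK.
move=> /andP[_ /eqP /outside pE].
have key x : x \in half_dom s ->
   sgn_mx x.2 (Y x.1) ([ffun x => if x \in half_dom s then phi x else i0] x)
     ([ffun x => if x \in half_dom s then phi x else i0] (s x)) =
   Y x.1 (phi (x.1, false)) (phi (x.1, true)).
  move=> xD; rewrite !ffunE half_dom_perm xD.
  have <- : phi (flip x) = phi (s x).
    by rewrite (pE (flip x)) ?flipK // half_dom_flip negbK.
  by case: x xD => k [] _; rewrite /sgn_mx /flip /= ?mxE.
rewrite (eq_bigr _ key).
rewrite (reindex_onto (fun x : pmset I => x.1) (fun k => (k, (k, true) \in half_dom s))) //=.
apply: eq_bigl => -[k b]; rewrite xpair_eqE eqxx /=.
have := half_dom_flip (k, true); rewrite /flip /=; case: b; case: (_ \in _) => //=;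
  by case: (_ \in _).
Qed.

Lemma strand_rel_sym (sp : pred I) : connect_sym (strand_rel sp s).
Proof.
apply: sym_connect_sym => x y; rewrite /strand_rel.
have e1 : (y == s (flip x)) = (x == s (flip y)).
  by apply/eqP/eqP => ->; rewrite sfl flipK.
rewrite e1; congr (_ || _); case: (eqVneq y (flip x)) => [->|]; first by rewrite flipK eqxx.
by rewrite andbF => nyx; case: (eqVneq x (flip y)) => [xE|]; rewrite ?andbF //;
   case/eqP: nyx; rewrite xE flipK.
Qed.

(** The unit matrices prescribe the indices at [A] and the identity matrices
    tie the others; each class without a prescribed index gives a factor
    [N]. *)
Lemma tr_half_units (F : fieldType) (N : nat) (sp : pred I) (a b : I -> 'I_N) :
  (0 < N)%N ->
  let A := [pred x : pmset I | sp x.1] in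
  let psi (x : pmset I) := if x.2 then a x.1 else b x.1 in
  tr_half s (fun k => if sp k then delta_mx (b k) (a k) else 1%:M : 'M[F]_N) =
  N%:R ^- (ncycles s)./2 *
  (if [forall x in A, forall y in A, connect (strand_rel sp s) x y ==> (psi x == psi y)]
   then N%:R ^+ n_comp (strand_rel sp s) (unmarked (strand_rel sp s) A) else 0).
Proof.
move=> N0 A psi; rewrite (tr_half_sum (Ordinal N0)); congr (_ * _).
have := card_class_maps A psi (strand_rel_sym sp) N0.
rewrite -sum1_card => /(congr1 (fun k : nat => k%:R : F)).
rewrite [in RHS](fun_if (fun k : nat => k%:R : F)) natrX => <-.
rewrite natr_sum big_mkcond [RHS]big_mkcond; apply: eq_bigr => phi _ /=.
rewrite inE.
have [/forallP h1|h1] := boolP [forall x, phi (s x) == phi (flip x)]; last first.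
  case: ifP => // /andP[/forallP h _]; case/negP: h1; apply/forallP => x.
  have /forallP/(_ (s x))/implyP := h (flip x); rewrite eq_sym; apply.
  by rewrite /strand_rel flipK eqxx.
have st x : phi (s (flip x)) = phi x by rewrite (eqP (h1 _)) flipK.
case: ifP => [/andP[/forallP h /forall_inP h']|/negbT].
  apply: big1 => k _; case: ifP => spk; rewrite !mxE.
    by rewrite (eqP (h' (k, false) spk)) (eqP (h' (k, true) spk)) !eqxx.
  rewrite (_ : phi _ == _) //.
  have /forallP/(_ (k, true))/implyP := h (k, false); apply.
  by rewrite /strand_rel /= spk eqxx orbT.
rewrite negb_and => nh.
suff [k kE] : exists k, (if sp k then delta_mx (b k) (a k) else 1%:M : 'M[F]_N)
     (phi (k, false)) (phi (k, true)) = 0.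
  by rewrite (bigD1 k) //= kE mul0r.
case/orP: nh => [/forallPn[x /forallPn[y]]|/forall_inPn[x xA px]].
  rewrite negb_imply => /andP[/orP[/eqP->|]]; first by rewrite st eqxx.
  case/andP=> /negbTE spx /eqP-> px; exists x.1; rewrite spx !mxE.
  by case: x px {spx} => k []; rewrite /flip /= ?[_ == phi (k, true)]eq_sym => /negbTE->.
exists x.1; rewrite (_ : sp x.1) // !mxE.
by case: x px {xA} => k []; rewrite /psi /= => /negbTE->; rewrite ?andbF.
Qed.

End Half.

(** * Premaps *)

Lemma deltaE (I : {fset nat}) (x : pmset I) : delta I x = flip x.
Proof. by rewrite permE /delta_eps_fun addbT. Qed.

(** Equivalently, [s \o flip] is an involution without fixed points. *)
Definition folded (A : finType) (s : A * bool -> A * bool) :=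
  (forall x, s (flip (s x)) = flip x) /\ (forall x, s x != flip x).

Lemma premap_folded (I : {fset nat}) (s : {perm (pmset I)}) :
  s \in premaps I -> folded s.
Proof.
rewrite inE => /andP[/forallP h1 /forallP h2]; split=> x.
  by rewrite (eqP (h1 _)) !deltaE flipK permK.
apply: contraNneq (h2 x) => e; rewrite deltaE -e.
by rewrite porbit_fconnect fconnect1.
Qed.

Lemma ncycles_even (I : {fset nat}) (s : {perm (pmset I)}) :
  folded s -> ncycles s = (ncycles s)./2.*2.
Proof. by case=> h1 h2; rewrite -(card_half_porbits h1 h2) doubleK. Qed.

Section Signs.
Variables (I : {fset nat}) (g : {perm I}) (eps : I -> bool).

Lemma delta_epsE (x : pmset I) : delta_eps eps x = (x.1, x.2 (+) eps x.1).
Proof. by rewrite permE. Qed.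

Lemma delta_epsK : involutive (delta_eps eps).
Proof. by case=> k b; rewrite !delta_epsE /= addbK. Qed.

Lemma delta_eps_flip x : delta_eps eps (flip x) = flip (delta_eps eps x).
Proof. by rewrite !delta_epsE /flip /= addNb. Qed.

Lemma gplusE x : gplus g x = if x.2 then x else (g x.1, false).
Proof. by rewrite permE. Qed.

Lemma gminusE x : gminus g x = if x.2 then (g x.1, true) else x.
Proof. by rewrite !permM !deltaE gplusE; case: x => k []. Qed.

Lemma gplus_flip x : gplus g (flip x) = flip (gminus g x).
Proof. by rewrite gplusE gminusE; case: x => k []. Qed.

Lemma gminus_flip x : gminus g (flip x) = flip (gplus g x).
Proof. by rewrite gplusE gminusE; case: x => k []. Qed.

(** The permutation $\gamma_+\gamma_-^{-1}$ of the first count in [chi]. *)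
Definition gdiff : {perm (pmset I)} := ((gminus g)^-1 * gplus g)%g.

Lemma gdiffE x : gdiff x = ((if x.2 then (g^-1)%g x.1 else g x.1), x.2).
Proof.
rewrite permM gplusE; have -> : ((gminus g)^-1)%g x = if x.2 then ((g^-1)%g x.1, true) else x.
  by apply: (@perm_inj _ (gminus g)); rewrite permKV gminusE; case: x => k []; rewrite ?permKV.
by case: x => k [].
Qed.

Lemma gdiff_folded : folded gdiff.
Proof.
split=> -[k b]; rewrite !gdiffE /flip /=; first by case: b => /=; rewrite ?permK ?permKV.
by rewrite xpair_eqE; case: b; rewrite andbF.
Qed.

Variable s : {perm (pmset I)}.
Hypothesis sP : folded s.

Definition twist : {perm (pmset I)} := (delta_eps eps * s * delta_eps eps)%g.

Lemma twistE x : twist x = delta_eps eps (s (delta_eps eps x)).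
Proof. by rewrite !permM. Qed.

Lemma twist_folded : folded twist.
Proof.
case: sP => h1 h2; split=> x; rewrite !twistE.
  by rewrite -delta_eps_flip delta_epsK h1 delta_eps_flip delta_epsK.
apply: contraNneq (h2 (delta_eps eps x)) => e.
by rewrite -(delta_epsK (s _)) e delta_eps_flip.
Qed.

Lemma krewerasE x : kreweras g eps s x = ((gminus g)^-1)%g (twist (gplus g x)).
Proof. by rewrite /kreweras !permM -!permM. Qed.

Lemma kreweras_folded : folded (kreweras g eps s).
Proof.
case: twist_folded => h1 h2; split=> x; rewrite !krewerasE.
  rewrite gplus_flip permKV h1; apply: (@perm_inj _ (gminus g)).
  by rewrite permKV gminus_flip.
apply: contraNneq (h2 (gplus g x)) => e.
by rewrite -gminus_flip -e permKV.
Qed.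

Lemma ncycles_twist : ncycles twist = ncycles s.
Proof.
rewrite /ncycles !card_porbits.
have t1 := fconnect_sym (@perm_inj _ twist); have t2 := fconnect_sym (@perm_inj _ s).
apply/eqP; rewrite eqn_leq; apply/andP; split;
  apply: (@n_comp_le _ _ _ _ _ _ (delta_eps eps)) => //= x y _ _ /iter_findex.
  move: (findex _ _ _) => i e; rewrite -(delta_epsK y) -e.
  suff -> : delta_eps eps (iter i s (delta_eps eps x)) = iter i twist x by apply: fconnect_iter.
  by elim: i {e} => [|i IH] /=; rewrite ?delta_epsK // -IH twistE delta_epsK.
move: (findex _ _ _) => i e; rewrite -(delta_epsK y) -e.
suff -> : delta_eps eps (iter i twist (delta_eps eps x)) = iter i s x by apply: fconnect_iter.
by elim: i {e} => [|i IH] /=; rewrite ?delta_epsK // -IH twistE !delta_epsK.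
Qed.

Lemma chi_even : chi g twist =
  ((ncycles gdiff)./2 + (ncycles s)./2 + (ncycles (kreweras g eps s))./2)%N%:Z - #|` I|%:Z.
Proof.
rewrite /chi -/gdiff.
rewrite ncycles_twist.
have -> // : ncycles (gminus g * twist^-1 * (gplus g)^-1)%g = ncycles (kreweras g eps s).
rewrite /ncycles -porbitsV (invMg (_ * _)%g) (invMg (gminus g)) !invgK /kreweras mulgA.
by [].
Qed.

(** The Kreweras complement is conjugate to the product of [gdiff] and the
    twisted premap. *)
Lemma kreweras_euler :
  (ncycles gdiff + ncycles s + ncycles (kreweras g eps s) <=
   #|{: pmset I}| + 2 * n_comp (joint_orbits twist gdiff) {: pmset I})%N.
Proof.
have le : (ncycles (kreweras g eps s) <= ncycles (twist * gdiff)%g)%N.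
  rewrite /ncycles !card_porbits.
  apply: (@n_comp_le _ _ _ _ _ _ (gplus g)) => //=; try exact/fconnect_sym/perm_inj.
  move=> x y _ _ /iter_findex; move: (findex _ _ _) => i e.
  suff -> : y = iter i (kreweras g eps s) x by apply: fconnect_iter.
  apply: (@perm_inj _ (gplus g)); rewrite -e; elim: i {e} => //= i ->.
  by rewrite krewerasE [RHS]/= permM /gdiff permM.
have : (ncycles twist + ncycles gdiff + ncycles (twist * gdiff) <= _)%N :=
  porbits_euler twist gdiff.
rewrite ncycles_twist.
have ar (u v x y z : nat) : (x <= y -> v + u + y <= z -> u + v + x <= z)%N by lia.
exact: ar le.
Qed.

End Signs.

(** [dl] permutes the classes of [e], in orbits of one or two elements. *)
Lemma n_comp_flip_le (T : finType) (e : rel T) (dl : T -> T) :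
  connect_sym e -> involutive dl ->
  (forall x y, connect e x y -> connect e (dl x) (dl y)) ->
  (n_comp e T <= 2 * n_comp (relU e (frel dl)) T)%N.
Proof.
move=> se dlK de; set e' := relU e (frel dl).
have se' : connect_sym e' by apply: relU_sym => //; apply/fconnect_sym/(can_inj dlK).
have e'P x y : connect e' x y -> connect e x y || connect e (dl x) y.
  case/connectP => p; elim: p x => [x _ ->|z p IH x /= /andP[xz pz] yE].
    by rewrite connect0.
  have {}IH := IH z pz yE; case/orP: xz => [xz|/eqP zE].
    case/orP: IH => h; first by rewrite (connect_trans (connect1 xz) h).
    by rewrite (connect_trans (de _ _ (connect1 xz)) h) orbT.
  by rewrite -zE dlK orbC in IH.
rewrite /n_comp_mem mulnC -[X in (X <= _)%N]sum1_card.
rewrite (partition_big (fingraph.root e')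
  (mem (predI (fingraph.roots e') T))) /=; last first.
  by move=> x _; apply/andP; split=> //; apply: roots_root.
rewrite -sum_nat_const; apply: leq_sum => x /andP[/eqP rx _].
rewrite sum1_card; apply: leq_trans (_ : (#|[set fingraph.root e x; fingraph.root e (dl x)]| <= 2)%N).
  apply: subset_leq_card; apply/fintype.subsetP => y; rewrite !inE.
  case/andP=> /andP[/eqP ry _] /eqP rE.
  move: (connect_root e' y); rewrite rE se' => /e'P /orP[] /(fingraph.rootP se) ->;
    by rewrite ry eqxx ?orbT.
by rewrite cards2; case: (_ != _).
Qed.

(** * Blocks of positions and their shadows *)

(** What a premap does to whole blocks.  The block [k] has a row index and a
    column index, its ends [(k, false)] and [(k, true)].  The first component
    tells which ends are tied to carry equal indices, the second which blocks
    lie in the same component of the premap. *)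
Definition shadow (L : finType) : finType :=
  ({set ((L * bool) * (L * bool))} * {set (L * L)})%type.

Definition label_rel (L : finType) (sh : shadow L) : rel L :=
  fun k l => [exists b, exists b', ((k, b), (l, b')) \in sh.1].

Definition class_rel (L : finType) (sh : shadow L) : rel L := fun k l => (k, l) \in sh.2.

Definition nloops (L : finType) (S : {set L}) (sh : shadow L) : nat :=
  n_comp (label_rel sh) S.

Definition nclasses (L : finType) (S : {set L}) (sh : shadow L) : nat :=
  n_comp (class_rel sh) S.

(** Relations on the ends and on the blocks of [S].  Each end has a mate
    because a strand of a premap has two ends; ties of ends stay inside a
    class of blocks because a strand stays inside a component. *)
Record valid (L : finType) (S : {set L}) (sh : shadow L) : Prop := Valid {
  valid_in : forall u v, (u, v) \in sh.1 -> u.1 \in S;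
  valid_refl : forall u, u.1 \in S -> (u, u) \in sh.1;
  valid_sym : forall u v, (u, v) \in sh.1 -> (v, u) \in sh.1;
  valid_trans : forall u v w, (u, v) \in sh.1 -> (v, w) \in sh.1 -> (u, w) \in sh.1;
  valid_mate : forall u, u.1 \in S -> exists2 v, v != u & (u, v) \in sh.1;
  valid_rin : forall k l, (k, l) \in sh.2 -> k \in S;
  valid_rrefl : forall k, k \in S -> (k, k) \in sh.2;
  valid_rsym : forall k l, (k, l) \in sh.2 -> (l, k) \in sh.2;
  valid_rtrans : forall k l m, (k, l) \in sh.2 -> (l, m) \in sh.2 -> (k, m) \in sh.2;
  valid_fine : forall u v, (u, v) \in sh.1 -> (u.1, v.1) \in sh.2
}.

Section Positions.
Variables (L : finType) (len : L -> nat).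
Hypothesis len_gt0 : forall k, (0 < len k)%N.
Variable k0 : L.
Let Q : finType := {k : L & 'I_(len k)}.

(** Condition (G) speaks of sets of positive integers.  The factors of all
    the blocks are numbered once and for all, and a set of blocks becomes the
    set of the numbers of its factors. *)
Definition pos (q : Q) : nat := (enum_rank q).+1.

Definition first_pos (k : L) : Q := Tagged (fun k => 'I_(len k)) (Ordinal (len_gt0 k)).

Definition unpos (x : nat) : Q := odflt (first_pos k0) [pick q | pos q == x].

Lemma pos_inj : injective pos.
Proof. by move=> q r [] /ord_inj/enum_rank_inj. Qed.

Lemma posK : cancel pos unpos.
Proof.
move=> q; rewrite /unpos; case: pickP => [r /eqP /pos_inj //|/(_ q)].
by rewrite eqxx.
Qed.

Definition block_fset (S : {set L}) : {fset nat} :=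
  [fset pos q | q in [pred q : Q | tag q \in S]]%fset.

Lemma in_block (S : {set L}) x :
  (x \in block_fset S) = (x == pos (unpos x)) && (tag (unpos x) \in S).
Proof.
apply/imfsetP/andP => [[q /= qS ->]|[/eqP xE xS]]; first by rewrite posK.
by exists (unpos x).
Qed.

Lemma pos_in_block (S : {set L}) q : (pos q \in block_fset S) = (tag q \in S).
Proof. by rewrite in_block posK eqxx. Qed.

Lemma block0 (S : {set L}) : 0%N \notin block_fset S.
Proof. by rewrite in_block. Qed.

Definition next_pos (q : Q) : Q := Tagged (fun k => 'I_(len k)) (ordS (tagged q)).

Lemma pos_eq (q r : Q) : tag q = tag r -> val (tagged q) = val (tagged r) -> q = r.
Proof.
case: q r => k i [l j] /= kl; case: l / kl j => j /= ij.
by rewrite (val_inj ij).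
Qed.

Lemma next_pos_inj : injective next_pos.
Proof.
case=> k i [l j] /= e; have kl : k = l by exact: (congr1 (@tag _ _) e).
case: l / kl j e => j /eqP; rewrite /next_pos /= eq_Tagged /= => /eqP.
by move/ordS_inj ->.
Qed.

Section OneFamily.
Variable S : {set L}.
Local Notation I := (block_fset S).

Definition at_pos (x : I) : Q := unpos (val x).
Definition lab (x : I) : L := tag (at_pos x).
Definition is_end (x : I) : bool := (tagged (at_pos x)).+1 == len (lab x).

Lemma val_at (x : I) : val x = pos (at_pos x).
Proof. by have := valP x; rewrite in_block => /andP[/eqP]. Qed.

Lemma lab_in (x : I) : lab x \in S.
Proof. by have := valP x; rewrite in_block => /andP[]. Qed.

Lemma at_pos_inj : injective at_pos.
Proof. by move=> x y e; apply: val_inj; rewrite !val_at e. Qed.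

Lemma at_pos_onto q : tag q \in S -> exists x : I, at_pos x = q.
Proof.
move=> qS; have h : pos q \in I by rewrite pos_in_block.
by exists [` h]%fset; rewrite /at_pos /= posK.
Qed.

Lemma shift_subproof (x : I) : pos (next_pos (at_pos x)) \in I.
Proof. by rewrite pos_in_block; apply: lab_in. Qed.

Definition shift_fun (x : I) : I := [` shift_subproof x]%fset.

Lemma at_shift_fun x : at_pos (shift_fun x) = next_pos (at_pos x).
Proof. by rewrite /at_pos /= posK. Qed.

Lemma shift_inj : injective shift_fun.
Proof.
move=> x y e; apply/at_pos_inj/next_pos_inj; by rewrite -!at_shift_fun e.
Qed.

Definition bshift : {perm I} := perm shift_inj.

Lemma at_shift x : at_pos (bshift x) = next_pos (at_pos x).
Proof. by rewrite permE at_shift_fun. Qed.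

Lemma lab_shift x : lab (bshift x) = lab x.
Proof. by rewrite /lab at_shift. Qed.

Lemma fconnect_lab x y : fconnect bshift x y = (lab x == lab y).
Proof.
have ss : connect_sym (frel bshift) := fconnect_sym (@perm_inj _ bshift).
apply/idP/eqP => [/iter_findex <-|].
  by elim: (findex _ _ _) => [|i IH] //=; rewrite lab_shift.
have [z zE] := at_pos_onto (lab_in x : tag (first_pos (lab x)) \in S).
suff key : forall n w, val (tagged (at_pos w)) = n -> lab w = lab x -> fconnect bshift z w.
  by move=> xy; rewrite -(same_connect ss (key _ x erefl erefl)) (key _ y erefl).
elim=> [|n IH] w nE wx.
  suff -> : w = z by apply: connect0.
  by apply/at_pos_inj; rewrite zE; apply: pos_eq => //; rewrite nE.
have ln : (n < len (tag (at_pos w)))%N.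
  by apply: leq_trans (ltnW (ltn_ord (tagged (at_pos w)))); rewrite nE.
have [u uE] := at_pos_onto (lab_in w : tag (Tagged (fun k => 'I_(len k)) (Ordinal ln)) \in S).
have -> : w = bshift u.
  apply/at_pos_inj; rewrite at_shift uE; apply: pos_eq => //=.
  rewrite modn_small ?nE //.
  by apply: leq_ltn_trans (ltn_ord (tagged (at_pos w))); rewrite nE.
apply: connect_trans (fconnect1 _ _); apply: IH; rewrite ?uE //.
by rewrite /lab uE.
Qed.

Lemma end_exists k : k \in S -> exists2 x : I, lab x = k & is_end x.
Proof.
move=> kS; have ln : ((len k).-1 < len k)%N by rewrite prednK // len_gt0.
have [u uE] := at_pos_onto (kS : tag (Tagged (fun k => 'I_(len k)) (Ordinal ln)) \in S).
exists u; rewrite /is_end /lab uE //=.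
by rewrite prednK // len_gt0.
Qed.

Lemma end_uniq x y : is_end x -> is_end y -> lab x = lab y -> x = y.
Proof.
move=> /eqP xe /eqP ye xy; apply: at_pos_inj; apply: pos_eq => //.
by apply: succn_inj; rewrite xe ye xy.
Qed.

Variables (eps : I -> bool) (s : {perm (pmset I)}).
Hypothesis sP : folded s.

Definition kappa := kreweras bshift eps s.
Definition strand : rel (pmset I) := strand_rel is_end kappa.
Definition ends : {pred pmset I} := [pred x : pmset I | is_end x.1].

(** The unit matrix of a block comes after its last factor, so that its row
    index is the column index of the block: the sign is reversed. *)
Definition endp (x : pmset I) : L * bool := (lab x.1, ~~ x.2).

(** The components of a premap once the positions of a block are identified. *)
Definition bmerge : rel (pmset I) :=
  relU (frel s) (fun x y => lab x.1 == lab y.1).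

Definition shadow_of : shadow L :=
  ([set uv | [exists x, exists y,
      [&& is_end x.1, is_end y.1, connect strand x y, uv.1 == endp x & uv.2 == endp y]]],
   [set kl | [exists x, exists y,
      [&& connect bmerge x y, kl.1 == lab x.1 & kl.2 == lab y.1]]]).

Lemma shadow_tauP u v : reflect
  (exists x y, [/\ is_end x.1, is_end y.1, connect strand x y, u = endp x & v = endp y])
  ((u, v) \in shadow_of.1).
Proof.
rewrite inE; apply: (iffP existsP) => [[x /existsP[y /and5P[h1 h2 h3 /eqP h4 /eqP h5]]]|].
  by exists x, y.
by case=> x [y [h1 h2 h3 -> ->]]; exists x; apply/existsP; exists y; rewrite h1 h2 h3 !eqxx.
Qed.

Lemma shadow_rhoP k l : reflect
  (exists x y, [/\ connect bmerge x y, k = lab x.1 & l = lab y.1])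
  ((k, l) \in shadow_of.2).
Proof.
rewrite inE; apply: (iffP existsP) => [[x /existsP[y /and3P[h1 /eqP h2 /eqP h3]]]|].
  by exists x, y.
by case=> x [y [h1 -> ->]]; exists x; apply/existsP; exists y; rewrite h1 !eqxx.
Qed.

Let kP : folded kappa := kreweras_folded bshift eps sP.

Lemma strand_sym : connect_sym strand.
Proof. by case: kP => h1 _; apply: strand_rel_sym. Qed.

Lemma merge_sym : connect_sym bmerge.
Proof.
apply: relU_sym; first exact/fconnect_sym/perm_inj.
by apply: sym_connect_sym => x y; rewrite eq_sym.
Qed.

Lemma merge_lab x y : lab x.1 = lab y.1 -> connect bmerge x y.
Proof. by move=> e; apply: connect1; apply/orP; right; apply/eqP. Qed.

Lemma merge_twist x : connect bmerge x (twist eps s x).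
Proof.
rewrite twistE; apply: (@connect_trans _ _ (delta_eps eps x)).
  by apply: merge_lab; rewrite delta_epsE.
apply: (@connect_trans _ _ (s (delta_eps eps x))); last by apply: merge_lab; rewrite (delta_epsE _ (s _)).
by apply: connect1; apply/orP; left; apply: eqxx.
Qed.

Lemma merge_kappa x : connect bmerge x (kappa x).
Proof.
rewrite /kappa krewerasE.
apply: (@connect_trans _ _ (gplus bshift x)).
  by apply: merge_lab; rewrite gplusE; case: x => k []; rewrite /= ?lab_shift.
apply: connect_trans (merge_twist _) _.
set z := twist _ _ _; apply: merge_lab; rewrite -{1}(permKV (gminus bshift) z).
by rewrite gminusE; case: (_ z) => k []; rewrite /= ?lab_shift.
Qed.

Lemma strand_merge x y : connect strand x y -> connect bmerge x y.
Proof.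
apply: connect_sub => {x y} x y /orP[/eqP->|/andP[_ /eqP->]]; last exact: merge_lab.
by apply: connect_trans (merge_kappa _); apply: merge_lab.
Qed.

Lemma endp_inj x y : is_end x.1 -> is_end y.1 -> endp x = endp y -> x = y.
Proof.
case: x y => x b [y c] /= ex ey [/(end_uniq ex ey) -> /eqP].
by rewrite (inj_eq negb_inj) => /eqP ->.
Qed.

Lemma end_lift u : u.1 \in S -> exists2 x, is_end x.1 & endp x = u.
Proof.
case: u => k b /= /end_exists[x xk ex]; exists (x, ~~ b) => //.
by rewrite /endp /= negbK xk.
Qed.

(** The involution [fun y => kappa (flip y)] has no fixed point and preserves
    the strand of [x]; if [x] were its only end, [flip] would act without
    fixed points on the other elements.  The two parities contradict each
    other. *)
Lemma strand_mate x : is_end x.1 -> exists y, [/\ is_end y.1, y != x & connect strand x y].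
Proof.
case: kP => h1 h2 ex; apply/not_existsP => no.
have onlyx y : is_end y.1 -> connect strand x y -> y = x.
  by move=> ey xy; apply/eqP/negPn/negP => yx; apply: (no y).
pose A := [set y | connect strand x y].
have ss := strand_sym.
have stepk y : connect strand y (kappa (flip y)).
  by apply: connect1; rewrite /strand /strand_rel eqxx.
have e1 : ~~ odd #|A|.
  apply: (@even_card_involution _ _ (fun y => kappa (flip y))).
    by move=> y; rewrite h1 flipK.
  move=> y; rewrite !inE => xy; apply/andP; split; first exact: connect_trans (stepk y).
  by rewrite -[X in _ != X]flipK; apply: h2.
have e2 : ~~ odd #|A :\ x|.
  apply: (@even_card_involution _ _ (@flip I)); first exact: flipK.
  move=> y; rewrite !inE => /andP[yx xy].
  have ney : ~~ is_end y.1 by apply: contra yx => ey; rewrite (onlyx y).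
  rewrite flip_neq andbT; apply/andP; split.
    by apply: contra ney => /eqP fy; rewrite -[y]flipK fy.
  apply: connect_trans xy _; apply: connect1.
  by rewrite /strand /strand_rel ney eqxx orbT.
have xA : x \in A by rewrite inE connect0.
by move: e1; rewrite (cardsD1 x) xA /= negbK (negbTE e2).
Qed.

Lemma valid_shadow : valid S shadow_of.
Proof.
have ss := strand_sym; have ms := merge_sym.
split.
- by move=> u v /shadow_tauP[x [y [_ _ _ -> _]]]; apply: lab_in.
- by move=> u /end_lift[x ex <-]; apply/shadow_tauP; exists x, x.
- by move=> u v /shadow_tauP[x [y [h1 h2 h3 -> ->]]]; apply/shadow_tauP; exists y, x;
    split=> //; rewrite ss.
- move=> u v w /shadow_tauP[x [y [h1 h2 h3 -> ->]]] /shadow_tauP[y' [z [h1' h2' h3' e ->]]].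
  apply/shadow_tauP; exists x, z; split=> //.
  by apply: connect_trans h3 _; rewrite (endp_inj h2 h1' e).
- move=> u /end_lift[x ex <-]; have [y [ey yx xy]] := strand_mate ex.
  exists (endp y); last by apply/shadow_tauP; exists x, y.
  by apply: contra_neq yx; apply: endp_inj.
- by move=> k l /shadow_rhoP[x [y [_ -> _]]]; apply: lab_in.
- move=> k kS; have [x xk _] := end_exists kS; apply/shadow_rhoP.
  by exists (x, true), (x, true); rewrite connect0.
- by move=> k l /shadow_rhoP[x [y [h -> ->]]]; apply/shadow_rhoP; exists y, x; rewrite ms.
- move=> k l m /shadow_rhoP[x [y [h -> ->]]] /shadow_rhoP[y' [z [h' e ->]]].
  apply/shadow_rhoP; exists x, z; split=> //.
  by apply: connect_trans h _; apply: connect_trans h'; apply: merge_lab.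
- move=> u v /shadow_tauP[x [y [_ _ h -> ->]]]; apply/shadow_rhoP.
  by exists x, y; split=> //; apply: strand_merge.
Qed.

Lemma merge_classes : (n_comp bmerge {: pmset I} <= nclasses S shadow_of)%N.
Proof.
have V := valid_shadow.
have cs : connect_sym (class_rel shadow_of).
  by apply: sym_connect_sym => k l; apply/idP/idP; apply: (valid_rsym V).
apply: (@n_comp_le _ _ _ _ _ _ (fun x : pmset I => lab x.1)) => //.
- exact: merge_sym.
- move=> k l kl; apply/idP/idP => _; last exact: (valid_rin V kl).
  exact: (valid_rin V (valid_rsym V kl)).
- by move=> x _; apply: lab_in.
move=> x y _ _ /connectP[p].
have key z : connect (class_rel shadow_of) (lab x.1) z -> (lab x.1, z) \in shadow_of.2.
  case/connectP => r; elim: r z x => [z x _ ->|l r IH z x /= /andP[xl pr zE]].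
    exact: (valid_rrefl V (lab_in _)).
  have [w [w' [_ _ lE]]] := shadow_rhoP _ _ xl.
  by apply: (valid_rtrans V xl); rewrite lE; apply: IH; rewrite -lE.
move=> pp e; have /key/shadow_rhoP[u [w [uw xu yw]]] : connect (class_rel shadow_of) (lab x.1) (lab y.1).
  by apply/connectP; exists p.
apply: (@connect_trans _ _ u); first exact: merge_lab.
by apply: connect_trans uw _; apply: merge_lab.
Qed.

(** By [kreweras_euler], [chi] is bounded by the number of joint orbits of
    the twisted premap and [gdiff]; up to sign, these are the components of
    the blocks. *)
Lemma chi_bound : (chi bshift (twist eps s) <= (2 * nclasses S shadow_of)%N%:Z)%R.
Proof.
have fl : (n_comp (joint_orbits (twist eps s) (gdiff bshift)) {: pmset I} <=
   2 * nclasses S shadow_of)%N.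
  set e := joint_orbits _ _.
  have se : connect_sym e := joint_orbits_sym _ _.
  have [t1 _] := twist_folded eps sP; have [d1 _] := gdiff_folded bshift.
  have J z := joint_orbits1 (twist eps s) (gdiff bshift) z.
  have eflip x y : connect e x y -> connect e (flip x) (flip y).
    case/connectP => p; elim: p x => [x _ -> //|z p IH x /= /andP[xz pz] yE].
    apply: connect_trans (IH z pz yE); rewrite se.
    case/orP: xz => /eqP <-.
      by have [h _] := J (flip (twist eps s x)); rewrite t1 in h.
    by have [_ h] := J (flip (gdiff bshift x)); rewrite d1 in h.
  apply: leq_trans (n_comp_flip_le se (@flipK _) eflip) _.
  rewrite leq_mul2l /=; apply: leq_trans merge_classes.
  set e' := relU _ _.
  have se' : connect_sym e' by apply: relU_sym => //; apply/fconnect_sym/(can_inj (@flipK _)).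
  apply: (@n_comp_le _ _ _ _ _ _ id) => //; first exact: merge_sym.
  have inE' x y : connect e x y -> connect e' x y.
    by apply: connect_sub => {x y} x y xy; apply: connect1; apply/orP; left.
  have flE x : connect e' x (flip x) by apply: connect1; apply/orP; right; apply: eqxx.
  have sgE x b : connect e' x (x.1, b).
    by case: x => x c; case: (eqVneq b c) => [->//|]; case: b c => [] [] // _; apply: flE.
  move=> x y _ _; apply: connect_sub => {x y} x y /orP[/eqP <-|/eqP xy].
    apply: (@connect_trans _ _ (delta_eps eps x)); first by rewrite delta_epsE; apply: sgE.
    apply: (@connect_trans _ _ (twist eps s (delta_eps eps x))).
      by apply: inE'; have [] := J (delta_eps eps x).
    by rewrite twistE delta_epsK se' delta_epsE; apply: sgE.
  apply: (@connect_trans _ _ (x.1, false)); first exact: sgE.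
  apply: (@connect_trans _ _ (y.1, false)); last by rewrite se'; apply: sgE.
  have /iter_findex <- : fconnect bshift x.1 y.1 by rewrite fconnect_lab xy.
  elim: (findex _ _ _) => [|i IH] //; apply: connect_trans IH _; apply: inE'.
  by have [_] := J (iter i bshift x.1, false); rewrite gdiffE.
rewrite chi_even //.
have := kreweras_euler bshift eps s.
have E1 := ncycles_even (gdiff_folded bshift); have E2 := ncycles_even sP.
have E3 := ncycles_even kP.
rewrite E1 E2 -/kappa E3 card_prod card_bool cardfE.
have ar (a b c i j n : nat) : (a.*2 + b.*2 + c.*2 <= i * 2 + 2 * j)%N -> (j <= 2 * n)%N ->
   ((a + b + c)%N%:Z - i%:Z <= (2 * n)%N%:Z)%R by lia.
by move/ar => /(_ _ fl); rewrite -!E1 -!E2 -!E3.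
Qed.

(** A cycle of the Kreweras complement, up to sign, either is a strand
    without ends or contains ends.  The cycles of the second kind are at
    least as many as the classes of blocks that have tied ends in common,
    for such a cycle only meets blocks of one class. *)
Lemma loops_bound :
  (n_comp strand (unmarked strand ends) + nloops S shadow_of <= (ncycles kappa)./2)%N.
Proof.
case: kP => h1 h2; have ss := strand_sym.
have V := valid_shadow.
pose e1 := fold_rel kappa (@flip I).
have se1 : connect_sym e1 := fold_rel_sym kappa (@flipK I).
have -> : (ncycles kappa)./2 = n_comp e1 {: pmset I}.
  by rewrite /ncycles card_porbits (fcard_fold (@flipK I) h1 (@flip_neq I) h2) doubleK.
have sub1 x y : connect strand x y -> connect e1 x y.
  have fl z : connect e1 z (flip z) by apply: connect1; apply/orP; right; apply: eqxx.
  apply: connect_sub => {x y} x y /orP[/eqP->|/andP[_ /eqP->]] //.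
  apply: connect_trans (fl x) _; apply: connect1; apply/orP; left; exact: eqxx.
pose U := unmarked strand ends.
have clU : fingraph.closed strand U := unmarked_closed _ ss.
have Unend x : x \in U -> ~~ is_end x.1.
  by move=> /forall_inP h; apply/negP => ex; move: (h x ex); rewrite connect0.
have step1 x : x \in U -> forall y, e1 x y -> connect strand x y.
  move=> xU y /orP[/eqP <-|/eqP <-].
    apply: (@connect_trans _ _ (flip x)).
      by apply: connect1; rewrite /strand /strand_rel (Unend x xU) eqxx orbT.
    by apply: connect1; rewrite /strand /strand_rel flipK eqxx.
  by apply: connect1; rewrite /strand /strand_rel (Unend x xU) eqxx orbT.
have clU1 : fingraph.closed e1 U.
  apply: intro_closed => // x y xy xU.
  by rewrite -(closed_connect clU (step1 x xU y xy)).
rewrite (n_compC U); apply: leq_add.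
  apply: (@n_comp_le _ _ _ _ _ _ id) => // x y xU _ /connectP[p].
  elim: p x xU => [x _ _ ->|z p IH x xU /= /andP[xz pz] yE]; first exact: connect0.
  apply: connect_trans (step1 x xU z xz) _; apply: IH => //.
  by rewrite -(closed_connect clU (step1 x xU z xz)).
have [S0|[k1 k1S]] := set_0Vmem S.
  by rewrite /nloops /n_comp_mem eq_card0 // => k; rewrite !inE S0 inE andbF.
have [x1 _ _] := end_exists k1S.
pose h k : pmset I := odflt (x1, false) [pick x : pmset I | is_end x.1 && (lab x.1 == k)].
have hP k : k \in S -> is_end (h k).1 /\ lab (h k).1 = k.
  move=> /end_exists[x xk ex]; rewrite /h; case: pickP => [y /andP[? /eqP] //|/(_ (x, true))].
  by rewrite /= ex xk eqxx.
have ls : connect_sym (label_rel shadow_of).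
  apply: sym_connect_sym => k l; apply/existsP/existsP => -[b /existsP[b' /(valid_sym V) h']];
  by exists b'; apply/existsP; exists b.
apply: (@n_comp_le _ _ _ _ _ _ h) => //.
- exact: predC_closed.
- move=> k /hP[eh _]; rewrite !inE; apply/forall_inPn; exists (h k) => //.
  by rewrite negbK connect0.
move=> k l kS lS /connectP[p].
have [ek kE] := hP k kS; have [el lE] := hP l lS.
(* [w] is an end tied to the current point of the path. *)
suff key : forall z, path e1 z p -> h l = last z p -> forall w, is_end w.1 -> connect strand w z ->
    connect (label_rel shadow_of) (lab w.1) (lab (h l).1).
  by move=> pp e; have := key (h k) pp e (h k) ek (connect0 _ _); rewrite kE lE.
have tau w w' : is_end w.1 -> is_end w'.1 -> connect strand w w' ->
    connect (label_rel shadow_of) (lab w.1) (lab w'.1).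
  move=> ew ew' ww'; apply: connect1; apply/existsP; exists (~~ w.2).
  by apply/existsP; exists (~~ w'.2); apply/shadow_tauP; exists w, w'.
elim: p => [z _ /= <- w ew wz|z' p IH z /= /andP[zz' pz'] e w ew wz]; first exact: tau.
have flipcase y w' : is_end w'.1 -> connect strand w' y ->
    exists w'', [/\ is_end w''.1, connect strand w'' (flip y) &
      connect (label_rel shadow_of) (lab w'.1) (lab w''.1)].
  move=> ew' wy; have [ey|ney] := boolP (is_end y.1).
    by exists (flip y); split=> //; apply: (tau w' y).
  exists w'; split=> //; apply: connect_trans wy _; apply: connect1.
  by rewrite /strand /strand_rel ney eqxx orbT.
have [w1 [ew1 wz1 lw1]] := flipcase z w ew wz.
case/orP: zz' => /eqP zE; last first.
  by apply: connect_trans lw1 _; apply: (IH z') => //; rewrite -zE.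
apply: connect_trans lw1 _; apply: (IH z') => //.
apply: connect_trans wz1 _; apply: connect1.
by rewrite /strand /strand_rel flipK -zE eqxx.
Qed.

End OneFamily.
End Positions.

(** * Splitting a premap along a union of blocks *)

Lemma connect_embed (T T1 : finType) (h : T1 -> T) (e : rel T) (e1 : rel T1) :
  (forall x y, e (h x) y -> exists2 y', y = h y' & e1 x y') ->
  (forall x y', e1 x y' -> e (h x) (h y')) ->
  forall x y, connect e (h x) y <-> exists2 y', y = h y' & connect e1 x y'.
Proof.
move=> H1 H2 x y; split=> [/connectP[p]|[y' -> /connectP[p]]].
  elim: p x => [x _ ->|z p IH x /= /andP[xz pz] yE]; first by exists x.
  have [z' zE xz'] := H1 _ _ xz; rewrite zE in pz yE.
  have [y' yE' zy'] := IH z' pz yE.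
  by exists y' => //; apply: connect_trans zy'; apply: connect1.
elim: p x => [x _ ->|z p IH x /= /andP[xz pz] yE]; first exact: connect0.
by apply: connect_trans (IH z pz yE); apply/connect1/H2.
Qed.

Lemma pactE (I : {fset nat}) (s : {perm (pmset I)}) (k : I) b :
  pact s (val k, b) = (val (s (k, b)).1, (s (k, b)).2).
Proof. by rewrite /pact /= valK. Qed.

Lemma pact_out (I : {fset nat}) (s : {perm (pmset I)}) x :
  x.1 \notin I -> pact s x = x.
Proof. by move=> xI; rewrite /pact insubF //; apply: negbTE. Qed.

Section Embedding.
Variables (I J : {fset nat}) (JI : (J `<=` I)%fset).

Definition emb (x : pmset J) : pmset I := (fincl JI x.1, x.2).

Lemma emb_inj : injective emb.
Proof.
case=> x b [y c] [xy ->]; congr (_, _).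
exact: val_inj.
Qed.

Lemma emb_codom (x : pmset I) : (x \in codom emb) = (val x.1 \in J).
Proof.
apply/codomP/idP => [[y ->] /=|xJ]; first exact: valP.
exists ([` xJ]%fset, x.2); case: x xJ => x b /= xJ; congr (_, _).
exact: val_inj.
Qed.

Definition agrees (s : {perm (pmset I)}) (s1 : {perm (pmset J)}) :=
  forall x, s (emb x) = emb (s1 x).

Lemma agrees_pact s s1 (k : J) b : agrees s s1 -> pact s1 (val k, b) = pact s (val k, b).
Proof.
move=> a; rewrite pactE (_ : val k = val (fincl JI k)) // pactE.
by rewrite [s _](a (k, b)).
Qed.

Lemma agrees_restriction s s1 : agrees s s1 -> is_restriction s s1.
Proof. by move=> a [x b] /= xJ; exact: (agrees_pact [` xJ]%fset b a). Qed.

Lemma agreesV s s1 : agrees s s1 -> agrees s^-1 s1^-1.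
Proof. by move=> a x; apply: (@perm_inj _ s); rewrite permKV a permKV. Qed.

Lemma agreesM s t s1 t1 : agrees s s1 -> agrees t t1 -> agrees (s * t) (s1 * t1).
Proof. by move=> a b x; rewrite !permM a b. Qed.

Lemma emb_flip x : emb (flip x) = flip (emb x).
Proof. by []. Qed.

Lemma agrees_delta (eps : I -> bool) (eps1 : J -> bool) :
  (forall k, eps (fincl JI k) = eps1 k) -> agrees (delta_eps eps) (delta_eps eps1).
Proof. by move=> h x; rewrite !delta_epsE /= h. Qed.

Lemma agrees_gplus (g : {perm I}) (g1 : {perm J}) :
  (forall k, g (fincl JI k) = fincl JI (g1 k)) -> agrees (gplus g) (gplus g1).
Proof. by move=> h [k b]; rewrite !gplusE /emb; case: b => //=; rewrite h. Qed.

Lemma agrees_gminus (g : {perm I}) (g1 : {perm J}) :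
  (forall k, g (fincl JI k) = fincl JI (g1 k)) -> agrees (gminus g) (gminus g1).
Proof. by move=> h [k b]; rewrite !gminusE /emb; case: b => //=; rewrite h. Qed.

End Embedding.

Section Counting.
Variables (I J K : {fset nat}) (JI : (J `<=` I)%fset) (KI : (K `<=` I)%fset).
Hypothesis KE : forall x, x \in I -> (x \in K) = (x \notin J).

Lemma emb_compl (x : pmset I) : (x \in codom (emb KI)) = (x \notin codom (emb JI)).
Proof. by rewrite !emb_codom KE //; apply: valP. Qed.

Lemma n_comp_split (e : rel (pmset I)) (e1 : rel (pmset J)) (e2 : rel (pmset K))
    (P : {pred pmset I}) :
  connect_sym e -> connect_sym e1 -> connect_sym e2 ->
  (forall x y, e (emb JI x) y -> exists2 y', y = emb JI y' & e1 x y') ->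
  (forall x y, e (emb JI x) (emb JI y) = e1 x y) ->
  (forall x y, e (emb KI x) (emb KI y) = e2 x y) -> fingraph.closed e P ->
  n_comp e P = (n_comp e1 [preim emb JI of P] + n_comp e2 [preim emb KI of P])%N.
Proof.
move=> se se1 se2 H E1 E2 clP; apply: n_comp_sum => //.
- exact: emb_inj.
- exact: emb_inj.
- apply: intro_closed => // x y xy /codomP[x' xE].
  by rewrite xE in xy; have [y' -> _] := H _ _ xy; apply: codom_f.
- exact: emb_compl.
Qed.

Lemma ncycles_split s s1 s2 : agrees JI s s1 -> agrees KI s s2 ->
  ncycles s = (ncycles s1 + ncycles s2)%N.
Proof.
move=> a1 a2; rewrite /ncycles !card_porbits (@n_comp_split _ (frel s1) (frel s2)) //.
- exact/fconnect_sym/perm_inj.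
- exact/fconnect_sym/perm_inj.
- exact/fconnect_sym/perm_inj.
- by move=> x y /eqP <-; exists (s1 x); rewrite ?a1 //=.
- by move=> x y; rewrite /= a1 (inj_eq (@emb_inj _ _ _)).
- by move=> x y; rewrite /= a2 (inj_eq (@emb_inj _ _ _)).
Qed.

Lemma disjointJK x : x \in J -> x \notin K.
Proof. by move=> xJ; rewrite KE ?xJ // (fsubsetP JI). Qed.

Lemma is_product_agrees (s : {perm (pmset I)}) s1 s2 :
  is_product s s1 s2 <-> agrees JI s s1 /\ agrees KI s s2.
Proof.
split=> [h|[a1 a2] [x b]].
  split=> -[k b].
    have := h (val k, b); rewrite /= [pact s2 _]pact_out /=; last by apply: disjointJK; apply: valP.
    rewrite pactE (_ : val k = val (fincl JI k)) // pactE => -[e1 e2].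
    by rewrite [LHS]surjective_pairing e2; congr (_, _); apply: val_inj.
  have := h (val k, b); rewrite /= [pact s2 _]pactE [pact s1 _]pact_out /=; last first.
    by apply/negP => inJ; case/negP: (disjointJK inJ); apply: valP.
  rewrite (_ : val k = val (fincl KI k)) // pactE => -[e1 e2].
  by rewrite [LHS]surjective_pairing e2; congr (_, _); apply: val_inj.
have [xI|xI] := boolP (x \in I); last first.
  by rewrite /= !pact_out //=; apply: contra xI; apply: fsubsetP.
have [xJ|xJ] := boolP (x \in J).
  rewrite /= [pact s2 _]pact_out /=; last exact: disjointJK.
  by rewrite (agrees_restriction a1).
have xK : x \in K by rewrite KE.
rewrite /= -(agrees_restriction a2) //.
have -> : pact s2 (x, b) = (val (s2 ([` xK]%fset, b)).1, (s2 ([` xK]%fset, b)).2).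
  exact: (pactE s2 [` xK]%fset b).
by rewrite pact_out //=; apply/negP => inJ; case/negP: (disjointJK inJ); apply: valP.
Qed.

Section Glue.
Variables (s1 : {perm (pmset J)}) (s2 : {perm (pmset K)}).

Definition glue_fun (x : pmset I) : pmset I :=
  if insub (val x.1) is Some j then emb JI (s1 (j, x.2))
  else if insub (val x.1) is Some k then emb KI (s2 (k, x.2)) else x.

Lemma glue_fun1 x : glue_fun (emb JI x) = emb JI (s1 x).
Proof. by case: x => k b; rewrite /glue_fun /= valK. Qed.

Lemma glue_fun2 x : glue_fun (emb KI x) = emb KI (s2 x).
Proof.
case: x => k b; rewrite /glue_fun /= insubF ?valK //.
by apply/negP => inJ; case/negP: (disjointJK inJ); apply: valP.
Qed.

Lemma emb_cover x : (exists y, x = emb JI y) \/ (exists y, x = emb KI y).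
Proof.
have [/codomP[y ->]|] := boolP (x \in codom (emb JI)); first by left; exists y.
by rewrite -emb_compl => /codomP[y ->]; right; exists y.
Qed.

Lemma emb_disjoint x y : emb JI x <> emb KI y.
Proof.
move=> e; have : emb KI y \in codom (emb KI) by apply: codom_f.
by rewrite -e emb_compl codom_f.
Qed.

Lemma glue_inj : injective glue_fun.
Proof.
move=> x y; have [[x' ->]|[x' ->]] := emb_cover x; have [[y' ->]|[y' ->]] := emb_cover y;
  rewrite ?glue_fun1 ?glue_fun2.
- by move=> /emb_inj /perm_inj ->.
- by move=> /emb_disjoint.
- by move=> /esym /emb_disjoint.
- by move=> /emb_inj /perm_inj ->.
Qed.

Definition perm_glue : {perm (pmset I)} := perm glue_inj.

Lemma glue_agrees : agrees JI perm_glue s1 /\ agrees KI perm_glue s2.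
Proof. by split=> x; rewrite permE ?glue_fun1 ?glue_fun2. Qed.

Lemma glue_unique s : agrees JI s s1 -> agrees KI s s2 -> s = perm_glue.
Proof.
move=> a1 a2; have [b1 b2] := glue_agrees; apply/permP => x.
by have [[x' ->]|[x' ->]] := emb_cover x; rewrite ?a1 ?a2 ?b1 ?b2.
Qed.

End Glue.

End Counting.

Definition shadowU (L : finType) (a b : shadow L) : shadow L := (a.1 :|: b.1, a.2 :|: b.2).

Lemma shadowU_inj (L : finType) (S1 S2 : {set L}) (a1 a2 b1 b2 : shadow L) :
  [disjoint S1 & S2] -> valid S1 a1 -> valid S2 a2 -> valid S1 b1 -> valid S2 b2 ->
  shadowU a1 a2 = shadowU b1 b2 -> a1 = b1 /\ a2 = b2.
Proof.
move=> dis.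
have nin k : k \in S1 -> k \in S2 -> False.
  by move=> k1 k2; rewrite (disjointFr dis k1) in k2.
suff key (x1 x2 y1 y2 : shadow L) : valid S1 x1 -> valid S2 x2 -> valid S1 y1 -> valid S2 y2 ->
    shadowU x1 x2 = shadowU y1 y2 ->
    [/\ x1.1 \subset y1.1, x1.2 \subset y1.2, x2.1 \subset y2.1 & x2.2 \subset y2.2].
  move=> va1 va2 vb1 vb2 e; have [h1 h2 h3 h4] := key _ _ _ _ va1 va2 vb1 vb2 e.
  have [h1' h2' h3' h4'] := key _ _ _ _ vb1 vb2 va1 va2 (esym e).
  move: h1 h2 h3 h4 h1' h2' h3' h4'; case: a1 a2 b1 b2 {va1 va2 vb1 vb2 e}
    => [t1 r1] [t2 r2] [t3 r3] [t4 r4] /= h1 h2 h3 h4 h1' h2' h3' h4'.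
  by split; congr (_, _); apply/eqP; rewrite finset.eqEsubset ?h1 ?h2 ?h3 ?h4.
move=> vx1 vx2 vy1 vy2 [e1 e2]; split; apply/fintype.subsetP => -[u v] h.
- have : (u, v) \in x1.1 :|: x2.1 by rewrite inE h.
  rewrite e1 inE => /orP[//|h']; case: (nin u.1).
    exact: (valid_in vx1 h).
  exact: (valid_in vy2 h').
- have : (u, v) \in x1.2 :|: x2.2 by rewrite inE h.
  rewrite e2 inE => /orP[//|h']; case: (nin u).
    exact: (valid_rin vx1 h).
  exact: (valid_rin vy2 h').
- have : (u, v) \in x1.1 :|: x2.1 by rewrite inE h orbT.
  rewrite e1 inE => /orP[h'|//]; case: (nin u.1).
    exact: (valid_in vy1 h').
  exact: (valid_in vx2 h).
have : (u, v) \in x1.2 :|: x2.2 by rewrite inE h orbT.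
rewrite e2 inE => /orP[h'|//]; case: (nin u).
  exact: (valid_rin vy1 h').
exact: (valid_rin vx2 h).
Qed.

Section SplitBlocks.
Variables (L : finType) (len : L -> nat) (len_gt0 : forall k, (0 < len k)%N) (k0 : L).
Variable epsN : nat -> bool.

Local Notation block S := (block_fset len S).

Definition sgnI (I : {fset nat}) (x : I) : bool := epsN (val x).

Local Notation shiftS S := (@bshift L len len_gt0 k0 S).
Local Notation kap S s := (@kappa L len len_gt0 k0 S (@sgnI (block S)) s).
Local Notation str S s := (@strand L len len_gt0 k0 S (@sgnI (block S)) s).
Local Notation endsS S := (@ends L len len_gt0 k0 S).
Local Notation labS S := (@lab L len len_gt0 k0 S).
Local Notation mergeS S s := (@bmerge L len len_gt0 k0 S s).
Local Notation shad S s := (@shadow_of L len len_gt0 k0 S (@sgnI (block S)) s).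

(** The power of [N] carried by a premap.  Condition (G) gives
    [chi - 2 * #|S|]; the normalisation of the traces gives [#|S|] on the left
    of (G) and minus the number of particular cycles on its right; each
    strand without ends leaves one index free. *)
Definition expo (S : {set L}) (s : {perm (pmset (block S))}) : int :=
  chi (shiftS S) (twist (@sgnI _) s) - #|S|%:Z - (ncycles (kap S s))./2%:Z
  + (n_comp (str S s) (unmarked (str S s) (endsS S)))%:Z.

Lemma card_block_sub (S1 S : {set L}) : S1 \subset S -> (block S1 `<=` block S)%fset.
Proof.
move=> /fintype.subsetP h; apply/fsubsetP => x.
by rewrite !(in_block len_gt0 k0) => /andP[-> /h ->].
Qed.

Variables (S1 S2 : {set L}).
Hypothesis dis : [disjoint S1 & S2].
Local Notation S := (S1 :|: S2).
Local Notation I := (block S).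
Local Notation J := (block S1).
Local Notation K := (block S2).

Lemma JI : (J `<=` I)%fset. Proof. exact/card_block_sub/finset.subsetUl. Qed.
Lemma KI : (K `<=` I)%fset. Proof. exact/card_block_sub/finset.subsetUr. Qed.

Lemma KE x : x \in I -> (x \in K) = (x \notin J).
Proof.
rewrite !(in_block len_gt0 k0) inE => /andP[-> /= /orP[h|h]]; rewrite h /=.
  by rewrite (disjointFr dis h).
by rewrite (disjointFl dis h).
Qed.

Lemma KE' : K = (I `\` J)%fset.
Proof.
apply/fsetP => x; rewrite inE; have [xI|xI] := boolP (x \in I).
  by rewrite KE // andbT.
rewrite andbF; apply/negP => /(fsubsetP KI) h; by rewrite h in xI.
Qed.

Lemma shift_emb S' (h : (block S' `<=` I)%fset) k :
  shiftS S (fincl h k) = fincl h (shiftS S' k).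
Proof.
apply: (@at_pos_inj _ _ len_gt0 k0); rewrite at_shift.
exact: (esym (at_shift len_gt0 k0 k)).
Qed.

Section Agree.
Variables (S' : {set L}) (h : (block S' `<=` I)%fset).
Variables (s : {perm (pmset I)}) (s' : {perm (pmset (block S'))}).
Hypothesis a : agrees h s s'.

Lemma twist_agrees : agrees h (twist (@sgnI _) s) (twist (@sgnI _) s').
Proof. by apply: agreesM; [apply: agreesM|]; rewrite ?[agrees _ _ _]a //; apply: agrees_delta. Qed.

Lemma kappa_agrees : agrees h (kap S s) (kap S' s').
Proof.
apply: agreesM; last by apply: agreesV; apply: agrees_gminus; apply: shift_emb.
by apply: agreesM; [apply: agrees_gplus; apply: shift_emb|apply: twist_agrees].
Qed.

Lemma gdiff_agrees : agrees h (gdiff (shiftS S)) (gdiff (shiftS S')).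
Proof.
apply: agreesM; first by apply: agreesV; apply: agrees_gminus; apply: shift_emb.
by apply: agrees_gplus; apply: shift_emb.
Qed.

Lemma strand_emb x y : str S s (emb h x) (emb h y) = str S' s' x y.
Proof.
rewrite /strand /strand_rel -emb_flip kappa_agrees !(inj_eq (@emb_inj _ _ h)).
by [].
Qed.

Lemma strand_emb_out x y : str S s (emb h x) y -> exists2 y', y = emb h y' & str S' s' x y'.
Proof.
rewrite /strand /strand_rel -emb_flip kappa_agrees => /orP[/eqP->|/andP[hx /eqP->]].
  by exists (kap S' s' (flip x)); rewrite ?eqxx.
by exists (flip x); rewrite ?eqxx ?andbT ?hx ?orbT.
Qed.

Lemma connect_strand_emb x y :
  connect (str S s) (emb h x) y <-> exists2 y', y = emb h y' & connect (str S' s') x y'.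
Proof.
apply: connect_embed => [u v|u v huv]; first exact: strand_emb_out.
by rewrite strand_emb.
Qed.

Lemma merge_emb x y : mergeS S s (emb h x) (emb h y) = mergeS S' s' x y.
Proof. by rewrite /bmerge /= a (inj_eq (@emb_inj _ _ h)). Qed.

Lemma connect_merge_emb x y :
  connect (mergeS S s) (emb h x) y <-> exists2 y', y = emb h y' & connect (mergeS S' s') x y'.
Proof.
apply: connect_embed => [u v|u v huv]; last by rewrite merge_emb.
case/orP => [/eqP <-|uv].
  by exists (s' u); [rewrite a|apply/orP; left; apply/eqP].
have vin : v \in codom (emb h).
  rewrite emb_codom (in_block len_gt0 k0).
  have := valP v.1; rewrite (in_block len_gt0 k0) => /andP[-> _] /=.
  rewrite -/(labS S v.1) -(eqP uv).
  exact: (lab_in len_gt0 k0 u.1).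
have [v' vE] := codomP vin; exists v' => //.
by apply/orP; right; rewrite vE in uv.
Qed.

Lemma unmarked_emb : [preim emb h of unmarked (str S s) (endsS S)] =i
   unmarked (str S' s') (endsS S').
Proof.
move=> x; rewrite !inE; apply/forall_inP/forall_inP => hx y yE.
  apply: contra (hx (emb h y) yE) => xy; apply/connect_strand_emb.
  by exists y.
apply/negP => /connect_strand_emb[y' y'E xy'].
rewrite y'E in yE; have y'in : y' \in endsS S' := yE.
by move: (hx y' y'in); rewrite xy'.
Qed.

End Agree.

Variables (s : {perm (pmset I)}) (s1 : {perm (pmset J)}) (s2 : {perm (pmset K)}).
Hypotheses (a1 : agrees JI s s1) (a2 : agrees KI s s2).
Hypotheses (f0 : folded s) (f1 : folded s1) (f2 : folded s2).

Lemma expo_split : expo s = expo s1 + expo s2.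
Proof.
rewrite /expo !chi_even //.
have f0' := kreweras_folded (shiftS S) (@sgnI _) f0.
have f1' := kreweras_folded (shiftS S1) (@sgnI _) f1.
have f2' := kreweras_folded (shiftS S2) (@sgnI _) f2.
have c1 := ncycles_split KE a1 a2.
have c2 := ncycles_split KE (kappa_agrees a1) (kappa_agrees a2).
have c3 := ncycles_split KE (gdiff_agrees JI) (gdiff_agrees KI).
have e1 := ncycles_even f1; have e2 := ncycles_even f2.
have e3 := ncycles_even f1'; have e4 := ncycles_even f2'.
have e5 := ncycles_even (gdiff_folded (shiftS S1)).
have e6 := ncycles_even (gdiff_folded (shiftS S2)).
have cS : #|S| = (#|S1| + #|S2|)%N.
  have /eqP e0 : S1 :&: S2 == finset.set0 by rewrite finset.setI_eq0.
  by rewrite cardsU e0 cards0 subn0.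
have cI : #|` I| = (#|` J| + #|` K|)%N.
  rewrite KE' cardfsD (fsetIidPr JI) subnKC //.
  exact/fsubset_leq_card/JI.
have cM : n_comp (str S s) (unmarked (str S s) (endsS S)) =
   (n_comp (str S1 s1) (unmarked (str S1 s1) (endsS S1)) +
    n_comp (str S2 s2) (unmarked (str S2 s2) (endsS S2)))%N.
  rewrite (n_comp_split (JI := JI) (KI := KI) KE (e1 := str S1 s1) (e2 := str S2 s2)).
  - by congr (_ + _)%N; apply: eq_n_comp_r; apply: unmarked_emb.
  - exact: strand_sym.
  - exact: strand_sym.
  - exact: strand_sym.
  - exact: strand_emb_out.
  - exact: strand_emb.
  - exact: strand_emb.
  - by apply: unmarked_closed; apply: strand_sym.
rewrite /kappa in c2 *; move: c1 c2 c3 e1 e2 e3 e4 e5 e6.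
move: (ncycles s) (ncycles s1) (ncycles s2) => x1 y1 z1.
move: (ncycles (kreweras _ _ s)) (ncycles (kreweras _ _ s1)) (ncycles (kreweras _ _ s2)) => x2 y2 z2.
move: (ncycles (gdiff _)) (ncycles (gdiff _)) (ncycles (gdiff _)) => x3 y3 z3.
move=> -> -> -> e1 e2 e3 e4 e5 e6; rewrite cS cI cM.
have hf y z : y = y./2.*2 -> z = z./2.*2 -> (y + z)./2 = (y./2 + z./2)%N.
  by move=> -> ->; rewrite -doubleD !doubleK.
rewrite !hf //; lia.
Qed.

Lemma shadow_split : shad S s = shadowU (shad S1 s1) (shad S2 s2).
Proof.
have cov := @emb_cover _ _ _ JI KI KE.
have e1 : (shad S s).1 = (shad S1 s1).1 :|: (shad S2 s2).1.
  apply/setP => -[u v]; apply/idP/idP.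
    case/shadow_tauP => x [y [ex ey xy uE vE]]; rewrite inE; apply/orP.
    have [[x' xE]|[x' xE]] := cov x; rewrite xE in ex xy uE; [left|right].
      have [y' yE xy'] := (connect_strand_emb a1 _ _).1 xy; rewrite yE in ey vE.
      by apply/shadow_tauP; exists x', y'.
    have [y' yE xy'] := (connect_strand_emb a2 _ _).1 xy; rewrite yE in ey vE.
    by apply/shadow_tauP; exists x', y'.
  rewrite inE => /orP[] /shadow_tauP[x [y [ex ey xy uE vE]]]; apply/shadow_tauP.
    exists (emb JI x), (emb JI y); split=> //.
    by apply/(connect_strand_emb a1); exists y.
  exists (emb KI x), (emb KI y); split=> //.
  by apply/(connect_strand_emb a2); exists y.
have e2 : (shad S s).2 = (shad S1 s1).2 :|: (shad S2 s2).2.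
  apply/setP => -[u v]; apply/idP/idP.
    case/shadow_rhoP => x [y [xy uE vE]]; rewrite inE; apply/orP.
    have [[x' xE]|[x' xE]] := cov x; rewrite xE in xy uE; [left|right].
      have [y' yE xy'] := (connect_merge_emb a1 _ _).1 xy; rewrite yE in vE.
      by apply/shadow_rhoP; exists x', y'.
    have [y' yE xy'] := (connect_merge_emb a2 _ _).1 xy; rewrite yE in vE.
    by apply/shadow_rhoP; exists x', y'.
  rewrite inE => /orP[] /shadow_rhoP[x [y [xy uE vE]]]; apply/shadow_rhoP.
    exists (emb JI x), (emb JI y); split=> //.
    by apply/(connect_merge_emb a1); exists y.
  exists (emb KI x), (emb KI y); split=> //.
  by apply/(connect_merge_emb a2); exists y.
by rewrite [LHS]surjective_pairing e1 e2.
Qed.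

End SplitBlocks.

(** * Blocks as products along cycles *)

Lemma fcycle_ordS n : fcycle (@ordS n) (enum 'I_n).
Proof.
case: n => [|n]; first by rewrite enum_ord0.
pose e' (i j : nat) := (i.+1 %% n.+1 == j)%N.
rewrite (_ : path.cycle _ _ = path.cycle (relpre val e') (enum 'I_n.+1)); last by apply: eq_cycle.
rewrite -cycle_map val_enum_ord /= rcons_path.
have pe i k : (i + k <= n)%N -> path e' i (iota i.+1 k) /\ last i (iota i.+1 k) = (i + k)%N.
  elim: k i => [|k IH] i; first by rewrite addn0.
  rewrite addnS -addSn => le; have [h1 h2] := IH i.+1 le.
  rewrite /= h1 h2 /e' modn_small ?eqxx // ltnS.
  by apply: leq_trans le; rewrite addSn ltnS leq_addr.
have [-> ->] := pe 0%N n (leqnn n).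
by rewrite /e' add0n modnn eqxx.
Qed.

Lemma enum_index_enum (T : finType) : enum T = index_enum T.
Proof. by rewrite enumT [index_enum T]unlock. Qed.

Lemma tr_delta (F : comNzRingType) (N : nat) (B : 'M[F]_N) a b :
  \tr (B *m delta_mx b a) = B a b.
Proof.
rewrite /mxtrace (bigD1 a) //= mxE (bigD1 b) //= mxE !eqxx mulr1.
rewrite big1 => [|i ib]; last by rewrite mxE (negbTE ib) mulr0.
rewrite addr0 big1 ?addr0 // => i ia; rewrite mxE big1 // => j _.
by rewrite mxE (negbTE ia) andbF mulr0.
Qed.

Lemma prod_last (F : comNzRingType) (N n : nat) (G : 'I_n -> 'M[F]_N) (D : 'M[F]_N) :
  (0 < n)%N ->
  \prod_(j < n) (G j *m (if j.+1 == n then D else 1%:M)) = (\prod_(j < n) G j) *m D.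
Proof.
case: n G => // n G _; rewrite !big_ord_recr /= eqxx -[RHS]mulmxA; congr (_ *m _).
apply: eq_bigr => i _; rewrite eqSS (ltn_eqF (ltn_ord i)).
exact: mulmx1.
Qed.

(** The trace does not depend on the point where a cycle is cut. *)
Lemma tr_cycle_perm (F : fieldType) (N : nat) (T : finType) (M : T -> 'M[F]_N)
    (g : T -> T) (c c' : seq T) : (0 < N)%N ->
  uniq c -> fcycle g c -> c != [::] -> uniq c' -> fcycle g c' -> c' != [::] -> c =i c' ->
  \tr (\prod_(x <- c) M x) = \tr (\prod_(x <- c') M x).
Proof.
move=> N0 u fc nc u' fc' nc' cc'; pose i0 := Ordinal N0.
rewrite (tr_cycle M i0 u fc nc) (tr_cycle M i0 u' fc' nc').
rewrite (@eq_supported _ _ i0 (mem c) (mem c')) //.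
by apply: eq_bigr => phi _; apply: perm_big; apply: uniq_perm.
Qed.

Section BlockTrace.
Variables (L : finType) (len : L -> nat) (len_gt0 : forall k, (0 < len k)%N) (k0 : L).
Variables (F : fieldType) (N : nat) (S : {set L}).
Local Notation I := (block_fset len S).
Local Notation atp := (@at_pos L len len_gt0 k0 S).
Local Notation labS := (@lab L len len_gt0 k0 S).
Local Notation endS := (@is_end L len len_gt0 k0 S).
Local Notation shS := (@bshift L len len_gt0 k0 S).

(** The unit matrix after the last factor turns the trace of a block into one
    of its entries, by [tr_delta]. *)
Lemma tr_blocks (Z : {k : L & 'I_(len k)} -> 'M[F]_N) (phi : L * bool -> 'I_N) : (0 < N)%N ->
  tr_perm shS (fun x => Z (atp x) *m
    (if endS x then delta_mx (phi (labS x, true)) (phi (labS x, false)) else 1%:M)) =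
  N%:R ^- #|S| *
  \prod_(k in S) (\prod_(j < len k) Z (Tagged (fun k => 'I_(len k)) j))
                   (phi (k, false)) (phi (k, true)).
Proof.
move=> N0; rewrite /tr_perm; set M := (X in tr_along _ _ X); rewrite /tr_along.
pose B k := [set x : I | labS x == k]%SET.
have pE x : porbit shS x = B (labS x).
  by apply/setP => y; rewrite porbit_fconnect inE (fconnect_lab len_gt0 k0) eq_sym.
have orbE : porbits shS = B @: S.
  apply/setP => A; apply/imsetP/imsetP => [[x _ ->]|[k kS ->]].
    by exists (labS x); rewrite ?pE //; apply: lab_in.
  have [x xk _] := end_exists len_gt0 k0 kS.
  by exists x; rewrite // pE xk.
rewrite (eq_bigl (mem (B @: S))); last first.
  by move=> A; rewrite -orbE /= (_ : A \subset _) ?andbT //; apply/fintype.subsetP.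
rewrite big_imset /=; last first.
  move=> k l kS lS BB; have [x xk _] := end_exists len_gt0 k0 kS.
  have : x \in B k by rewrite inE xk.
  by rewrite BB inE xk => /eqP.
rewrite /ntr big_split /= prodr_const exprVn; congr (_ * _); apply: eq_bigr => k kS.
have h (j : 'I_(len k)) : pos (Tagged (fun k => 'I_(len k)) j : {k : L & 'I_(len k)}) \in I.
  rewrite (pos_in_block len_gt0 k0); exact: kS.
pose el (j : 'I_(len k)) : I := [` h j]%fset.
have elE j : atp (el j) = Tagged (fun k => 'I_(len k)) j by rewrite /at_pos /= posK.
have lel j : labS (el j) = k by rewrite /lab elE.
have eli : injective el.
  move=> i j e; apply: val_inj.
  have : atp (el i) = atp (el j) by rewrite e.
  rewrite !elE => /eqP; rewrite eq_Tagged => /eqP ij; exact: (congr1 val ij).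
have BkO : B k \in porbits shS by rewrite orbE; apply: imset_f.
have [u fc nn mE] := cycle_seqP BkO.
rewrite (@tr_cycle_perm _ _ _ M shS _ [seq el j | j <- enum 'I_(len k)]) //; last 4 first.
- by rewrite map_inj_uniq ?enum_uniq.
- rewrite cycle_map; apply: sub_cycle (fcycle_ordS (len k)) => i j /eqP <- /=.
  by apply/eqP/(@at_pos_inj _ _ len_gt0 k0); rewrite at_shift !elE.
- by rewrite -size_eq0 size_map size_enum_ord -lt0n.
- move=> x; rewrite mE inE; apply/eqP/mapP => [xk|[j _ ->]]; last exact: lel.
  exists (cast_ord (congr1 len xk) (tagged (atp x))); first by rewrite mem_enum.
  apply: (@at_pos_inj _ _ len_gt0 k0); rewrite elE.
  by apply: pos_eq.
rewrite big_map enum_index_enum.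
have -> : \prod_(j < len k) M (el j) = (\prod_(j < len k) Z (Tagged (fun k => 'I_(len k)) j))
    *m delta_mx (phi (k, true)) (phi (k, false)).
  rewrite /M; under eq_bigr do rewrite elE lel.
  have endE j : endS (el j) = (j.+1 == len k).
    by rewrite /is_end lel elE.
  under eq_bigr do rewrite endE.
  exact: prod_last.
exact: tr_delta.
Qed.

End BlockTrace.

(** * Expectations of complex random variables *)

Section Expectation.
Variables (R : realType) (d : measure_display) (T : measurableType d) (P : probability T R).

Definition rint (r : T -> R) := P.-integrable setT (EFin \o r).
Definition rexp (r : T -> R) : R := fine (\int[P]_w (r w)%:E)%E.

Lemma rintD r s : rint r -> rint s -> rint (fun w => r w + s w).
Proof. by move=> hr hs; rewrite /rint (_ : _ \o _ = (EFin \o r) \+ (EFin \o s))%E //; apply: integrableD. Qed.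

Lemma rintZ c r : rint r -> rint (fun w => c * r w).
Proof. by move=> hr; rewrite /rint (_ : _ \o _ = (fun w => c%:E * (EFin \o r) w)%E) //; apply: integrableZl. Qed.

Lemma rexpD r s : rint r -> rint s -> rexp (fun w => r w + s w) = rexp r + rexp s.
Proof.
move=> hr hs; rewrite /rexp -fineD.
- by congr fine; rewrite -integralD_EFin.
- exact: integrable_fin_num.
- exact: integrable_fin_num.
Qed.

Lemma rexpZ c r : rint r -> rexp (fun w => c * r w) = c * rexp r.
Proof.
move=> hr; rewrite /rexp -[c in RHS]/(fine c%:E) -fineM //.
- by congr fine; rewrite -integralZl //.
- exact: integrable_fin_num.
Qed.

Lemma rint_cst c : rint (fun=> c).
Proof. exact: finite_measure_integrable_cst. Qed.

Lemma rexp_cst c : rexp (fun=> c) = c.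
Proof. by rewrite /rexp integral_cst //= probability_setT mule1. Qed.

Local Notation C := R[i].
Implicit Types Z W : T -> C.

Lemma cexpE Z : cexp P Z = Complex (rexp (fun w => complex.Re (Z w))) (rexp (fun w => complex.Im (Z w))).
Proof. by rewrite /cexp unlock. Qed.

Lemma cReD (a b : C) : complex.Re (a + b) = complex.Re a + complex.Re b.
Proof. by case: a b => ? ? []. Qed.
Lemma cImD (a b : C) : complex.Im (a + b) = complex.Im a + complex.Im b.
Proof. by case: a b => ? ? []. Qed.
Lemma cReM (a b : C) : complex.Re (a * b) =
  complex.Re a * complex.Re b + (-1) * (complex.Im a * complex.Im b).
Proof. by case: a b => ? ? [] ? ?; rewrite mulN1r. Qed.
Lemma cImM (a b : C) : complex.Im (a * b) =
  complex.Re a * complex.Im b + complex.Im a * complex.Re b.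
Proof. by case: a b => ? ? [] ? ? /=; rewrite addrC [X in _ + X]mulrC addrC [X in _ + X]mulrC mulrC. Qed.

Lemma eq_cexp Z W : Z =1 W -> cexp P Z = cexp P W.
Proof. by move=> ZW; rewrite (funext ZW). Qed.

Lemma cintegrableD Z W : cintegrable P Z -> cintegrable P W ->
  cintegrable P (fun w => Z w + W w).
Proof.
move=> [h1 h2] [h3 h4]; split.
  by rewrite (_ : (fun _ => _) = (EFin \o (fun w => complex.Re (Z w) + complex.Re (W w))));
    [exact: rintD|apply/funext => w /=; rewrite cReD].
by rewrite (_ : (fun _ => _) = (EFin \o (fun w => complex.Im (Z w) + complex.Im (W w))));
  [exact: rintD|apply/funext => w /=; rewrite cImD].
Qed.

Lemma cexpD Z W : cintegrable P Z -> cintegrable P W ->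
  cexp P (fun w => Z w + W w) = cexp P Z + cexp P W.
Proof.
move=> [h1 h2] [h3 h4]; rewrite !cexpE.
under [X in Complex (rexp X) _]eq_fun do rewrite cReD.
under [X in Complex _ (rexp X)]eq_fun do rewrite cImD.
by rewrite !rexpD.
Qed.

Lemma cintegrable_cst c : cintegrable P (fun=> c).
Proof. by split; apply: rint_cst. Qed.

Lemma cexp_cst c : cexp P (fun=> c) = c.
Proof. by rewrite cexpE !rexp_cst; case: c. Qed.

Lemma cintegrableZ c Z : cintegrable P Z -> cintegrable P (fun w => c * Z w).
Proof.
move=> [h1 h2]; split.
  rewrite (_ : (fun _ => _) = (EFin \o (fun w => complex.Re c * complex.Re (Z w) + (-1) * (complex.Im c * complex.Im (Z w))))).
    by apply: rintD; [exact: rintZ|apply/rintZ/rintZ].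
  by apply/funext => w /=; rewrite cReM.
rewrite (_ : (fun _ => _) = (EFin \o (fun w => complex.Re c * complex.Im (Z w) + complex.Im c * complex.Re (Z w)))).
  by apply: rintD; exact: rintZ.
by apply/funext => w /=; rewrite cImM.
Qed.

Lemma cexpZ c Z : cintegrable P Z -> cexp P (fun w => c * Z w) = c * cexp P Z.
Proof.
move=> [h1 h2]; rewrite !cexpE.
under [X in Complex (rexp X) _]eq_fun do rewrite cReM.
under [X in Complex _ (rexp X)]eq_fun do rewrite cImM.
rewrite !rexpD ?rexpZ //; try exact: rintZ; try (by apply/rintZ/rintZ).
by apply/eqP; rewrite eq_complex /= cReM cImM /= !eqxx.
Qed.

Lemma cintegrable_sum (J : Type) (r : seq J) (G : J -> T -> C) (p : pred J) :
  (forall j, p j -> cintegrable P (G j)) ->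
  cintegrable P (fun w => \sum_(j <- r | p j) G j w).
Proof.
move=> h; elim: r => [|j r IH].
  rewrite (_ : (fun w => _) = (fun=> 0 : C)); first exact: cintegrable_cst.
  by apply/funext => w; rewrite big_nil.
rewrite (_ : (fun w => _) = (fun w => if p j then G j w + \sum_(i <- r | p i) G i w
    else \sum_(i <- r | p i) G i w)); last by apply/funext => w; rewrite big_cons.
by case pj: (p j) => //; apply: cintegrableD => //; apply: h.
Qed.

Lemma cexp_sum (J : Type) (r : seq J) (G : J -> T -> C) (p : pred J) :
  (forall j, p j -> cintegrable P (G j)) ->
  cexp P (fun w => \sum_(j <- r | p j) G j w) = \sum_(j <- r | p j) cexp P (G j).
Proof.
move=> h; elim: r => [|j r IH].
  rewrite (_ : (fun w => _) = (fun=> 0 : C)); first by rewrite cexp_cst big_nil.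
  by apply/funext => w; rewrite big_nil.
rewrite (_ : (fun w => _) = (fun w => if p j then G j w + \sum_(i <- r | p i) G i w
    else \sum_(i <- r | p i) G i w)); last by apply/funext => w; rewrite big_cons.
rewrite big_cons -IH; case pj: (p j) => //.
by rewrite cexpD //; [apply: h|apply: cintegrable_sum].
Qed.

Local Open Scope classical_set_scope.

Definition smeas (G : set (set T)) (r : T -> R) := forall B, measurable B -> G (r @^-1` B).

(** The joint distribution of [r] and [s] is the product of their
    distributions; Fubini's theorem for [z.1 * z.2] gives the rest. *)
Lemma rexpM_indep (F G : set (set T)) (r s : T -> R) :
  indep2 P F G -> smeas F r -> smeas G s -> rint r -> rint s ->
  rint (fun w => r w * s w) /\ rexp (fun w => r w * s w) = rexp r * rexp s.
Proof.
move=> ind Fr Gs ir is_.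
have mr : measurable_fun setT r by have := measurable_int _ ir => /measurable_EFinP.
have ms : measurable_fun setT s by have := measurable_int _ is_ => /measurable_EFinP.
pose X1 : {mfun T >-> R} := HB.pack r (isMeasurableFun.Build _ _ _ _ _ mr).
pose X2 : {mfun T >-> R} := HB.pack s (isMeasurableFun.Build _ _ _ _ _ ms).
pose h (w : T) : (R * R)%type := (r w, s w).
have mh : measurable_fun setT h by apply: measurable_fun_pair.
pose H : {mfun T >-> (R * R)%type} := HB.pack h (isMeasurableFun.Build _ _ _ _ _ mh).
pose D1 := distribution P X1; pose D2 := distribution P X2; pose D := distribution P H.
have DE A : measurable A -> (D1 \x D2)%E A = D A.
  move=> mA; apply: product_measure_unique => // B1 B2 mB1 mB2.
  rewrite /D /D1 /D2 /distribution /pushforward -ind; [|exact: Fr|exact: Gs].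
  by congr (P _).
pose f (z : R * R) : \bar R := (z.1 * z.2)%:E.
have mf : measurable_fun setT f by apply/measurable_EFinP; apply: measurable_funM.
have push (X : {mfun T >-> R}) : P.-integrable setT (EFin \o X) ->
   (distribution P X).-integrable setT EFin.
  by move=> iX; apply: integrable_pushforward.
have pushE (X : {mfun T >-> R}) : P.-integrable setT (EFin \o X) ->
   (\int[distribution P X]_x x%:E = \int[P]_w (X w)%:E)%E.
  by move=> iX; rewrite integral_pushforward.
have i1 := push X1 ir; have i2 := push X2 is_.
have inf : (D1 \x D2)%E.-integrable setT f.
  apply/integrable12ltyP => //.
  have E x : (\int[D2]_y `|f (x, y)| = `|x|%:E * \int[D2]_y `|y%:E|)%E.
    rewrite -ge0_integralZl //=.
    - by apply: eq_integral => y _; rewrite /f /= normrM EFinM.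
    - by apply: measurableT_comp => //; apply: measurableT_comp.
  under eq_integral do rewrite E.
  rewrite ge0_integralZr //=; last by apply: integral_ge0.
  - have g0 (Q : probability R R) : (0 <= \int[Q]_x `|x|%:E)%E by apply: integral_ge0.
    apply: lte_mul_pinfty; first exact: g0.
      by rewrite ge0_fin_numE ?g0 //; move: i1 => /integrableP[].
    by move: i2 => /integrableP[].
  - by apply: measurableT_comp => //; apply: measurableT_comp.
have ifh : P.-integrable setT (f \o h).
  apply/integrableP; split; first exact: measurableT_comp mf mh.
  have E : (\int[pushforward P h]_y `|f y| = \int[P]_w `|f (h w)|)%E.
    by rewrite ge0_integral_pushforward //; apply: measurableT_comp.
  rewrite -[X in (X < _)%E]E.
  move: inf => /integrableP[_]; congr (_ < _)%E.
  by apply: eq_measure_integral => A mA _; first [exact: DE|exact: (esym (DE A mA))].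
split; first exact: ifh.
rewrite /rexp -fineM; [|exact: integrable_fin_num|exact: integrable_fin_num].
congr fine; transitivity (\int[D]_z f z)%E; first by rewrite integral_pushforward.
have <- : (\int[(D1 \x D2)%E]_z f z = \int[D]_z f z)%E.
  by apply: eq_measure_integral => A mA _; first [exact: DE|exact: (esym (DE A mA))].
have E2 : (\int[D2]_x x%:E = \int[P]_w (s w)%:E)%E := pushE X2 is_.
have E1 : (\int[D1]_x x%:E = \int[P]_w (r w)%:E)%E := pushE X1 ir.
have fin2 : (\int[P]_w (s w)%:E)%E \is a fin_num by exact: integrable_fin_num.
rewrite -integral12_prod_meas1 // /fubini_F -E1 -(fineK fin2).
rewrite -integralZr //; apply: eq_integral => x _.
by rewrite fineK // -E2 -integralZl //; apply: eq_integral => y _.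
Qed.

End Expectation.

Section Independence.
Variables (R : realType) (d : measure_display) (T : measurableType d) (P : probability T R).
Local Open Scope classical_set_scope.
Local Notation C := R[i].
Implicit Types Z W : T -> C.

Lemma smeasP (E : set (set T)) (r : T -> R) :
  smeas <<s E>> r <-> measurable_fun [set: g_sigma_algebraType E] (r : g_sigma_algebraType E -> R).
Proof.
split=> h; first by move=> _ B mB; rewrite setTI; apply: h.
by move=> B mB; rewrite -[_ @^-1` _]setTI; apply: h.
Qed.

Lemma smeas_cst (E : set (set T)) (c : R) : smeas <<s E>> ((fun=> c) : T -> R).
Proof. by apply/smeasP; apply: measurable_cst. Qed.

Lemma smeasD (E : set (set T)) (r s : T -> R) :
  smeas <<s E>> r -> smeas <<s E>> s -> smeas <<s E>> (fun w => r w + s w).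
Proof. by move=> /smeasP hr /smeasP hs; apply/smeasP; apply: measurable_funD. Qed.

Lemma smeasM (E : set (set T)) (r s : T -> R) :
  smeas <<s E>> r -> smeas <<s E>> s -> smeas <<s E>> (fun w => r w * s w).
Proof. by move=> /smeasP hr /smeasP hs; apply/smeasP; apply: measurable_funM. Qed.

Lemma ReMf Z W : (fun w => complex.Re (Z w * W w)) = (fun w => complex.Re (Z w) * complex.Re (W w)
   + (-1) * (complex.Im (Z w) * complex.Im (W w))).
Proof. by apply/funext => w; rewrite cReM. Qed.

Lemma ImMf Z W : (fun w => complex.Im (Z w * W w)) = (fun w => complex.Re (Z w) * complex.Im (W w)
   + complex.Im (Z w) * complex.Re (W w)).
Proof. by apply/funext => w; rewrite cImM. Qed.

Definition csmeas (G : set (set T)) Z :=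
  smeas G (fun w => complex.Re (Z w)) /\ smeas G (fun w => complex.Im (Z w)).

Lemma csmeas_cst (E : set (set T)) (c : C) : csmeas <<s E>> (fun=> c).
Proof. by split; apply: smeas_cst. Qed.

Lemma csmeasD (E : set (set T)) Z W :
  csmeas <<s E>> Z -> csmeas <<s E>> W -> csmeas <<s E>> (fun w => Z w + W w).
Proof.
move=> [h1 h2] [h3 h4]; split.
  by under eq_fun do rewrite cReD; apply: smeasD.
by under eq_fun do rewrite cImD; apply: smeasD.
Qed.

Lemma csmeasM (E : set (set T)) Z W :
  csmeas <<s E>> Z -> csmeas <<s E>> W -> csmeas <<s E>> (fun w => Z w * W w).
Proof.
move=> [h1 h2] [h3 h4]; rewrite /csmeas ReMf ImMf; split.
  by apply: smeasD; [|apply: smeasM; first exact: smeas_cst]; apply: smeasM.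
by apply: smeasD; apply: smeasM.
Qed.

Lemma csmeas_sub (F G : set (set T)) Z : F `<=` G -> csmeas F Z -> csmeas G Z.
Proof. by move=> FG [h1 h2]; split=> B mB; apply: FG; [apply: h1|apply: h2]. Qed.

Lemma cexpM_indep (F G : set (set T)) Z W :
  indep2 P F G -> csmeas F Z -> csmeas G W -> cintegrable P Z -> cintegrable P W ->
  cintegrable P (fun w => Z w * W w) /\
  cexp P (fun w => Z w * W w) = cexp P Z * cexp P W.
Proof.
move=> ind [Z1 Z2] [W1 W2] [iZ1 iZ2] [iW1 iW2].
have [i11 e11] := rexpM_indep ind Z1 W1 iZ1 iW1.
have [i12 e12] := rexpM_indep ind Z1 W2 iZ1 iW2.
have [i21 e21] := rexpM_indep ind Z2 W1 iZ2 iW1.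
have [i22 e22] := rexpM_indep ind Z2 W2 iZ2 iW2.
split.
  split; rewrite -/(rint P (fun w => _ (Z w * W w))) ?ReMf ?ImMf.
    by apply: rintD => //; apply: rintZ.
  exact: rintD.
rewrite !cexpE ReMf ImMf !rexpD ?rexpZ //; last exact: rintZ.
by rewrite e11 e12 e21 e22 mulN1r; apply/eqP; rewrite eq_complex /= !eqxx.
Qed.

Section Grouping.
Variables (I : finType) (E : I -> set (set T)).
Let F (i : I) : set (set T) := <<s E i>>.
Hypothesis Fm : forall i, F i `<=` measurable.
Hypothesis ind : mutually_indep P F.

(** A family closed under intersection that generates the sigma-algebra of
    all the [F i], [i] in [D]. *)
Definition meets (D : {set I}) : set (set T) :=
  [set B | exists2 A : I -> set T, (forall i, F i (A i)) &
     B = \bigcap_(i in [set i | i \in D]) A i].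

Let sF i : sigma_algebra [set: T] (F i).
Proof. exact: smallest_sigma_algebra. Qed.

Let FT i : F i setT.
Proof. by have [h1 h2 h3] := sF i; rewrite -[setT]setD0; apply: h2. Qed.

Let FI i A B : F i A -> F i B -> F i (A `&` B).
Proof. exact: (@measurableI _ (g_sigma_algebraType (E i))). Qed.

Lemma meets_setI D : setI_closed (meets D).
Proof.
move=> _ _ [A FA ->] [B FB ->]; exists (fun i => A i `&` B i); first by move=> i; apply: FI.
by rewrite bigcapI.
Qed.

Lemma meets_measurable D : meets D `<=` measurable.
Proof.
move=> _ [A FA ->]; apply: fin_bigcap_measurable => [|i _]; first exact: finite_finset.
exact: (Fm (FA i)).
Qed.

Lemma meets_sub (D : {set I}) i : i \in D -> F i `<=` meets D.
Proof.
move=> iD B FB; exists (fun j => if j == i then B else setT).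
  by move=> j; case: eqP => [->//|_]; apply: FT.
apply/seteqP; split=> [x Bx j /= jD|x /(_ i iD)]; last by rewrite eqxx.
by case: (j == i).
Qed.

(** For fixed [B] in [F c], the events independent of [B] form a Dynkin class,
    and mutual independence puts [meets D] inside it. *)
Lemma meets_indep (D : {set I}) c : c \notin D -> indep2 P <<s meets D>> (F c).
Proof.
move=> cD A B mA FB; have mB : measurable B := Fm FB.
pose G : set (set T) := [set A | measurable A /\ P (A `&` B) = (P A * P B)%E].
suff /(_ A mA)[] : <<s meets D>> `<=` G by [].
rewrite -(setI_closed_g_dynkin_g_sigma_algebra (@meets_setI D)).
apply: smallest_sub; last first.
  move=> _ [A' FA' ->]; split; first by apply: meets_measurable; exists A'.
  pose A2 i := if i == c then B else A' i.
  have h2 : \bigcap_(i in [set i | i \in D]) A' i `&` B =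
      \bigcap_(i in [set i | i \in (c |: D)%SET]) A2 i.
    apply/seteqP; split=> [x [h Bx] i /=|x h].
      by rewrite /A2 !inE; case: eqP => //= _ iD; apply: h.
    split; last by have := h c; rewrite /A2 eqxx; apply; rewrite /= !inE eqxx.
    move=> i iD; have := h i; rewrite /A2; case: eqP => [ic|_]; last first.
      by apply; rewrite /= !inE iD orbT.
    by move: iD; rewrite /= ic (negbTE cD).
  rewrite h2 ind; last by move=> i _; rewrite /A2; case: eqP => [->|].
  rewrite big_setU1 //= /A2 eqxx muleC; congr (_ * _)%E.
  rewrite ind //; apply: eq_bigr => i iD; case: eqP => // ic.
  by rewrite ic (negbTE cD) in iD.
split.
- by split; [exact: measurableT|rewrite setTI probability_setT mul1e].
- move=> A' [mA' eA']; split; first exact: measurableC.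
  have fin X : measurable X -> P X \is a fin_num by move=> mX; apply: fin_num_measure.
  have -> : ~` A' `&` B = B `\` A' by rewrite setIC.
  have eD : P (B `\` A') = (P B - P (B `&` A'))%E.
    by apply: measureD => //; rewrite ltey_eq fin.
  rewrite eD.
  have eB : P (B `&` A') = (P A' * P B)%E by rewrite -eA' setIC.
  rewrite eB probability_setC // muleBl ?mul1e ?fin //.
move=> A' tA' GA'; split; first by apply: bigcup_measurable => k _; have [] := GA' k.
rewrite setI_bigcupl measure_bigcup /=; last 2 first.
- by move=> k _; apply: measurableI => //; have [] := GA' k.
- apply/trivIsetP => i j _ _ ij; move/trivIsetP: tA' => /(_ i j Logic.I Logic.I ij) tA'.
  by rewrite setIACA tA' set0I.
rewrite measure_bigcup //; last by move=> k _; have [] := GA' k.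
have fB : P B \is a fin_num by exact: fin_num_measure.
rewrite muleC -(fineK fB) -nneseriesZl //.
by apply: eq_eseriesr => k _; have [_ ->] := GA' k; rewrite fineK // muleC.
Qed.

(** The product of some factors is measurable for the sigma-algebra of their
    indices, which is independent of the next factor by [meets_indep]. *)
Lemma cexp_prod_indep (Z : I -> T -> C) (r : seq I) :
  (forall i, csmeas (F i) (Z i)) -> (forall i, cintegrable P (Z i)) -> uniq r ->
  cintegrable P (fun w => \prod_(i <- r) Z i w) /\
  cexp P (fun w => \prod_(i <- r) Z i w) = \prod_(i <- r) cexp P (Z i).
Proof.
move=> mZ iZ ur.
have meas (q : seq I) (D : {set I}) : {subset q <= D} ->
    csmeas <<s meets D>> (fun w => \prod_(i <- q) Z i w).
  elim: q => [|i q IH] qD.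
    rewrite (_ : (fun w => _) = (fun=> 1)); first exact: csmeas_cst.
    by apply/funext => w; rewrite big_nil.
  rewrite (_ : (fun w => _) = (fun w => Z i w * \prod_(j <- q) Z j w)); last first.
    by apply/funext => w; rewrite big_cons.
  apply: csmeasM; last by apply: IH => j jq; apply: qD; rewrite inE jq orbT.
  apply: csmeas_sub (mZ i); apply: subset_trans (@sub_gen_smallest _ _ _).
  by apply: meets_sub; apply: qD; rewrite inE eqxx.
elim: r ur => [_|i r IH /= /andP[ir /IH{IH}[IH1 IH2]]].
  rewrite (_ : (fun w => _) = (fun=> 1)); last by apply/funext => w; rewrite big_nil.
  by rewrite big_nil cexp_cst; split=> //; apply: cintegrable_cst.
rewrite (_ : (fun w => _) = (fun w => (\prod_(j <- r) Z j w) * Z i w)); last first.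
  by apply/funext => w; rewrite big_cons mulrC.
rewrite big_cons -IH2 mulrC.
have /meets_indep ind_i : i \notin [set j | j \in r]%SET by rewrite inE.
apply: cexpM_indep ind_i _ (mZ i) IH1 (iZ i).
by apply: meas => j jr; rewrite inE.
Qed.

End Grouping.

Section Polynomials.
Variables (N : nat) (Lam : Type) (X : Lam -> T -> 'M[C]_N).

(** Polynomials in the entries of the matrices [X l].  All the random
    variables in sight are of this kind, which settles integrability and
    measurability at once. *)
Definition poly_rv Z := exists l : seq (C * seq (Lam * ('I_N * 'I_N))),
  Z = fun w => \sum_(m <- l) m.1 * \prod_(t <- m.2) X t.1 w t.2.1 t.2.2.

Lemma poly_rv_cst c : poly_rv (fun=> c).
Proof. by exists [:: (c, [::])]; apply/funext => w; rewrite big_seq1 big_nil mulr1. Qed.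

Lemma poly_rv_entry l a b : poly_rv (fun w => X l w a b).
Proof. by exists [:: (1, [:: (l, (a, b))])]; apply/funext => w; rewrite !big_seq1 mul1r. Qed.

Lemma poly_rvD Z W : poly_rv Z -> poly_rv W -> poly_rv (fun w => Z w + W w).
Proof.
by move=> [l1 ->] [l2 ->]; exists (l1 ++ l2); apply/funext => w; rewrite big_cat.
Qed.

Lemma poly_rvM Z W : poly_rv Z -> poly_rv W -> poly_rv (fun w => Z w * W w).
Proof.
move=> [l1 ->] [l2 ->]; exists [seq (m.1 * n.1, m.2 ++ n.2) | m <- l1, n <- l2].
apply/funext => w; rewrite big_allpairs_dep /= mulr_suml; apply: eq_bigr => m _.
by rewrite mulr_sumr; apply: eq_bigr => n _; rewrite big_cat /= mulrACA.
Qed.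

Lemma poly_rv_sum (J : Type) (r : seq J) (p : pred J) (G : J -> T -> C) :
  (forall j, poly_rv (G j)) -> poly_rv (fun w => \sum_(j <- r | p j) G j w).
Proof.
move=> h; elim: r => [|j r IH].
  rewrite (_ : (fun w => _) = (fun=> 0)); first exact: poly_rv_cst.
  by apply/funext => w; rewrite big_nil.
rewrite (_ : (fun w => _) = (fun w => if p j then G j w + \sum_(i <- r | p i) G i w
    else \sum_(i <- r | p i) G i w)); last by apply/funext => w; rewrite big_cons.
by case: (p j) => //; apply: poly_rvD.
Qed.

Lemma poly_rv_prod (J : Type) (r : seq J) (p : pred J) (G : J -> T -> C) :
  (forall j, poly_rv (G j)) -> poly_rv (fun w => \prod_(j <- r | p j) G j w).
Proof.
move=> h; elim: r => [|j r IH].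
  rewrite (_ : (fun w => _) = (fun=> 1)); first exact: poly_rv_cst.
  by apply/funext => w; rewrite big_nil.
rewrite (_ : (fun w => _) = (fun w => if p j then G j w * \prod_(i <- r | p i) G i w
    else \prod_(i <- r | p i) G i w)); last by apply/funext => w; rewrite big_cons.
by case: (p j) => //; apply: poly_rvM.
Qed.

Lemma poly_rv_block len (eps : 'I_len -> bool) (lam : 'I_len -> Lam) a b :
  poly_rv (fun w => block (fun l => X l w) eps lam a b).
Proof.
rewrite /block; elim: len eps lam a b => [|n IH] eps lam a b.
  rewrite (_ : (fun w => _) = (fun=> (1%:M : 'M[C]_N) a b)); first exact: poly_rv_cst.
  by apply/funext => w; rewrite big_ord0.
rewrite (_ : (fun w => _) = (fun w => \sum_c sgn_mx (eps ord0) (X (lam ord0) w) a c *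
   (\prod_(j < n) sgn_mx (eps (lift ord0 j)) (X (lam (lift ord0 j)) w)) c b)); last first.
  by apply/funext => w; rewrite big_ord_recl mxE.
apply: poly_rv_sum => c; apply: poly_rvM; last exact: IH.
case: (eps ord0) => /=; last exact: poly_rv_entry.
rewrite (_ : (fun w => _) = (fun w => X (lam ord0) w c a)); first exact: poly_rv_entry.
by apply/funext => w; rewrite mxE.
Qed.

Lemma poly_rv_integrable Z : all_moments P X -> poly_rv Z -> cintegrable P Z.
Proof.
move=> aX [l ->]; apply: cintegrable_sum => m _; apply: cintegrableZ; exact: aX.
Qed.

Lemma poly_rv_meas Z : poly_rv Z -> csmeas (sigma_mx X) Z.
Proof.
have entry l a b : csmeas (sigma_mx X) (fun w => X l w a b).
  by split=> B mB; apply: sub_gen_smallest; exists l, a, b, B; split=> //; [left|right].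
have pr (q : seq (Lam * ('I_N * 'I_N))) :
    csmeas (sigma_mx X) (fun w => \prod_(t <- q) X t.1 w t.2.1 t.2.2).
  elim: q => [|t q IH].
    rewrite (_ : (fun w => _) = (fun=> 1)); first exact: csmeas_cst.
    by apply/funext => w; rewrite big_nil.
  rewrite (_ : (fun w => _) = (fun w => X t.1 w t.2.1 t.2.2 *
    \prod_(t <- q) X t.1 w t.2.1 t.2.2)); last by apply/funext => w; rewrite big_cons.
  exact: csmeasM.
move=> [l ->]; elim: l => [|m l IH].
  rewrite (_ : (fun w => _) = (fun=> 0)); first exact: csmeas_cst.
  by apply/funext => w; rewrite big_nil.
rewrite (_ : (fun w => _) = (fun w => m.1 * \prod_(t <- m.2) X t.1 w t.2.1 t.2.2 +
  \sum_(m <- l) m.1 * \prod_(t <- m.2) X t.1 w t.2.1 t.2.2)); last first.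
  by apply/funext => w; rewrite big_cons.
apply: csmeasD => //; apply: csmeasM => //; exact: csmeas_cst.
Qed.

Lemma sigma_mx_measurable : (forall l, random_matrix (X l)) -> sigma_mx X `<=` measurable.
Proof.
move=> mX; apply: smallest_sub; first exact: sigma_algebra_measurable.
move=> A [l [a [b [B [mB [->|->]]]]]].
  by rewrite -[_ @^-1` _]setTI; apply: (mX l a b).1.
by rewrite -[_ @^-1` _]setTI; apply: (mX l a b).2.
Qed.

End Polynomials.

Lemma indep2_cst (N : nat) (J : Type) (Y : J -> 'M[C]_N) (F : set (set T)) :
  F `<=` measurable -> indep2 P F (sigma_mx (fun k (_ : T) => Y k)).
Proof.
move=> Fm A B FA; have mA := Fm A FA.
pose G : set (set T) := [set B | B = set0 \/ B = setT].
suff h : sigma_mx (fun k (_ : T) => Y k) `<=` G.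
  by move=> /h[]->; [rewrite setI0 measure0 mule0|rewrite setIT probability_setT mule1].
apply: smallest_sub.
  split; [by left|move=> B' [->|->]; rewrite ?setD0 ?setDT; [right|left]; by []|].
  move=> B' hB'; have [[n hn]|no] := pselect (exists n, B' n = setT).
    by right; apply/seteqP; split=> // x _; exists n; rewrite ?hn.
  left; apply: bigcup0 => n _; have [//|hn] := hB' n.
  by case: no; exists n.
move=> A' [l [a [b [B' [mB' [->|->]]]]]].
  have [h|h] := pselect (B' (complex.Re (Y l a b))); [right|left]; apply/seteqP; split=> //.
have [h|h] := pselect (B' (complex.Im (Y l a b))); [right|left]; apply/seteqP; split=> //.
Qed.
End Independence.

(** * Limits of complex sequences *)

Section Limits.
Variable R : realType.
Local Notation C := R[i].
Implicit Types u v : nat -> C.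

Lemma ccvg_to_cst (c : C) : ccvg_to (fun=> c) c.
Proof. exact: (@cvg_cst (C^o : topologicalType)). Qed.

Lemma ccvg_toD u v a b : ccvg_to u a -> ccvg_to v b -> ccvg_to (fun N => u N + v N) (a + b).
Proof. by move=> hu hv; exact: (@cvgD _ C^o _ _ _ u v a b hu hv). Qed.

Lemma ccvg_toM u v a b : ccvg_to u a -> ccvg_to v b -> ccvg_to (fun N => u N * v N) (a * b).
Proof. by move=> hu hv; exact: (@cvgM _ _ _ _ u v a b hu hv). Qed.

Lemma ccvg_to_sum (J : Type) (r : seq J) (p : pred J) (u : J -> nat -> C) (a : J -> C) :
  (forall j, p j -> ccvg_to (u j) (a j)) ->
  ccvg_to (fun N => \sum_(j <- r | p j) u j N) (\sum_(j <- r | p j) a j).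
Proof.
move=> h; elim: r => [|j r IH].
  rewrite big_nil (_ : (fun N => _) = (fun=> 0)); first exact: ccvg_to_cst.
  by apply/funext => N; rewrite big_nil.
rewrite (_ : (fun w => _) = (fun w => if p j then u j w + \sum_(i <- r | p i) u i w
    else \sum_(i <- r | p i) u i w)); last by apply/funext => w; rewrite big_cons.
rewrite big_cons; case pj : (p j); last exact: IH.
by apply: ccvg_toD; [exact: h|exact: IH].
Qed.

Lemma ccvg_to_prod (J : Type) (r : seq J) (p : pred J) (u : J -> nat -> C) (a : J -> C) :
  (forall j, p j -> ccvg_to (u j) (a j)) ->
  ccvg_to (fun N => \prod_(j <- r | p j) u j N) (\prod_(j <- r | p j) a j).
Proof.
move=> h; elim: r => [|j r IH].
  rewrite big_nil (_ : (fun N => _) = (fun=> 1)); first exact: ccvg_to_cst.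
  by apply/funext => N; rewrite big_nil.
rewrite (_ : (fun w => _) = (fun w => if p j then u j w * \prod_(i <- r | p i) u i w
    else \prod_(i <- r | p i) u i w)); last by apply/funext => w; rewrite big_cons.
rewrite big_cons; case pj : (p j); last exact: IH.
by apply: ccvg_toM; [exact: h|exact: IH].
Qed.

Lemma ccvg_to_eventually u v a : (forall N, (0 < N)%N -> u N = v N) ->
  ccvg_to u a -> ccvg_to v a.
Proof.
move=> uv; apply: cvg_trans; apply: near_eq_cvg.
by exists 1%N => // N /= N1; rewrite uv.
Qed.

Lemma clim_eq u a : ccvg_to u a -> clim u = a.
Proof. by move=> h; apply: (@cvg_lim C^o) => //; apply: norm_hausdorff. Qed.

Lemma ccvgP u : ccvg u <-> ccvg_to u (clim u).
Proof. by split=> h //; apply/cvg_ex; exists (clim u). Qed.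

Lemma ccvg_to_ccvg u a : ccvg_to u a -> ccvg u.
Proof. by move=> h; apply/cvg_ex; exists a. Qed.

Lemma invN_to0 : ccvg_to (fun N => (N%:R : C)^-1) 0.
Proof.
apply/(@cvgrPdist_lt _ C^o) => e e0.
have := e0; rewrite ltcE => /andP[/eqP im0 re0].
have eR : e = (complex.Re e)%:C%C by case: e im0 {e0 re0} => a b /= ->.
pose M := (Num.truncn (complex.Re e)^-1).+1.
exists M => // N /= MN.
have N0 : (0 < N)%N by apply: leq_trans MN.
rewrite sub0r normrN ger0_norm ?invr_ge0 ?ler0n //.
rewrite eR -(rmorph_nat (real_complex R)) -fmorphV ltcR.
rewrite invf_plt ?posrE ?ltr0n //.
apply: lt_le_trans (_ : M%:R <= _); last by rewrite ler_nat.
exact: truncnS_gt.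
Qed.

Lemma powN_le0 (z : int) : z <= 0 ->
  ccvg_to (fun N => (N%:R : C) ^ z) (if z == 0 then 1 else 0).
Proof.
case: z => [[|n]|n] // _.
  by rewrite eqxx; exact: ccvg_to_cst.
rewrite (_ : (fun N => _) = (fun N => \prod_(i < n.+1) (N%:R : C)^-1)); last first.
  by apply/funext => N; rewrite NegzE -exprnN prodr_const card_ord exprVn.
have -> : (if Negz n == 0 then 1 else 0 : C) = \prod_(i < n.+1) 0.
  by rewrite prodr_const card_ord expr0n.
by apply: ccvg_to_prod => i _; apply: invN_to0.
Qed.

End Limits.

(** * Moments of one ensemble *)

Definition compat (L : finType) (N : nat) (phi : L * bool -> 'I_N) (sh : shadow L) : bool :=
  [forall uv in sh.1, phi uv.1 == phi uv.2].

Definition block_moment (R : realType) (d : measure_display) (T : measurableType d)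
    (P : probability T R) (L : finType) (N : nat) (A : L -> T -> 'M[R[i]]_N)
    (S : {set L}) (phi : L * bool -> 'I_N) : R[i] :=
  cexp P (fun w => \prod_(k in S) A k w (phi (k, false)) (phi (k, true))).

(** The interface between the ensembles and the covariance.  [W S N sh] is the
    total weight of the premaps of shadow [sh] on the blocks of [S]; the
    exponent in [weights_limit] is the one that Euler's inequality
    guarantees. *)
Record weights (R : realType) (d : nat -> measure_display)
    (T : forall N : nat, measurableType (d N)) (P : forall N : nat, probability (T N) R)
    (L : finType) (A : forall N : nat, L -> T N -> 'M[R[i]]_N) (Lc : {set L})
    (W : {set L} -> nat -> shadow L -> R[i]) : Prop := Weights {
  weights_moment : forall (S : {set L}) N (phi : L * bool -> 'I_N), (0 < N)%N -> S \subset Lc ->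
    block_moment (P N) (@A N) S phi = \sum_sh W S N sh * (compat phi sh)%:R;
  weights_split : forall (S1 S2 : {set L}) N sh1 sh2, (0 < N)%N ->
    S1 \subset Lc -> S2 \subset Lc -> [disjoint S1 & S2] -> valid S1 sh1 -> valid S2 sh2 ->
    W (S1 :|: S2) N (shadowU sh1 sh2) = W S1 N sh1 * W S2 N sh2;
  weights_limit : forall (S : {set L}) sh, S \subset Lc ->
    ccvg (fun N => N%:R ^ (#|S|%:Z + (nloops S sh)%:Z - (2 * nclasses S sh)%N%:Z) * W S N sh);
  weights_valid : forall (S : {set L}) N sh, S \subset Lc -> W S N sh != 0 -> valid S sh
}.

Section Ensemble.
Variables (R : realType) (d : nat -> measure_display)
  (T : forall N : nat, measurableType (d N)) (P : forall N : nat, probability (T N) R)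
  (Lam : Type) (X : forall N : nat, Lam -> T N -> 'M[R[i]]_N)
  (PM : premap_data) (f : weight_data R Lam).
Hypothesis hG : condition_G P X PM f.
Variables (L : finType) (len : L -> nat) (len_gt0 : forall k, (0 < len k)%N) (k0 : L).
Variables (eps : forall k, 'I_(len k) -> bool) (lam : forall k, 'I_(len k) -> Lam).
Arguments eps : clear implicits.
Arguments lam : clear implicits.

Let A N (k : L) (t : T N) : 'M[R[i]]_N := block (fun l => X l t) (eps k) (lam k).

Let epsN (x : nat) : bool :=
  eps (tag (unpos len_gt0 k0 x)) (tagged (unpos len_gt0 k0 x)).
Let lamN (x : nat) : Lam :=
  lam (tag (unpos len_gt0 k0 x)) (tagged (unpos len_gt0 k0 x)).

Local Notation I S := (block_fset len S).
Local Notation sgnS S := (@sgnI epsN (I S)).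
Local Notation shiftS S := (@bshift L len len_gt0 k0 S).
Local Notation shad S s := (@shadow_of L len len_gt0 k0 S (sgnS S) s).
Local Notation expoS S s := (@expo L len len_gt0 k0 epsN S s).

Let lamI (J : {fset nat}) (x : J) : Lam := lamN (val x).

Definition premap_weight (S : {set L}) (N : nat) (s : {perm (pmset (I S))}) : R[i] :=
  N%:R ^ (expoS S s) * f N (@lamI (I S)) s.

Definition shadow_weight (S : {set L}) (N : nat) (sh : shadow L) : R[i] :=
  \sum_(s in PM (I S) | shad S s == sh) premap_weight N s.

Lemma PM_folded S s : s \in PM (I S) -> folded s.
Proof.
case: hG => _ [/(_ (I S) (block0 len_gt0 k0 S))[/fintype.subsetP h _] _] _ _ _ /h.
exact: premap_folded.
Qed.

Lemma ncycles_bshift (S : {set L}) : ncycles (shiftS S) = #|S|.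
Proof.
rewrite /ncycles.
have pE x : porbit (shiftS S) x = [set y : I S | lab len_gt0 k0 y == lab len_gt0 k0 x]%SET.
  by apply/setP => y; rewrite porbit_fconnect inE (fconnect_lab len_gt0 k0) eq_sym.
rewrite -(card_in_imset (f := fun k => [set x : I S | lab len_gt0 k0 x == k]%SET)).
  apply: eq_card => B; apply/imsetP/imsetP => [[x _ ->]|[k kS ->]].
    by exists (lab len_gt0 k0 x); rewrite ?pE //; apply: lab_in.
  have [x xk _] := end_exists len_gt0 k0 kS.
  by exists x; rewrite // pE xk.
move=> k l kS lS BB; have [x xk _] := end_exists len_gt0 k0 kS.
have : x \in [set x : I S | lab len_gt0 k0 x == k]%SET by rewrite inE xk.
by rewrite BB inE xk => /eqP.
Qed.

(** Condition (G) for the permutation that runs through each block, [Y]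
    being a unit matrix after the last factor of a block and the identity
    elsewhere. *)
Lemma shadow_moment (S : {set L}) N (phi : L * bool -> 'I_N) : (0 < N)%N ->
  block_moment (P N) (@A N) S phi =
  \sum_(s in PM (I S)) premap_weight N s * (compat phi (shad S s))%:R.
Proof.
move=> N0; have [hm [hPM hlim] hexp hmult hempty] := hG.
have [mX aX] := hm N N0.
have N0' : N%:R != 0 :> R[i] by rewrite pnatr_eq0 -lt0n.
pose sp := @is_end L len len_gt0 k0 S.
pose a (x : I S) := phi (lab len_gt0 k0 x, false).
pose b (x : I S) := phi (lab len_gt0 k0 x, true).
pose Y (x : I S) : 'M[R[i]]_N := if sp x then delta_mx (b x) (a x) else 1%:M.
have lhsE w : tr_perm (shiftS S) (fun k => sgn_mx (sgnS S k) (X (lamI k) w) *m Y k) =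
    N%:R ^- #|S| * \prod_(k in S) A k w (phi (k, false)) (phi (k, true)).
  pose Z (q : {k : L & 'I_(len k)}) := sgn_mx (eps (tag q) (tagged q)) (X (lam (tag q) (tagged q)) w).
  exact: (tr_blocks len_gt0 k0 S Z phi N0).
have polyA : poly_rv (@X N) (fun w => \prod_(k in S) A k w (phi (k, false)) (phi (k, true))).
  by apply: poly_rv_prod => k; apply: poly_rv_block.
have intA := poly_rv_integrable aX polyA.
have lhsF : (fun w => tr_perm (shiftS S) (fun k => sgn_mx (sgnS S k) (X (lamI k) w) *m Y k)) =
    (fun w => N%:R ^- #|S| * \prod_(k in S) A k w (phi (k, false)) (phi (k, true))).
  by apply/funext => w; apply: lhsE.
have main := @hexp N N0 (I S) (shiftS S) (sgnS S) (@lamI (I S)) (fun k _ => Y k)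
  (block0 len_gt0 k0 S).
have mY k : random_matrix (fun _ : T N => Y k) by move=> i j; split; apply: measurable_cst.
have iY := @indep2_cst _ _ _ (P N) N _ Y _ (sigma_mx_measurable mX).
rewrite lhsF cexpZ // in main.
have {main} := main mY iY (cintegrableZ _ intA) (fun s _ => cintegrable_cst _ _).
move/(congr1 (fun z => N%:R ^+ #|S| * z)).
rewrite mulrA divff ?expf_neq0 // mul1r /block_moment => ->.
rewrite mulr_sumr; apply: eq_bigr => s sPM.
have fs := PM_folded sPM.
have [k1 k2] := kreweras_folded (shiftS S) (sgnS S) fs.
rewrite cexp_cst (@tr_half_units _ _ k1 k2 _ N sp a b N0) -/(kappa _ _ _).
have -> : [forall x in [pred x : pmset (I S) | sp x.1],
    forall y in [pred x : pmset (I S) | sp x.1],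
    connect (strand_rel sp (kreweras (shiftS S) (sgnS S) s)) x y ==>
    ((if x.2 then a x.1 else b x.1) == (if y.2 then a y.1 else b y.1))] =
    compat phi (shad S s).
  have psiE (x : pmset (I S)) : (if x.2 then a x.1 else b x.1) = phi (endp len_gt0 k0 x).
    by rewrite /endp /a /b; case: x.2.
  apply/forall_inP/forall_inP => [h [u v] /shadow_tauP[x [y [ex ey xy -> ->]]]|h x ex].
    have /forall_inP/(_ y ey)/implyP/(_ xy) := h x ex.
    by rewrite !psiE.
  apply/forall_inP => y ey; apply/implyP => xy; rewrite !psiE.
  apply: (h (_, _)); apply/shadow_tauP.
  by exists x, y.
rewrite /premap_weight /expo.
case: (compat _ _); last by rewrite !mulr0.
rewrite !mulr1 ncycles_bshift.
set c := chi _ _; set K := (ncycles _)./2; set m := n_comp_mem _ _.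
have -> : c - #|S|%:Z - K%:Z + m%:Z = #|S|%:Z + (c - (2 * #|S|)%N%:Z) + (- K%:Z) + m%:Z.
  by rewrite PoszM; lia.
clearbody c K m; rewrite !expfzDr // -!exprnN -!exprnP -!mulrA.
by do 3 congr (_ * _); rewrite mulrC -mulrA.
Qed.

(** A premap whose shadow splits is glued from premaps of the two parts, and
    its value under [f] is the product of theirs, by (i) and (iv) of condition
    (G); the exponent is additive by [expo_split]. *)
Lemma shadow_weight_split (S1 S2 : {set L}) N sh1 sh2 : (0 < N)%N -> [disjoint S1 & S2] ->
  valid S1 sh1 -> valid S2 sh2 ->
  shadow_weight (S1 :|: S2) N (shadowU sh1 sh2) =
  shadow_weight S1 N sh1 * shadow_weight S2 N sh2.
Proof.
move=> N0 dis v1 v2; have [hm [hPM hlim] hexp hmult hempty] := hG.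
have N0' : N%:R != 0 :> R[i] by rewrite pnatr_eq0 -lt0n.
set S := S1 :|: S2.
pose JIs := JI len_gt0 k0 S1 S2.
pose KIs := KI len_gt0 k0 S1 S2.
have hKE := KE len_gt0 k0 dis; have hKE' := KE' len_gt0 k0 dis.
have I0 := block0 len_gt0 k0 S.
pose gl (p : {perm (pmset (I S1))} * {perm (pmset (I S2))}) := perm_glue JIs KIs hKE p.1 p.2.
have glP p : agrees JIs (gl p) p.1 /\ agrees KIs (gl p) p.2 by apply: glue_agrees.
(* part (i) of condition (G) *)
have PMsplit (s : {perm (pmset (I S))}) : (s \in PM (I S) /\ not_connecting (I S1) s) <->
   exists s1 s2, [/\ s1 \in PM (I S1), s2 \in PM (I S2) & is_product s s1 s2].
  have [_ h] := hPM (I S) I0; move: (h _ JIs s); rewrite -hKE'; exact.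
have fmult (s : {perm (pmset (I S))}) s1 s2 : s \in PM (I S) -> not_connecting (I S1) s ->
    agrees JIs s s1 -> agrees KIs s s2 ->
    f N (@lamI (I S)) s = f N (@lamI (I S1)) s1 * f N (@lamI (I S2)) s2.
  move=> sPM nc a1 a2.
  have := agrees_restriction a2; have := agrees_restriction a1.
  move: (s2) => t2 r1 r2.
  move: (I S2) hKE' t2 r2 => K -> t2 r2.
  exact: (hmult N (I S) (I S1) JIs (@lamI (I S)) s s1 t2).
have fold1 s1 : s1 \in PM (I S1) -> folded s1 by exact: PM_folded.
have fold2 s2 : s2 \in PM (I S2) -> folded s2 by exact: PM_folded.
pose B := [set p : {perm (pmset (I S1))} * {perm (pmset (I S2))} |
  [&& p.1 \in PM (I S1), shad S1 p.1 == sh1, p.2 \in PM (I S2) & shad S2 p.2 == sh2]]%SET.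
have gl_inj : {in B &, injective gl}.
  move=> p q _ _ e; have [p1 p2] := glP p; have [q1 q2] := glP q.
  rewrite e in p1 p2; case: p q e p1 p2 q1 q2 => x1 x2 [y1 y2] _ /= p1 p2 q1 q2.
  congr (_, _); apply/permP => z; first by apply: (@emb_inj _ _ JIs); rewrite -p1 -q1.
  by apply: (@emb_inj _ _ KIs); rewrite -p2 -q2.
have BE : [set s in PM (I S) | shad S s == shadowU sh1 sh2]%SET = gl @: B.
  apply/setP => s; rewrite inE; apply/andP/imsetP => [[sPM /eqP sE]|[[s1 s2]]].
    have nc : not_connecting (I S1) s.
      move=> x y; rewrite porbit_fconnect => xy.
      have : (lab len_gt0 k0 x.1, lab len_gt0 k0 y.1) \in (shad S s).2.
        apply/shadow_rhoP; exists x, y; split=> //.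
        by apply: connect_sub xy => u v uv; apply: connect1; apply/orP; left.
      rewrite sE inE /= => xyr.
      have inS z : (val z.1 \in I S1) = (lab len_gt0 k0 z.1 \in S1).
        by rewrite (val_at len_gt0 k0 z.1) (pos_in_block len_gt0 k0).
      rewrite !inS; case/orP: xyr => h.
        by rewrite (valid_rin v1 h) (valid_rin v1 (valid_rsym v1 h)).
      have nS2 k : k \in S2 -> k \in S1 = false by move=> k2; rewrite (disjointFl dis k2).
      by rewrite (nS2 _ (valid_rin v2 h)) (nS2 _ (valid_rin v2 (valid_rsym v2 h))).
    have [s1 [s2 [s1PM s2PM /(is_product_agrees JIs KIs hKE)[a1 a2]]]] :=
      (PMsplit s).1 (conj sPM nc).
    exists (s1, s2); last exact: (glue_unique hKE a1 a2).
    have e := shadow_split epsN dis a1 a2.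
    rewrite sE in e; have [e1 e2] : sh1 = shad S1 s1 /\ sh2 = shad S2 s2.
      by apply: shadowU_inj dis v1 v2 _ _ e; apply: valid_shadow; [apply: fold1|apply: fold2].
    by rewrite inE /= s1PM s2PM e1 e2 !eqxx.
  rewrite inE /= => /and4P[s1PM /eqP <- s2PM /eqP <-] ->.
  have [a1 a2] := glP (s1, s2).
  have [h1 _] := (PMsplit (gl (s1, s2))).2 (ex_intro _ s1 (ex_intro _ s2
    (And3 s1PM s2PM ((is_product_agrees JIs KIs hKE _ _ _).2 (conj a1 a2))))).
  split=> //; apply/eqP.
  exact: (shadow_split epsN dis a1 a2).
rewrite /shadow_weight big_distrlr /= pair_big /=.
transitivity (\sum_(s in gl @: B) premap_weight N s).
  by rewrite -BE; apply: eq_bigl => s; rewrite inE.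
rewrite big_imset //=; apply: eq_big => [p|p].
  by rewrite inE -andbA.
rewrite inE => /and4P[s1PM _ s2PM _]; have [a1 a2] := glP p.
have [h1 h2] := (PMsplit (gl p)).2 (ex_intro _ p.1 (ex_intro _ p.2
    (And3 s1PM s2PM ((is_product_agrees JIs KIs hKE _ _ _).2 (conj a1 a2))))).
rewrite /premap_weight (fmult _ _ _ h1 h2 a1 a2).
rewrite (expo_split epsN dis a1 a2 (PM_folded h1) (fold1 _ s1PM) (fold2 _ s2PM)).
by rewrite expfzDr // mulrACA.
Qed.

Lemma ensemble_weights : weights P A [set: L]%SET shadow_weight.
Proof.
have [hm [hPM hlim] hexp hmult hempty] := hG.
split.
- move=> S N phi N0 _; rewrite shadow_moment //.
  rewrite (partition_big (fun s => shad S s) predT) //=; apply: eq_bigr => sh _.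
  by rewrite /shadow_weight mulr_suml; apply: eq_bigr => s /andP[_ /eqP ->].
- by move=> S1 S2 N sh1 sh2 N0 _ _; apply: shadow_weight_split.
- move=> S sh _.
  pose z s : int := #|S|%:Z + (nloops S sh)%:Z - (2 * nclasses S sh)%N%:Z + expoS S s.
  have zle s : s \in PM (I S) -> shad S s == sh -> z s <= 0.
    move=> /PM_folded fs /eqP shE; rewrite /z /expo -shE.
    have := chi_bound len_gt0 k0 (sgnS S) fs; have := loops_bound len_gt0 k0 (sgnS S) fs.
    move: (chi _ _) (nclasses _ _) (nloops _ _) (ncycles _)./2 (n_comp_mem _ _) => c q l K m.
    by lia.
  apply: (@ccvg_to_ccvg _ _ (\sum_(s in PM (I S) | shad S s == sh)
     (if z s == 0 then 1 else 0) * clim (fun N => f N (@lamI (I S)) s))).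
  apply: (@ccvg_to_eventually _ (fun N => \sum_(s in PM (I S) | shad S s == sh)
     N%:R ^ (z s) * f N (@lamI (I S)) s)).
    move=> N N0; have N0' : N%:R != 0 :> R[i] by rewrite pnatr_eq0 -lt0n.
    rewrite /shadow_weight mulr_sumr; apply: eq_bigr => s _.
    by rewrite /premap_weight mulrA -expfzDr.
  apply: ccvg_to_sum => s /andP[sPM sE]; apply: ccvg_toM.
    exact/powN_le0/zle.
  exact/ccvgP/hlim/sPM/(block0 len_gt0 k0).
move=> S N sh _ /eqP nz.
have [s /andP[sPM /eqP <-]|no] := pickP [pred s | (s \in PM (I S)) && (shad S s == sh)].
  exact/valid_shadow/PM_folded.
by case: nz; rewrite /shadow_weight big_pred0.
Qed.

End Ensemble.

(** * Several independent ensembles *)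

Lemma n_comp_local (T : finType) (e e' : rel T) (a : {pred T}) :
  connect_sym e -> connect_sym e' -> fingraph.closed e a ->
  {in a, forall x, e x =1 e' x} -> n_comp e a = n_comp e' a.
Proof.
move=> se se' cl ee'.
have cl' : fingraph.closed e' a.
  by apply: intro_closed => // x y + xa; rewrite -ee' // => /cl <-.
have sub (g g' : rel T) : fingraph.closed g a -> {in a, forall x, g x =1 g' x} ->
    {in a, forall x y, connect g x y -> connect g' x y}.
  move=> clg gg' x xa y /connectP[p]; elim: p x xa => [x _ _ ->|z p IH x xa /= /andP[xz pz] yE].
    exact: connect0.
  apply: (@connect_trans _ _ z); first by apply: connect1; rewrite -gg'.
  by apply: IH => //; rewrite -(clg x z).
apply/eqP; rewrite eqn_leq; apply/andP; split;
  apply: (@n_comp_le _ _ _ _ _ _ id) => // x y xa _; apply: sub => // u ua v.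
by rewrite ee'.
Qed.

Lemma label_rel_sym (L : finType) (S : {set L}) (sh : shadow L) :
  valid S sh -> connect_sym (label_rel sh).
Proof.
move=> V; apply: sym_connect_sym => k l; apply/existsP/existsP => -[b /existsP[b' h]];
by exists b'; apply/existsP; exists b; apply: (valid_sym V).
Qed.

Lemma class_rel_sym (L : finType) (S : {set L}) (sh : shadow L) :
  valid S sh -> connect_sym (class_rel sh).
Proof.
by move=> V; apply: sym_connect_sym => k l; apply/idP/idP; apply: (valid_rsym V).
Qed.

Lemma valid_shadowU (L : finType) (S1 S2 : {set L}) (sh1 sh2 : shadow L) :
  [disjoint S1 & S2] -> valid S1 sh1 -> valid S2 sh2 ->
  valid (S1 :|: S2) (shadowU sh1 sh2).
Proof.
move=> dis V1 V2; split=> /=.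
- by move=> u v; rewrite !inE => /orP[/(valid_in V1)|/(valid_in V2)] ->; rewrite ?orbT.
- by move=> u; rewrite !inE => /orP[/(valid_refl V1)|/(valid_refl V2)] ->; rewrite ?orbT.
- by move=> u v; rewrite !inE => /orP[/(valid_sym V1)|/(valid_sym V2)] ->; rewrite ?orbT.
- move=> u v w; rewrite !inE => /orP[] h /orP[] h'.
  + by rewrite (valid_trans V1 h h').
  + have h1 := valid_in V1 (valid_sym V1 h); have h2 := valid_in V2 h'.
    by rewrite (disjointFr dis h1) in h2.
  + have h1 := valid_in V2 (valid_sym V2 h); have h2 := valid_in V1 h'.
    by rewrite (disjointFr dis h2) in h1.
  + by rewrite (valid_trans V2 h h') orbT.
- move=> u; rewrite inE => /orP[/(valid_mate V1)|/(valid_mate V2)] [v vu h];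
    by exists v; rewrite // inE h ?orbT.
- by move=> k l; rewrite !inE => /orP[/(valid_rin V1)|/(valid_rin V2)] ->; rewrite ?orbT.
- by move=> k; rewrite !inE => /orP[/(valid_rrefl V1)|/(valid_rrefl V2)] ->; rewrite ?orbT.
- by move=> k l; rewrite !inE => /orP[/(valid_rsym V1)|/(valid_rsym V2)] ->; rewrite ?orbT.
- move=> u v w; rewrite !inE => /orP[] h /orP[] h'.
  + by rewrite (valid_rtrans V1 h h').
  + have h1 := valid_rin V1 (valid_rsym V1 h); have h2 := valid_rin V2 h'.
    by rewrite (disjointFr dis h1) in h2.
  + have h1 := valid_rin V2 (valid_rsym V2 h); have h2 := valid_rin V1 h'.
    by rewrite (disjointFr dis h2) in h1.
  + by rewrite (valid_rtrans V2 h h') orbT.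
by move=> u v; rewrite !inE => /orP[/(valid_fine V1)|/(valid_fine V2)] ->; rewrite ?orbT.
Qed.

Section Colours.
Variables (L K : finType) (col : L -> K).

Definition colour_class (c : K) : {set L} := [set k | col k == c].
Local Notation Lc := colour_class.

Definition respects (sh : shadow L) : bool := [forall kl in sh.2, col kl.1 == col kl.2].

Definition sh_restr (c : K) (sh : shadow L) : shadow L :=
  ([set uv in sh.1 | col uv.1.1 == c], [set kl in sh.2 | col kl.1 == c]).

Definition sh_union (F : {ffun K -> shadow L}) : shadow L :=
  (\bigcup_c (F c).1, \bigcup_c (F c).2).

Section Restr.
Variables (S : {set L}) (sh : shadow L).
Hypotheses (V : valid S sh) (rs : respects sh).

Let rsE k l : (k, l) \in sh.2 -> col k = col l.
Proof. by move=> h; move/forall_inP: rs => /(_ _ h) /eqP. Qed.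

Lemma valid_restr c : valid (S :&: Lc c) (sh_restr c sh).
Proof.
split=> /=.
- move=> u v; rewrite !inE => /andP[h ->]; rewrite (valid_in V h) //.
- by move=> u; rewrite !inE => /andP[h ->]; rewrite (valid_refl V).
- move=> u v; rewrite !inE => /andP[h /eqP <-]; rewrite (valid_sym V) //=.
  by rewrite (rsE (valid_fine V h)).
- move=> u v w; rewrite !inE => /andP[h ->] /andP[h' _].
  by rewrite (valid_trans V h h').
- move=> u; rewrite !inE => /andP[uS uc]; have [v vu h] := valid_mate V uS.
  by exists v; rewrite // inE h.
- by move=> k l; rewrite !inE => /andP[h ->]; rewrite (valid_rin V h).
- by move=> k; rewrite !inE => /andP[h ->]; rewrite (valid_rrefl V).
- by move=> k l; rewrite !inE => /andP[h /eqP <-]; rewrite (valid_rsym V) //= (rsE h).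
- move=> k l m; rewrite !inE => /andP[h ->] /andP[h' _].
  by rewrite (valid_rtrans V h h').
by move=> u v; rewrite !inE => /andP[h ->]; rewrite (valid_fine V).
Qed.

Lemma sh_union_restr : sh_union [ffun c => sh_restr c sh] = sh.
Proof.
rewrite [RHS]surjective_pairing; congr (_, _); apply/setP => x.
  apply/finset.bigcupP/idP => [[c _]|h]; first by rewrite ffunE !inE => /andP[].
  by exists (col x.1.1); rewrite // ffunE inE h eqxx.
apply/finset.bigcupP/idP => [[c _]|h]; first by rewrite ffunE !inE => /andP[].
by exists (col x.1); rewrite // ffunE inE h eqxx.
Qed.

Lemma sum_colours (p : pred L) : (\sum_c #|[pred k | p k & (k \in S :&: Lc c)]| =
  #|[pred k | p k & (k \in S)]|)%N.
Proof.
rewrite -sum1_card (partition_big col predT) //=; apply: eq_bigr => c _.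
by rewrite -sum1_card; apply: eq_bigl => k; rewrite !inE andbA.
Qed.

Lemma card_colours : #|S| = (\sum_c #|S :&: Lc c|)%N.
Proof.
rewrite -(eq_card (A := [pred k | xpredT k & (k \in S)])) // -sum_colours.
by apply: eq_bigr => c _; apply: eq_card.
Qed.

Lemma nloops_colours : nloops S sh = (\sum_c nloops (S :&: Lc c) (sh_restr c sh))%N.
Proof.
rewrite /nloops /n_comp_mem -sum_colours; apply: eq_bigr => c _.
have Vc := valid_restr c.
have lS k l : label_rel sh k l -> (k \in S) && (l \in S) && (col k == col l).
  case/existsP => b /existsP[b' h]; rewrite (valid_in V h) (valid_in V (valid_sym V h)) /=.
  by rewrite (rsE (valid_fine V h)).
rewrite -[LHS]/(n_comp (label_rel sh) (S :&: Lc c)) -[RHS]/(n_comp _ (S :&: Lc c)).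
apply: n_comp_local.
- exact: label_rel_sym V.
- exact: label_rel_sym Vc.
- by move=> k l /lS /andP[/andP[kS lS'] /eqP kl]; rewrite !inE kS lS' kl.
move=> k; rewrite !inE => /andP[kS kc] l; apply: eq_existsb => b; apply: eq_existsb => b'.
by rewrite inE /= kc andbT.
Qed.

Lemma nclasses_colours : nclasses S sh = (\sum_c nclasses (S :&: Lc c) (sh_restr c sh))%N.
Proof.
rewrite /nclasses /n_comp_mem -sum_colours; apply: eq_bigr => c _.
have Vc := valid_restr c.
rewrite -[LHS]/(n_comp (class_rel sh) (S :&: Lc c)) -[RHS]/(n_comp _ (S :&: Lc c)).
apply: n_comp_local.
- exact: class_rel_sym V.
- exact: class_rel_sym Vc.
- move=> k l h; rewrite !inE (rsE h) (valid_rin V h).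
  by rewrite (valid_rin V (valid_rsym V h)).
by move=> k; rewrite !inE => /andP[kS kc] l; rewrite /class_rel inE /= kc andbT.
Qed.

End Restr.

Lemma union_valid (S : {set L}) (F : {ffun K -> shadow L}) :
  (forall c, valid (S :&: Lc c) (F c)) ->
  [/\ valid S (sh_union F), respects (sh_union F) & forall c, F c = sh_restr c (sh_union F)].
Proof.
move=> V.
have inc c u v : (u, v) \in (F c).1 -> [/\ u.1 \in S, col u.1 = c & col v.1 = c].
  move=> h; have := valid_in (V c) h; have := valid_in (V c) (valid_sym (V c) h).
  by rewrite !inE => /andP[_ /eqP ->] /andP[-> /eqP ->].
have rinc c k l : (k, l) \in (F c).2 -> [/\ k \in S, col k = c & col l = c].
  move=> h; have := valid_rin (V c) h; have := valid_rin (V c) (valid_rsym (V c) h).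
  by rewrite !inE => /andP[_ /eqP ->] /andP[-> /eqP ->].
have U1 u v : (u, v) \in (sh_union F).1 -> (u, v) \in (F (col u.1)).1.
  by case/finset.bigcupP => c _ h; have [_ -> _] := inc _ _ _ h.
have U2 k l : (k, l) \in (sh_union F).2 -> (k, l) \in (F (col k)).2.
  by case/finset.bigcupP => c _ h; have [_ -> _] := rinc _ _ _ h.
have U1' c u v : (u, v) \in (F c).1 -> (u, v) \in (sh_union F).1.
  by move=> h; apply/finset.bigcupP; exists c.
have U2' c k l : (k, l) \in (F c).2 -> (k, l) \in (sh_union F).2.
  by move=> h; apply/finset.bigcupP; exists c.
split.
- split.
  + by move=> u v /U1 /inc[].
  + by move=> u uS; apply: (U1' (col u.1)); apply: (valid_refl (V _)); rewrite !inE uS eqxx.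
  + by move=> u v /U1 h; apply: U1'; apply: (valid_sym (V _)) h.
  + move=> u v w /U1 h /U1 h'; have [_ _ e] := inc _ _ _ h; rewrite e in h'.
    exact: U1' (valid_trans (V _) h h').
  + move=> u uS; have [|v vu h] := valid_mate (V (col u.1)) (u := u).
      by rewrite !inE uS eqxx.
    by exists v => //; apply: U1' h.
  + by move=> k l /U2 /rinc[].
  + by move=> k kS; apply: (U2' (col k)); apply: (valid_rrefl (V _)); rewrite !inE kS eqxx.
  + by move=> k l /U2 h; apply: U2'; apply: (valid_rsym (V _)) h.
  + move=> k l m /U2 h /U2 h'; have [_ _ e] := rinc _ _ _ h; rewrite e in h'.
    exact: U2' (valid_rtrans (V _) h h').
  by move=> u v /U1 h; apply: U2'; apply: (valid_fine (V _)) h.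
- by apply/forall_inP => -[k l] /U2 /rinc[_ _ /= ->].
move=> c; rewrite [LHS]surjective_pairing; congr (_, _); apply/setP => -[u v]; rewrite inE.
  apply/idP/andP => [h|[/U1 h /eqP <-]] //.
  by have [_ -> _] := inc _ _ _ h; split=> //; apply: U1' h.
apply/idP/andP => [h|[/U2 h /eqP <-]] //.
by have [_ -> _] := rinc _ _ _ h; split=> //; apply: U2' h.
Qed.

Lemma sh_restrU c (a b : shadow L) :
  sh_restr c (shadowU a b) = shadowU (sh_restr c a) (sh_restr c b).
Proof. by congr (_, _); apply/setP => x; rewrite !inE andb_orl. Qed.

Lemma respectsU (a b : shadow L) : respects (shadowU a b) = respects a && respects b.
Proof.
apply/forall_inP/andP => [h|[/forall_inP ha /forall_inP hb] x].
  by split; apply/forall_inP => x xa; apply: h; rewrite inE xa ?orbT.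
by rewrite inE => /orP[/ha|/hb].
Qed.

Variables (R : realType) (d : nat -> measure_display)
    (T : forall N : nat, measurableType (d N)) (P : forall N : nat, probability (T N) R)
    (A : forall N : nat, L -> T N -> 'M[R[i]]_N)
    (W : K -> {set L} -> nat -> shadow L -> R[i]).
Hypothesis HW : forall c, weights P A (Lc c) (W c).
Hypothesis fact : forall N (S : {set L}) (phi : L * bool -> 'I_N), (0 < N)%N ->
  block_moment (P N) (@A N) S phi = \prod_c block_moment (P N) (@A N) (S :&: Lc c) phi.

(** The sum has at most one nonzero term, at the family of the restrictions
    of [sh] to the colours. *)
Definition colour_weight (S : {set L}) (N : nat) (sh : shadow L) : R[i] :=
  \sum_(F : {ffun K -> shadow L} | sh_union F == sh) \prod_c W c (S :&: Lc c) N (F c).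

Let SLc (S : {set L}) c : S :&: Lc c \subset Lc c.
Proof. exact: finset.subsetIr. Qed.

Lemma colour_weight_neq0 S N sh : colour_weight S N sh != 0 -> valid S sh /\ respects sh.
Proof.
move=> nz; have [F /eqP <- /prodf_neq0 h] : exists2 F, sh_union F == sh &
    \prod_c W c (S :&: Lc c) N (F c) != 0.
  apply/exists_inP; apply: contraNT nz => /exists_inPn h; apply/eqP.
  by apply: big1 => F /h; rewrite negbK => /eqP.
have [|V r _] := @union_valid S F; last by split.
by move=> c; apply: (weights_valid (HW c) (SLc S c) (h c isT)).
Qed.

Lemma colour_weightE S N sh : valid S sh -> respects sh ->
  colour_weight S N sh = \prod_c W c (S :&: Lc c) N (sh_restr c sh).
Proof.
move=> V rs; pose F0 := [ffun c => sh_restr c sh].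
rewrite /colour_weight (bigD1 F0) /=; last by rewrite sh_union_restr.
rewrite [X in _ + X]big1 ?addr0; first by apply: eq_bigr => c _; rewrite ffunE.
move=> F /andP[/eqP FE FF0]; apply/eqP; apply: contraTT FF0 => /prodf_neq0 h; rewrite negbK.
have [|_ _ h'] := @union_valid S F.
  by move=> c; apply: (weights_valid (HW c) (SLc S c) (h c isT)).
by apply/eqP/ffunP => c; rewrite h' FE ffunE.
Qed.

Lemma compat_union N (phi : L * bool -> 'I_N) (F : {ffun K -> shadow L}) :
  (compat phi (sh_union F))%:R = \prod_c (compat phi (F c))%:R :> R[i].
Proof.
have [/forall_inP h|h] := boolP (compat phi (sh_union F)).
  rewrite big1 // => c _; rewrite (_ : compat _ _ = true) //; apply/forall_inP => x xF.
  by apply: h; apply/finset.bigcupP; exists c.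
have /forall_inPn[x /finset.bigcupP[c _ xc] px] := h.
rewrite (bigD1 c) //= (_ : compat phi (F c) = false) ?mul0r //.
by apply/negbTE/forall_inPn; exists x.
Qed.

Lemma colour_weights : weights P A [set: L] colour_weight.
Proof.
split.
- move=> S N phi N0 _; rewrite fact //.
  rewrite (eq_bigr (fun c => \sum_sh W c (S :&: Lc c) N sh * (compat phi sh)%:R)); last first.
    by move=> c _; rewrite (weights_moment (HW c)).
  rewrite bigA_distr_bigA /= (partition_big sh_union predT) //=; apply: eq_bigr => sh _.
  rewrite /colour_weight mulr_suml; apply: eq_bigr => F /eqP <-.
  by rewrite big_split /= -compat_union.
- move=> S1 S2 N sh1 sh2 N0 _ _ dis V1 V2.
  have VU : colour_weight (S1 :|: S2) N (shadowU sh1 sh2) != 0 -> respects sh1 && respects sh2.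
    by case/colour_weight_neq0; rewrite respectsU.
  have [/andP[r1 r2]|nr] := boolP (respects sh1 && respects sh2); last first.
    have -> : colour_weight (S1 :|: S2) N (shadowU sh1 sh2) = 0.
      by apply/eqP; apply: contraNT nr => /VU.
    move: nr; rewrite negb_and => /orP[] nr.
      suff -> : colour_weight S1 N sh1 = 0 by rewrite mul0r.
      by apply/eqP; apply: contraNT nr => /colour_weight_neq0[].
    suff -> : colour_weight S2 N sh2 = 0 by rewrite mulr0.
    by apply/eqP; apply: contraNT nr => /colour_weight_neq0[].
  have disc c : [disjoint S1 :&: Lc c & S2 :&: Lc c].
    by apply: disjointWl (finset.subsetIl _ _) _; apply: disjointWr (finset.subsetIl _ _) dis.
  have VUU := valid_shadowU dis V1 V2.
  rewrite !colour_weightE ?respectsU ?r1 ?r2 //.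
  rewrite -big_split /=; apply: eq_bigr => c _.
  rewrite sh_restrU finset.setIUl (weights_split (HW c)) //; exact: valid_restr.
- move=> S sh _.
  have [V|nV] := pselect (valid S sh /\ respects sh); last first.
    apply: (@ccvg_to_ccvg _ _ 0); rewrite (_ : (fun N => _) = (fun=> 0)).
      exact: ccvg_to_cst.
    apply/funext => N; have [->|/colour_weight_neq0 //] := eqVneq (colour_weight S N sh) 0.
    by rewrite mulr0.
  case: V => V rs.
  pose z c : int := #|S :&: Lc c|%:Z + (nloops (S :&: Lc c) (sh_restr c sh))%:Z
     - (2 * nclasses (S :&: Lc c) (sh_restr c sh))%N%:Z.
  have zE : #|S|%:Z + (nloops S sh)%:Z - (2 * nclasses S sh)%N%:Z = \sum_c z c.
    have mor (g : K -> nat) : (\sum_c g c)%N%:Z = \sum_c (g c)%:Z.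
      exact: (big_morph Posz PoszD (erefl 0%:Z)).
    rewrite card_colours (nloops_colours V rs) (nclasses_colours V rs) big_distrr /=.
    by rewrite !mor -big_split /= -sumrB.
  apply: (@ccvg_to_ccvg _ _ (\prod_c clim (fun N => N%:R ^ z c * W c (S :&: Lc c) N (sh_restr c sh)))).
  apply: (@ccvg_to_eventually _ (fun N => \prod_c (N%:R ^ z c * W c (S :&: Lc c) N (sh_restr c sh)))).
    move=> N N0; have N0' : N%:R != 0 :> R[i] by rewrite pnatr_eq0 -lt0n.
    rewrite big_split /= colour_weightE // zE; congr (_ * _).
    rewrite (@big_morph _ _ (fun y : int => (N%:R : R[i]) ^ y) 1 *%R 0 +%R) // => x y.
    by rewrite expfzDr.
  by apply: ccvg_to_prod => c _; apply/ccvgP/(weights_limit (HW c)).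
by move=> S N sh _ /colour_weight_neq0[].
Qed.

End Colours.

(** * Centering removes isolated blocks *)

Definition lone (L : finType) (sh : shadow L) (k : L) : bool :=
  [forall l, ((k, l) \in sh.2) ==> (l == k)].

Definition splits (L : finType) (S : {set L}) (sh : shadow L) : bool :=
  respects (fun k => k \in S) sh.

Lemma splits_lone (L : finType) (S : {set L}) (sh : shadow L) (k : L) :
  valid S sh -> splits [set k] sh = lone sh k.
Proof.
move=> V; apply/forall_inP/forallP => [h l|h [a b] /= ab].
  by apply/implyP => kl; move: (h _ kl); rewrite /= !inE eqxx eq_sym => /eqP.
rewrite !inE; apply/eqP; apply/idP/idP => /eqP ek.
  by have := h b; rewrite -ek ab.
by have := h a; rewrite -ek (valid_rsym V ab).
Qed.

Lemma compat_shadowU (L : finType) N (phi : L * bool -> 'I_N) (a b : shadow L) :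
  compat phi (shadowU a b) = compat phi a && compat phi b.
Proof.
apply/forall_inP/andP => [h|[/forall_inP ha /forall_inP hb] x].
  by split; apply/forall_inP => x xa; apply: h; rewrite inE xa ?orbT.
by rewrite inE => /orP[/ha|/hb].
Qed.

Lemma lone_shadowUr (L : finType) (S1 S2 : {set L}) (a b : shadow L) k :
  valid S1 a -> k \notin S1 -> lone (shadowU a b) k = lone b k.
Proof.
move=> V kS; apply: eq_forallb => l; rewrite inE; case: (boolP (_ \in a.2)) => //= h.
by rewrite (valid_rin V h) in kS.
Qed.

Lemma sum_split (L : finType) (F : zmodType) (S1 S2 : {set L}) (H : shadow L -> F) :
  [disjoint S1 & S2] ->
  \sum_(sh | `[< valid (S1 :|: S2) sh >] && splits S1 sh) H sh =
  \sum_(sh1 | `[< valid S1 sh1 >]) \sum_(sh2 | `[< valid S2 sh2 >]) H (shadowU sh1 sh2).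
Proof.
move=> dis; rewrite pair_big /=.
pose col k := k \in S1.
have restrU (sh : shadow L) : shadowU (sh_restr col true sh) (sh_restr col false sh) = sh.
  rewrite [RHS]surjective_pairing; congr (_, _); apply/setP => x; rewrite !inE;
  by case: (col _); rewrite /= ?eqxx ?andbT ?andbF ?orbF.
have in2 k : k \in S2 -> col k = false by move=> k2; rewrite /col (disjointFl dis k2).
rewrite (reindex_onto (fun p : shadow L * shadow L => shadowU p.1 p.2)
  (fun sh => (sh_restr col true sh, sh_restr col false sh))) /=; last by move=> sh _; apply: restrU.
apply: eq_bigl => -[a b] /=; apply/idP/idP => [|/andP[/asboolP Va /asboolP Vb]].
  case/andP => /andP[/asboolP V sp] /eqP[ea eb].
  have E1 : (S1 :|: S2) :&: colour_class col true = S1.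
    by apply/setP => k; rewrite !inE /col; case: (k \in S1); rewrite ?andbF.
  have E2 : (S1 :|: S2) :&: colour_class col false = S2.
    apply/setP => k; rewrite !inE; have [/in2 ->|] := boolP (k \in S2); first by rewrite orbT.
    by rewrite orbF /col; case: (k \in S1).
  have := valid_restr V sp true; have := valid_restr V sp false; rewrite E1 E2 => v2 v1.
  by rewrite ea eb in v1 v2; apply/andP; split; apply/asboolP.
rewrite (asboolT (valid_shadowU dis Va Vb)) /splits respectsU /=.
have ra k l : (k, l) \in a.2 -> col k && col l.
  by move=> h; rewrite /col (valid_rin Va h) (valid_rin Va (valid_rsym Va h)).
have rb k l : (k, l) \in b.2 -> (col k == false) && (col l == false).
  by move=> h; rewrite (in2 _ (valid_rin Vb h)) (in2 _ (valid_rin Vb (valid_rsym Vb h))).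
have -> : respects (fun k => k \in S1) a.
  by apply/forall_inP => -[k l] /ra /andP[/= ? ?]; apply/eqP; rewrite [LHS](_ : _ = true).
have -> : respects (fun k => k \in S1) b.
  apply/forall_inP => -[k l] /rb /andP[/eqP /= h1 /eqP h2].
  by apply/eqP; rewrite [LHS]h1 [RHS]h2.
apply/eqP; congr (_, _); rewrite sh_restrU [RHS]surjective_pairing; congr (_, _);
  apply/setP => -[u v]; rewrite !inE /=.
- have [h|h] := boolP ((u, v) \in a.1); first by rewrite (_ : col u.1) //; apply: (valid_in Va h).
  have [h'|h'] := boolP ((u, v) \in b.1) => //.
  by rewrite (in2 _ (valid_in Vb h')).
- have [h|h] := boolP ((u, v) \in a.2); first by have /andP[-> _] := ra _ _ h.
  by have [h'|h'] := boolP ((u, v) \in b.2) => //; have /andP[/eqP -> _] := rb _ _ h'.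
- have [h|h] := boolP ((u, v) \in b.1); first by rewrite (in2 _ (valid_in Vb h)) orbT.
  have [h'|h'] := boolP ((u, v) \in a.1) => //.
  by rewrite (_ : col u.1) //; apply: (valid_in Va h').
have [h|h] := boolP ((u, v) \in b.2); first by have /andP[-> _] := rb _ _ h; rewrite orbT.
by have [h'|h'] := boolP ((u, v) \in a.2) => //; have /andP[-> _] := ra _ _ h'.
Qed.

Section Centering.
Variables (L : finType) (R : realType) (d : nat -> measure_display)
    (T : forall N : nat, measurableType (d N)) (P : forall N : nat, probability (T N) R)
    (A : forall N : nat, L -> T N -> 'M[R[i]]_N)
    (W : {set L} -> nat -> shadow L -> R[i]).
Hypothesis HW : weights P A [set: L] W.
Variable N : nat.
Hypothesis N0 : (0 < N)%N.
Hypothesis intA : forall (S : {set L}) (phi : L * bool -> 'I_N),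
  cintegrable (P N) (fun w => \prod_(k in S) A k w (phi (k, false)) (phi (k, true))).

Let subT (S : {set L}) : S \subset [set: L]. Proof. exact: finset.subsetT. Qed.

(** The weights vanish off the valid shadows, so that sums may be restricted
    to them. *)
Lemma sum_valid (S : {set L}) (H : shadow L -> R[i]) :
  \sum_sh W S N sh * H sh = \sum_(sh | `[< valid S sh >]) W S N sh * H sh.
Proof.
rewrite [RHS]big_mkcond; apply: eq_bigr => sh _; case: asboolP => // nV.
have [->|/(weights_valid HW (subT S)) //] := eqVneq (W S N sh) 0.
by rewrite mul0r.
Qed.

(** In a valid shadow of a single block the two ends are mates. *)
Lemma entry_moment k (a b : 'I_N) :
  cexp (P N) (fun w => A k w a b) = cexp (P N) (fun w => ntr (A k w)) * (a == b)%:R.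
Proof.
pose w1 := \sum_(sh | `[< valid [set k] sh >]) W [set k] N sh.
have e a' b' : cexp (P N) (fun w => A k w a' b') = w1 * (a' == b')%:R.
  pose phi (u : L * bool) := if u.2 then b' else a'.
  have -> : (fun w => A k w a' b') =
      (fun w => \prod_(l in [set k]) A l w (phi (l, false)) (phi (l, true))).
    by apply/funext => w; rewrite big_set1.
  rewrite -/(block_moment _ _ _ _) (weights_moment HW) // sum_valid mulr_suml.
  apply: eq_bigr => sh /asboolP V; congr (_ * _%:R).
  have inK u v : (u, v) \in sh.1 -> (u.1 = k) /\ (v.1 = k).
    move=> h; have := valid_in V h; have := valid_in V (valid_sym V h).
    by rewrite !inE => /eqP -> /eqP ->.
  suff -> : compat phi sh = (a' == b') by [].
  apply/forall_inP/eqP => [h|ab [u v] _]; last by rewrite /phi ab; case: u.2; case: v.2.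
  have [[l c] vk h'] := valid_mate V (u := (k, false)) (set11 k).
  have [_ /= lk] := inK _ _ h'; rewrite lk in vk h'.
  case: c vk h' => [_ h'|]; last by rewrite eqxx.
  by have := h _ h'; rewrite /phi /= => /eqP.
have intk a' b' : cintegrable (P N) (fun w => A k w a' b').
  pose phi (u : L * bool) := if u.2 then b' else a'.
  have := intA [set k] phi; congr cintegrable.
  by apply/funext => w; rewrite big_set1.
rewrite e; congr (_ * _).
rewrite (_ : (fun w => _) = (fun w => N%:R^-1 * \sum_i A k w i i)) //.
rewrite cexpZ; last by apply: cintegrable_sum.
rewrite cexp_sum // (eq_bigr (fun=> w1)); last by move=> i _; rewrite e eqxx mulr1.
rewrite sumr_const card_ord -[w1 *+ N]mulr_natl mulrA mulVf ?mul1r //.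
by rewrite pnatr_eq0 -lt0n.
Qed.

(** Centering the block [k0] subtracts its mean times the moment of the other
    blocks.  By multiplicativity of the weights this is the part of the
    expansion in which [k0] is alone in its class. *)
Lemma centered_moment (r : seq L) (S : {set L}) (phi : L * bool -> 'I_N) :
  uniq r -> (forall k, k \in r -> k \notin S) ->
  cintegrable (P N) (fun w => (\prod_(k in S) A k w (phi (k, false)) (phi (k, true))) *
     \prod_(k <- r) centered (P N) (A k) w (phi (k, false)) (phi (k, true))) /\
  cexp (P N) (fun w => (\prod_(k in S) A k w (phi (k, false)) (phi (k, true))) *
     \prod_(k <- r) centered (P N) (A k) w (phi (k, false)) (phi (k, true))) =
  \sum_(sh | all (fun k => ~~ lone sh k) r)
     W (S :|: [set k in r]) N sh * (compat phi sh)%:R.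
Proof.
elim: r S => [|k0 r IH] S.
  move=> _ _; rewrite (_ : (fun w => _) = (fun w => \prod_(k in S) A k w (phi (k, false)) (phi (k, true)))).
    split; first exact: intA.
    rewrite -/(block_moment _ _ _ _) (weights_moment HW) //=.
    by rewrite (_ : S :|: _ = S) //; apply/setP => k; rewrite !inE orbF.
  by apply/funext => w; rewrite big_nil mulr1.
case/andP => k0r ur notS.
have k0S : k0 \notin S by apply: notS; rewrite inE eqxx.
have h1 k : k \in r -> k \notin k0 |: S.
  move=> kr; rewrite !inE negb_or notS ?inE ?kr ?orbT // andbT.
  by apply: contraNneq k0r => <-.
have h2 k : k \in r -> k \notin S by move=> kr; rewrite notS // inE kr orbT.
have [i1 e1] := IH _ ur h1; have [i2 e2] := IH _ ur h2.
set al := cexp (P N) (fun w => ntr (A k0 w)) * (phi (k0, false) == phi (k0, true))%:R.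
have fE : (fun w => (\prod_(k in S) A k w (phi (k, false)) (phi (k, true))) *
   \prod_(k <- k0 :: r) centered (P N) (A k) w (phi (k, false)) (phi (k, true))) =
  (fun w => (\prod_(k in k0 |: S) A k w (phi (k, false)) (phi (k, true))) *
      (\prod_(k <- r) centered (P N) (A k) w (phi (k, false)) (phi (k, true)))
    + (- al) * ((\prod_(k in S) A k w (phi (k, false)) (phi (k, true))) *
      (\prod_(k <- r) centered (P N) (A k) w (phi (k, false)) (phi (k, true))))).
  apply/funext => w; rewrite big_cons big_setU1 //=.
  set x := A _ _ _ _; set y := \prod_(k in S) _; set z := \prod_(k <- r) _.
  have -> : centered (P N) (A k0) w (phi (k0, false)) (phi (k0, true)) = x - al.
    by rewrite /centered !mxE -mulr_natr.
  by rewrite mulrBl mulrBr mulNr mulrCA mulrA [y * (al * z)]mulrCA.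
rewrite fE; split; first by apply: cintegrableD => //; apply: cintegrableZ.
rewrite cexpD //; last exact: cintegrableZ.
rewrite cexpZ // e1 e2.
set U' := S :|: [set k in r]%SET.
have -> : (k0 |: S) :|: [set k in r]%SET = [set k0]%SET :|: U' by rewrite /U' finset.setUA.
have -> : S :|: [set k in k0 :: r]%SET = [set k0]%SET :|: U'.
  by apply/setP => k; rewrite !inE orbCA.
set U := [set k0]%SET :|: U'.
have dis : [disjoint [set k0]%SET & U'].
  by rewrite disjoints1 !inE negb_or k0S k0r.
rewrite [in RHS](eq_bigl (fun sh => all (fun k => ~~ lone sh k) r && ~~ lone sh k0));
  last by move=> sh /=; rewrite andbC.
rewrite (bigID (fun sh => lone sh k0)) /= addrAC.
suff -> : \sum_(sh | all (fun k => ~~ lone sh k) r && lone sh k0)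
     W U N sh * (compat phi sh)%:R =
   al * \sum_(sh | all (fun k => ~~ lone sh k) r) W U' N sh * (compat phi sh)%:R.
  by rewrite mulNr subrr add0r.
(* Split off the block [k0]: its factor is the mean [al]. *)
have -> : \sum_(sh | all (fun k => ~~ lone sh k) r && lone sh k0)
     W U N sh * (compat phi sh)%:R =
   \sum_sh W U N sh * ((compat phi sh)%:R *
      (all (fun k => ~~ lone sh k) r && lone sh k0)%:R).
  rewrite big_mkcond; apply: eq_bigr => sh _; case: ifP => _; rewrite ?mulr1 //.
  by rewrite mulr0 mulr0.
rewrite sum_valid.
rewrite (eq_bigr (fun sh => if splits [set k0]%SET sh then W U N sh * ((compat phi sh)%:R *
      (all (fun k => ~~ lone sh k) r)%:R) else 0)); last first.
  move=> sh /asboolP V; rewrite (splits_lone _ V); case: ifP => h; rewrite ?andbT //.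
  by rewrite andbF !mulr0.
rewrite -big_mkcondr sum_split //.
have -> : al = \sum_(sh | `[< valid [set k0]%SET sh >]) W [set k0]%SET N sh * (compat phi sh)%:R.
  rewrite -sum_valid -(weights_moment HW) // /block_moment /al -entry_moment.
  by apply: eq_cexp => w; rewrite big_set1.
have -> : \sum_(sh | all (fun k => ~~ lone sh k) r) W U' N sh * (compat phi sh)%:R =
    \sum_(sh | `[< valid U' sh >]) W U' N sh * ((compat phi sh)%:R *
      (all (fun k => ~~ lone sh k) r)%:R).
  rewrite -sum_valid big_mkcond; apply: eq_bigr => sh _; case: ifP => _; rewrite ?mulr1 //.
  by rewrite !mulr0.
rewrite mulr_suml; apply: eq_bigr => a /asboolP Va.
rewrite mulr_sumr; apply: eq_bigr => b /asboolP Vb.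
rewrite (weights_split HW) // compat_shadowU.
rewrite (@eq_in_all _ _ (fun k => ~~ lone b k)); last first.
  move=> k kr; rewrite (lone_shadowUr _ _ Va) // inE.
  by apply: contraNneq k0r => <-.
by rewrite -mulnb natrM !mulrA; congr (_ * _ * _); rewrite -!mulrA; congr (_ * _); rewrite mulrC.
Qed.

End Centering.

Lemma trivial_weights (L : finType) (R : realType) (d : nat -> measure_display)
    (T : forall N : nat, measurableType (d N)) (P : forall N : nat, probability (T N) R)
    (A : forall N : nat, L -> T N -> 'M[R[i]]_N) (Lc : {set L}) : Lc = finset.set0 ->
  weights P A Lc (fun S N sh => (sh == (finset.set0, finset.set0))%:R).
Proof.
move=> Lc0; have S0 (S : {set L}) : S \subset Lc -> S = finset.set0.
  by rewrite Lc0 finset.subset0 => /eqP.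
have V0 : valid finset.set0 (finset.set0, finset.set0 : {set L * L}) by split=> [u v|u|u v|u v w|u|k l|k|k l|k l m|u v]; rewrite inE.
have V0E (sh : shadow L) : valid finset.set0 sh -> sh = (finset.set0, finset.set0).
  move=> V; rewrite [LHS]surjective_pairing; congr (_, _); apply/setP => -[u v]; rewrite inE.
    by apply/negP => /(valid_in V); rewrite inE.
  by apply/negP => /(valid_rin V); rewrite inE.
split.
- move=> S N phi N0 /S0 ->; rewrite /block_moment.
  rewrite (_ : (fun w => _) = (fun=> 1)); last by apply/funext => w; rewrite big_set0.
  rewrite cexp_cst (bigD1 (finset.set0, finset.set0)) //= eqxx mul1r.
  rewrite big1 ?addr0 => [|sh /negbTE ->]; last by rewrite mul0r.
  by rewrite (_ : compat _ _ = true) //; apply/forall_inP => x; rewrite inE.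
- move=> S1 S2 N sh1 sh2 N0 /S0 -> /S0 -> _ /V0E -> /V0E ->.
  by rewrite /shadowU !finset.setU0 !eqxx mulr1.
- move=> S sh /S0 ->; have [->|ne] := eqVneq sh (finset.set0, finset.set0).
    apply: (@ccvg_to_ccvg _ _ 1).
    rewrite (_ : (fun N => _) = (fun=> 1)); first exact: ccvg_to_cst.
    apply/funext => N; rewrite mulr1 cards0.
    by rewrite /nloops /nclasses /n_comp_mem !eq_card0 // => k; rewrite !inE andbF.
  apply: (@ccvg_to_ccvg _ _ 0).
  rewrite (_ : (fun N => _) = (fun=> 0)); first exact: ccvg_to_cst.
  by apply/funext => N; rewrite mulr0.
by move=> S N sh /S0 ->; case: (sh =P _) => [->|_]; rewrite ?eqxx.
Qed.

(** * Leading shadows of a cyclic product *)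

(** The root of a class and a chosen mate of this root are two elements of
    the class, different for different classes; in case of equality these
    elements are everything. *)
Lemma two_point_classes (T : finType) (e : rel T) :
  connect_sym e -> (forall x, exists2 y, y != x & connect e x y) ->
  ((n_comp e T).*2 <= #|T|)%N /\
  ((n_comp e T).*2 = #|T| -> forall x y z, connect e x y -> connect e x z ->
     y != x -> z != x -> y = z).
Proof.
move=> se mate; pose m x := odflt x [pick y | (y != x) && connect e x y].
have mP x : m x != x /\ connect e x (m x).
  rewrite /m; case: pickP => [y /andP[] //|no]; have [y yx xy] := mate x.
  by have := no y; rewrite /= yx xy.
pose r := fingraph.root e; have rE x y : connect e x y -> r x = r y by move=> h; apply/(fingraph.rootP se).
pose A := [set x | roots e x]%SET; pose B := m @: A.
have rA x : x \in A -> r x = x by rewrite inE => /eqP.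
have nA : n_comp e T = #|A| by apply: eq_card => x; rewrite !inE andbT.
have cB : #|B| = #|A|.
  apply: card_in_imset => x y /rA xE /rA yE mxy.
  by rewrite -xE -yE (rE _ _ (mP x).2) (rE _ _ (mP y).2) mxy.
have dis : A :&: B = finset.set0.
  apply/setP => x; rewrite !inE; apply/negP => /andP[xA /imsetP[y yA xE]].
  have := (mP y).1; rewrite -xE; move: xA; rewrite -[roots e x]/(r x == x) => /eqP <-.
  by rewrite xE -(rE _ _ (mP y).2) (rA _ yA) eqxx.
have cU : #|A :|: B| = (n_comp e T).*2.
  by rewrite cardsU dis cards0 subn0 cB nA addnn.
split=> [|eT x y z xy xz yx zx]; first by rewrite -cU max_card.
have UT : A :|: B = [set: T]%SET.
  by apply/eqP; rewrite finset.eqEcard finset.subsetT cardsT cU eT leqnn.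
have two u : u = r u \/ u = m (r u).
  have: u \in A :|: B by rewrite UT inE.
  rewrite finset.in_setU => /orP[/rA|/imsetP[v vA uE]]; first by left.
  by right; rewrite {2}uE -(rE _ _ (mP v).2) (rA _ vA).
have yE := two y; have zE := two z; have xE := two x.
rewrite -(rE _ _ xy) in yE; rewrite -(rE _ _ xz) in zE.
case: yE => yE; case: zE => zE; rewrite ?yE ?zE //; case: xE => xE;
  by move: yx zx; rewrite yE zE -xE eqxx.
Qed.

Lemma coarser_classes (T : finType) (e e' : rel T) :
  connect_sym e -> connect_sym e' -> subrel e (connect e') ->
  (n_comp e' T <= n_comp e T)%N /\
  (n_comp e T = n_comp e' T -> forall x y, connect e' x y -> connect e x y).
Proof.
move=> se se' ee'; have sub := connect_sub ee'.
split; first by apply: (@n_comp_le _ _ _ _ _ _ id) => // x y _ _ /sub.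
move=> eq x y xy; pose r := fingraph.root e; pose r' := fingraph.root e'.
pose A := [set x | roots e x]%SET; pose A' := [set x | roots e' x]%SET.
have nA : n_comp e T = #|A| by apply: eq_card => z; rewrite !inE andbT.
have nA' : n_comp e' T = #|A'| by apply: eq_card => z; rewrite !inE andbT.
have rA' z : z \in A' -> r' z = z by rewrite inE => /eqP.
have cr : #|r @: A'| = #|A'|.
  apply: card_in_imset => z t /rA' zE /rA' tE rr.
  by rewrite -zE -tE; apply/(fingraph.rootP se')/sub/(fingraph.rootP se).
have rAA : r @: A' = A.
  apply/eqP; rewrite finset.eqEcard cr -nA' -nA eq leqnn andbT.
  by apply/fintype.subsetP => _ /imsetP[z _ ->]; rewrite inE roots_root.
have key z : connect e z (r' z).
  have: r z \in A by rewrite inE roots_root.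
  rewrite -rAA => /imsetP[t /rA' tE rzt].
  have zt : connect e z t by apply/(fingraph.rootP se).
  by rewrite /r' (fingraph.rootP se' (sub _ _ zt)) -/r' tE.
apply: connect_trans (key x) _.
by rewrite /r' (fingraph.rootP se' xy) se; apply: key.
Qed.

Section Cyclic.
Variables (L : finType) (next prev : L -> L).
Hypotheses (nextK : cancel next prev) (prevK : cancel prev next).

(** In a trace of a product the column index of a block is the row index of
    the next one. *)
Definition idx (u : L * bool) : L := if u.2 then next u.1 else u.1.

Definition index_rel (sh : shadow L) : rel L :=
  fun a b => [exists u, exists v, [&& (u, v) \in sh.1, idx u == a & idx v == b]].

Lemma index_relP (sh : shadow L) a b :
  reflect (exists u v, [/\ (u, v) \in sh.1, idx u = a & idx v = b]) (index_rel sh a b).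
Proof.
apply: (iffP existsP) => [[u /existsP[v /and3P[h /eqP ? /eqP ?]]]|[u [v [h <- <-]]]].
  by exists u, v.
by exists u; apply/existsP; exists v; rewrite h !eqxx.
Qed.

Variables (K : finType) (col : L -> K).
Hypothesis alt : forall k, col k != col (next k).

Lemma idx_inj u v : idx u = idx v -> col u.1 = col v.1 -> u = v.
Proof.
case: u v => k [] [l []]; rewrite /idx /=.
- by move/(can_inj nextK) ->.
- by move=> <- /eqP; rewrite (negPf (alt k)).
- by move=> -> /eqP; rewrite eq_sym (negPf (alt l)).
by move=> ->.
Qed.

Variable sh : shadow L.
Hypotheses (V : valid [set: L] sh) (rs : respects col sh) (ni : forall k, ~~ lone sh k).

Let tau u v := (u, v) \in sh.1.
Let rho k l := (k, l) \in sh.2.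

Lemma rho_col k l : rho k l -> col k = col l.
Proof. by move=> h; move/forall_inP: rs => /(_ _ h) /eqP. Qed.

Lemma tau_col u v : tau u v -> col u.1 = col v.1.
Proof. by move/(valid_fine V)/rho_col. Qed.

Lemma mate u : exists2 v, v != u & tau u v.
Proof. by apply: (valid_mate V); rewrite inE. Qed.

(** A tie between two ends with the same index would join consecutive
    blocks, whose colours differ. *)
Lemma tau_idx u v : tau u v -> v != u -> idx v != idx u.
Proof.
by move=> uv; apply: contraNneq => /idx_inj -> //; rewrite (tau_col uv).
Qed.

Lemma index_rel_sym : connect_sym (index_rel sh).
Proof.
by apply: sym_connect_sym => a b; apply/index_relP/index_relP => -[u [v [h ? ?]]];
  exists v, u; split=> //; apply: (valid_sym V).
Qed.

Lemma index_bound : ((n_comp (index_rel sh) L).*2 <= #|L|)%N /\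
  ((n_comp (index_rel sh) L).*2 = #|L| -> forall u v u' v', tau u v -> tau u' v' ->
     idx u = idx u' -> v != u -> v' != u' -> idx v = idx v').
Proof.
have [|le h] := two_point_classes index_rel_sym.
  move=> a; have [v va h] := mate (a, false).
  by exists (idx v); [apply: (tau_idx h va)|apply/connect1/index_relP; exists (a, false), v].
split=> // e u v u' v' uv uv' uu' vu vu'; apply: (h e (idx u)).
- by apply/connect1/index_relP; exists u, v.
- by rewrite uu'; apply/connect1/index_relP; exists u', v'.
- exact: tau_idx.
- by rewrite uu'; apply: tau_idx.
Qed.

Lemma class_relE k l : connect (class_rel sh) k l = rho k l.
Proof.
apply/idP/idP => [/connectP[p]|h]; last exact: connect1.
elim: p k => [k _ ->|m p IH k /= /andP[km pm] /(IH _ pm) ml].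
  by apply: (valid_rrefl V); rewrite inE.
exact: (valid_rtrans V km ml).
Qed.

Lemma nTE (e : rel L) : n_comp e [set: L]%SET = n_comp e L.
Proof. by apply: eq_n_comp_r => x; rewrite !inE. Qed.

Lemma class_bound : ((nclasses [set: L] sh).*2 <= #|L|)%N /\
  ((nclasses [set: L] sh).*2 = #|L| -> forall k l m, rho k l -> rho k m ->
     l != k -> m != k -> l = m).
Proof.
rewrite /nclasses nTE; have [|le h] := two_point_classes (class_rel_sym V).
  move=> k; have /forallPn[l] := ni k; rewrite negb_imply => /andP[kl lk].
  by exists l => //; rewrite class_relE.
by split=> // e k l m kl km; apply: (h e); rewrite class_relE.
Qed.

Lemma loop_bound : (nclasses [set: L] sh <= nloops [set: L] sh)%N /\
  (nloops [set: L] sh = nclasses [set: L] sh -> forall k l, rho k l ->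
     connect (label_rel sh) k l).
Proof.
rewrite /nclasses /nloops !nTE.
have [|le h] := coarser_classes (label_rel_sym V) (class_rel_sym V).
  by move=> k l /existsP[b /existsP[b' h]]; apply: connect1; apply: (valid_fine V h).
by split=> // e k l; rewrite -class_relE; apply: h.
Qed.

(** The power of [N] that a shadow carries in the covariance: the free
    indices, against the normalisation in [weights_limit]. *)
Definition excess : int :=
  (2 * nclasses [set: L] sh)%N%:Z - #|L|%:Z - (nloops [set: L] sh)%:Z
  + (n_comp (index_rel sh) L)%:Z.

Lemma excess_le0 : excess <= 0.
Proof.
by have [h1 _] := index_bound; have [h2 _] := class_bound; have [h3 _] := loop_bound;
  rewrite /excess; lia.
Qed.

Section Leading.
Hypothesis lead : excess = 0.

Lemma lead_idx u v u' v' : tau u v -> tau u' v' -> idx u = idx u' -> v != u -> v' != u' ->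
  idx v = idx v'.
Proof.
have [h1 e1] := index_bound; have [h2 _] := class_bound; have [h3 _] := loop_bound.
by apply: e1; move: lead; rewrite /excess; lia.
Qed.

Lemma lead_rho k l m : rho k l -> rho k m -> l != k -> m != k -> l = m.
Proof.
have [h1 _] := index_bound; have [h2 e2] := class_bound; have [h3 _] := loop_bound.
by apply: e2; move: lead; rewrite /excess; lia.
Qed.

Lemma lead_label k l : rho k l -> connect (label_rel sh) k l.
Proof.
have [h1 _] := index_bound; have [h2 _] := class_bound; have [h3 e3] := loop_bound.
by apply: e3; move: lead; rewrite /excess; lia.
Qed.

Lemma lead_tau u v v' : tau u v -> tau u v' -> v != u -> v' != u -> v = v'.
Proof.
move=> uv uv' vu vu'; apply: idx_inj; first exact: (lead_idx uv uv').
by rewrite -(tau_col uv) -(tau_col uv').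
Qed.

(** Otherwise the two ends of a block are tied to each other and to nothing
    else, and no chain of ties leads to the other block of its class. *)
Lemma lead_neq u v : tau u v -> v != u -> v.1 != u.1.
Proof.
move=> uv vu; apply/negP => /eqP vu1.
have loop b : tau (u.1, b) (u.1, ~~ b).
  have vE : v = (u.1, ~~ u.2).
    move: vu vu1; case: (u) (v) => k c [l c'] /= h lk; rewrite lk in h *; congr (_, _).
    by move: h; case: c; case: c'; rewrite ?eqxx.
  have [<-|/negPf bu] := eqVneq u.2 b; first by rewrite -vE -surjective_pairing.
  have -> : b = ~~ u.2 by move: bu; case: b; case: (u.2).
  by rewrite negbK -vE -surjective_pairing; apply: (valid_sym V).
have stay m : connect (label_rel sh) u.1 m -> m = u.1.
  case/connectP => p; elim: p => [//|l p IH] /= /andP[/existsP[b /existsP[b' h]]].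
  suff -> : l = u.1 by [].
  have [[-> _] //|ne] := eqVneq (l, b') (u.1, b).
  have e : (u.1, ~~ b) != (u.1, b) by rewrite xpair_eqE eqxx; case: (b).
  by case: (lead_tau (loop b) h e ne).
have /forallPn[l] := ni u.1; rewrite negb_imply => /andP[/lead_label/stay ->].
by rewrite eqxx.
Qed.

Lemma tau_sym u v : tau u v -> tau v u. Proof. exact: (valid_sym V). Qed.

Lemma lead_flip k l b : l != k -> tau (k, false) (l, b) -> tau (k, true) (l, ~~ b).
Proof.
move=> lk h; have [[m c] mk h'] := mate (k, true).
have ml : m = l.
  apply: (@lead_rho k); [exact: (valid_fine V h')|exact: (valid_fine V h)| |done].
  exact: (lead_neq h' mk).
rewrite ml in h' mk; suff -> : ~~ b = c by [].
have [cb|] := eqVneq c b; last by case: (c); case: (b).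
have kl : k != l by rewrite eq_sym.
have ne c' : (k, c') != (l, b) by rewrite xpair_eqE (negPf kl).
by have := lead_tau (tau_sym h) _ (ne _) (ne true); rewrite -{1}cb => /(_ (tau_sym h')).
Qed.

(** The two ends at the index between [k] and [next k] are tied to the two
    ends at one other index: the partners of [k] and of [next k] are
    neighbours. *)
Lemma lead_next k l b : l != k -> tau (k, false) (l, b) ->
  tau (next k, false) (if b then prev l else next l, b).
Proof.
move=> lk h; have h1 := lead_flip lk h.
have [[m c] mk h2] := mate (next k, false).
have ne1 : (l, ~~ b) != (k, true) by rewrite xpair_eqE (negPf lk).
have ne : (m, c) != (l, ~~ b).
  apply/negP => /eqP E; rewrite E in h2 mk.
  have kl : (k, true) != (l, ~~ b) by rewrite eq_sym.
  have nl : (next k, false) != (l, ~~ b) by rewrite eq_sym.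
  by have := lead_tau (tau_sym h1) (tau_sym h2) kl nl.
have E := lead_idx h1 h2 erefl ne1 mk.
move: ne h2 E; rewrite /idx /=; case: b {h h1 ne1} => /=; case: c {mk} => //=.
- by move=> _ h2 ->; rewrite nextK.
- by move=> ne _ E; rewrite E eqxx in ne.
- by move=> ne _ /(can_inj nextK) E; rewrite E eqxx in ne.
by move=> _ h2 ->.
Qed.

End Leading.

End Cyclic.

(** * Spoke diagrams *)

(** The flag [o] tells whether a block and its partner are read in opposite
    senses: if so, the row index of one is tied to the column index of the
    other, as in the trace of [A B]; if not, rows are tied to rows and columns
    to columns, as in the trace of [A B^T]. *)
Definition oriented (L : finType) (r : {set L * L}) (o : bool) : shadow L :=
  ([set uv | ((uv.1.1, uv.2.1) \in r) && (uv.1.2 (+) uv.2.2 == (uv.1.1 != uv.2.1) && o)], r).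

Section Word.
Variables (p q : nat).
Hypotheses (hp : (0 < p)%N) (hq : (0 < q)%N).
Let L : finType := ('I_p + 'I_q)%type.

Definition nextL (k : L) : L :=
  match k with inl i => inl (ordS i) | inr j => inr (ordS j) end.
Definition prevL (k : L) : L :=
  match k with inl i => inl (ord_pred i) | inr j => inr (ord_pred j) end.

Lemma nextLK : cancel nextL prevL.
Proof. by case=> i /=; rewrite ordSK. Qed.

Definition sideA : {set L} := [set k | if k is inl _ then true else false].

Variables (K : finType) (col : L -> K).
Hypothesis alt : forall k, col k != col (nextL k).
Variable sh : shadow L.
Hypotheses (V : valid [set: L] sh) (rs : respects col sh) (ni : forall k, ~~ lone sh k).
Hypothesis lead : excess nextL sh = 0.

Lemma lead_all_A i0 j0 o : ((inl i0, false), (inr j0, o)) \in sh.1 ->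
  forall i, exists j, ((inl i, false), (inr j, o)) \in sh.1.
Proof.
move=> h i; have : fconnect (@ordS p) i0 i.
  by rewrite (fconnect_cycle (fcycle_ordS p)) ?mem_enum.
case/connectP => s; elim: s i0 j0 h => [|i1 s IH] i0 j0 h /=; first by move=> _ ->; exists j0.
case/andP => /eqP <-; apply: (IH _ (if o then ord_pred j0 else ordS j0)).
by have := lead_next nextLK alt V rs ni lead _ h; case: (o) => /=; apply.
Qed.

Lemma lead_all_B i0 j0 o : ((inr j0, false), (inl i0, o)) \in sh.1 ->
  forall j, exists i, ((inr j, false), (inl i, o)) \in sh.1.
Proof.
move=> h j; have : fconnect (@ordS q) j0 j.
  by rewrite (fconnect_cycle (fcycle_ordS q)) ?mem_enum.
case/connectP => s; elim: s i0 j0 h => [|i1 s IH] i0 j0 h /=; first by move=> _ ->; exists i0.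
case/andP => /eqP <-; apply: (IH (if o then ord_pred i0 else ordS i0)).
by have := lead_next nextLK alt V rs ni lead _ h; case: (o) => /=; apply.
Qed.

Lemma lead_swap k l o : l != k -> ((k, false), (l, o)) \in sh.1 -> ((l, false), (k, o)) \in sh.1.
Proof.
move=> lk h; case: o h => h; last exact: (valid_sym V h).
exact: (valid_sym V (lead_flip nextLK alt V rs ni lead lk h)).
Qed.

(** A class that meets both sides is a pair of one block of each word, and
    the ends of one are tied to the ends of the other. *)
Lemma lead_crossing : ~~ splits sideA sh ->
  exists i j o, ((inl i, false), (inr j, o)) \in sh.1.
Proof.
case/forall_inPn => -[a b] ab; rewrite /= !inE => nab.
have [i [j ij]] : exists i j, (inl i, inr j) \in sh.2.
  case: a b ab nab => i [] j // ab _; first by exists i, j.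
  by exists j, i; apply: (valid_rsym V ab).
have [[l c] lk h] := mate V (inl i, false).
exists i, j, c; rewrite -(lead_rho nextLK alt V rs ni lead (valid_fine V h) ij) //.
exact: (lead_neq nextLK alt V rs ni lead h lk).
Qed.

(** By [lead_next] a single crossing pair propagates around both circles, so
    that every block of either word has a unique partner in the other. *)
Lemma lead_same_length : ~~ splits sideA sh -> p = q.
Proof.
case/lead_crossing => i0 [j0 [b h0]].
have [g hg] := fin_all_exists (lead_all_A h0).
have [g' hg'] := fin_all_exists (lead_all_B (@lead_swap (inl i0) (inr j0) _ isT h0)).
have gi : injective g.
  move=> i i' e; have h := valid_sym V (hg i); have h' := valid_sym V (hg i'); rewrite -e in h'.
  by case: (lead_tau nextLK alt V rs ni lead h h' isT isT).
have gi' : injective g'.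
  move=> i i' e; have h := valid_sym V (hg' i); have h' := valid_sym V (hg' i'); rewrite -e in h'.
  by case: (lead_tau nextLK alt V rs ni lead h h' isT isT).
have := leq_card g gi; have := leq_card g' gi'; rewrite !card_ord => h1 h2.
by apply/eqP; rewrite eqn_leq h1 h2.
Qed.

End Word.

Section CycIdx.
Variables (p : nat) (p0 : (0 < p)%N).

Lemma val_cyc (z : int) : (val (cyc_idx p0 z))%:Z = ((z - 1) %% p%:Z)%Z.
Proof. by rewrite /= gez0_abs // modz_ge0 // eqz_nat -lt0n. Qed.

Lemma cyc_eq (z z' : int) : (cyc_idx p0 z == cyc_idx p0 z') = (z == z' %[mod p])%Z.
Proof. by rewrite -val_eqE -eqz_nat !val_cyc eqz_modDr. Qed.

Lemma ordS_cyc (z : int) : ordS (cyc_idx p0 z) = cyc_idx p0 (z + 1).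
Proof.
apply/val_inj/eqP; rewrite -eqz_nat val_cyc /= -modz_nat -[in X in X == _]addn1 PoszD val_cyc.
by rewrite modzDml subrK addrK.
Qed.

Lemma cyc_ord (i : 'I_p) : cyc_idx p0 i.+1%:Z = i.
Proof.
by apply/val_inj/eqP; rewrite -eqz_nat val_cyc -addn1 PoszD addrK modz_small // ltz_nat ltn_ord.
Qed.

Lemma ord_pred_cyc (z : int) : ord_pred (cyc_idx p0 z) = cyc_idx p0 (z - 1).
Proof. by apply: (can_inj (@ordSK p)); rewrite ord_predK ordS_cyc subrK. Qed.

(** The block [k - i] or [k + i] of the second word, with indices modulo
    [p]. *)
Definition partner (o : bool) (k i : 'I_p) : 'I_p :=
  cyc_idx p0 (if o then k%:Z - i.+1%:Z else k%:Z + i.+1%:Z).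

Lemma partnerS o k i : partner o k (ordS i) =
  if o then ord_pred (partner o k i) else ordS (partner o k i).
Proof.
have iS : (val (ordS i)).+1%:Z = i.+1%:Z + 1 %[mod p]%Z.
  by rewrite /= -[(_ %% _)%N.+1]addn1 PoszD -modz_nat modzDml.
rewrite /partner; case: o; rewrite ?ord_pred_cyc ?ordS_cyc; apply/eqP; rewrite cyc_eq.
  by rewrite -addrA eqz_modDl -opprD -modzNm iS modzNm.
by rewrite -addrA eqz_modDl iS.
Qed.

Lemma partner_inj o i : injective (fun k => partner o k i).
Proof.
move=> k k' /eqP; rewrite /partner cyc_eq; case: o; rewrite eqz_modDr => /eqP;
by rewrite !modz_small ?ltz_nat ?ltn_ord // => -[] /val_inj.
Qed.

Lemma partner_injr o k : injective (partner o k).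
Proof.
move=> i i' /eqP; rewrite /partner cyc_eq; case: o; rewrite eqz_modDl.
  move=> /eqP h; rewrite -(cyc_ord i) -(cyc_ord i'); apply/eqP; rewrite cyc_eq.
  by rewrite -[i.+1%:Z]opprK -modzNm h modzNm opprK.
by move=> h; rewrite -(cyc_ord i) -(cyc_ord i'); apply/eqP; rewrite cyc_eq.
Qed.

Lemma partner_onto o i j : exists k, partner o k i = j.
Proof. by have [g _ gK] := injF_bij (@partner_inj o i); exists (g j). Qed.

Let L : finType := ('I_p + 'I_p)%type.

Definition spoke_label (o : bool) (k : 'I_p) (a : L) : 'I_p :=
  match a with inl i => partner o k i | inr j => j end.

Definition spoke (o : bool) (k : 'I_p) : shadow L :=
  oriented [set ab | spoke_label o k ab.1 == spoke_label o k ab.2] o.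

Lemma spoke_tau o k i : ((inl i, false), (inr (partner o k i), o)) \in (spoke o k).1.
Proof. by rewrite !inE /= eqxx /=. Qed.

Lemma spoke_inj : injective (fun ok => spoke ok.1 ok.2).
Proof.
move=> [ o k] [ o' k'] /= e; pose i0 := Ordinal p0.
have := spoke_tau o k i0; rewrite e !inE /= => /andP[/eqP e1 /eqP e2].
by rewrite -e2 in e1 *; rewrite (partner_inj e1).
Qed.

Lemma spoke_crosses o k : ~~ splits (sideA p p) (spoke o k).
Proof.
pose i0 := Ordinal p0.
apply/forall_inPn; exists (inl i0, inr (partner o k i0)); first by rewrite !inE /= eqxx.
by rewrite /= !inE.
Qed.

Let side (a : L) : bool := if a is inl _ then true else false.

(** The fibres of [spoke_label] are pairs with one element on each side. *)
Lemma spoke_neq o k a b : spoke_label o k a = spoke_label o k b ->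
  (a != b) = side a (+) side b.
Proof.
case: a b => i [] j //= e; last by rewrite e eqxx.
by rewrite (partner_injr e) eqxx.
Qed.

Lemma spoke_other o k a : exists2 b, b != a & spoke_label o k a = spoke_label o k b.
Proof.
case: a => [i|j]; first by exists (inr (partner o k i)).
have [g _ gK] := injF_bij (@partner_injr o k).
by exists (inl (g j)); rewrite //= gK.
Qed.

Lemma in_spoke o k u v : ((u, v) \in (spoke o k).1) =
  (spoke_label o k u.1 == spoke_label o k v.1) &&
  (u.2 (+) v.2 == (side u.1 (+) side v.1) && o).
Proof. by rewrite !inE /=; case: eqP => //= /spoke_neq ->. Qed.

Lemma spoke_not_lone o k a : ~~ lone (spoke o k) a.
Proof.
apply/forallPn; have [b ba ab] := spoke_other o k a.
by exists b; rewrite !inE /= ab eqxx.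
Qed.

Lemma spoke_valid o k : valid [set: L] (spoke o k).
Proof.
split=> [u v|u _|u v|u v w|u _|a b|a _|a b|a b c|u v]; rewrite ?in_spoke ?inE //=.
- by rewrite !eqxx !addbb.
- by move=> /andP[/eqP -> /eqP h]; rewrite eqxx /= addbC h [side _ (+) _]addbC.
- move=> /andP[/eqP -> /eqP h2] /andP[/eqP -> /eqP h4]; rewrite eqxx /=.
  move: h2 h4; case: (side u.1); case: (side v.1); case: (side w.1);
  by case: o; case: (u.2); case: (v.2); case: (w.2).
- have [b bu ub] := spoke_other o k u.1; exists (b, u.2 (+) o).
    by apply: contraNneq bu => <-.
  by rewrite in_spoke /= ub eqxx -(spoke_neq ub) [u.1 == _]eq_sym bu addbA addbb eqxx.
- by move=> /eqP ->.
- by move=> /eqP -> /eqP ->.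
by move=> /andP[/eqP ->].
Qed.

End CycIdx.

Section Spokes.
Variables (p : nat) (p0 : (0 < p)%N).
Let L : finType := ('I_p + 'I_p)%type.
Local Notation next := (@nextL p p).
Local Notation label := (spoke_label p0).

Lemma spoke_respects o k : respects (label o k) (spoke p0 o k).
Proof. by apply/forall_inP => -[a b]; rewrite inE. Qed.

Lemma spoke_class o k i :
  colour_class (label o k) (partner p0 o k i) = [set (inl i : L); inr (partner p0 o k i)]%SET.
Proof.
apply/setP => -[i'|j]; rewrite !inE //=.
by rewrite orbF (inj_eq (@partner_injr _ _ _ _)) (inj_eq (@inl_inj _ _)).
Qed.

Lemma spoke_restr o k i : let S := [set (inl i : L); inr (partner p0 o k i)]%SET in
  sh_restr (label o k) (partner p0 o k i) (spoke p0 o k) = oriented (finset.setX S S) o.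
Proof.
move=> S; have inS a : (a \in S) = (label o k a == partner p0 o k i).
  by rewrite /S -spoke_class inE.
clearbody S; congr (_, _); apply/setP => -[u v]; rewrite !inE /= !inS.
  by rewrite -andbA [X in _ && X]andbC andbA; congr (_ && _); rewrite andbC;
    case: eqP => //= ->; rewrite eq_sym.
by rewrite andbC; case: eqP => //= ->; rewrite eq_sym.
Qed.

(** The function [G], which follows an index from one word to the other, is
    constant along ties and takes [p] values. *)
Lemma spoke_index_classes o k : (p <= n_comp (index_rel next (spoke p0 o k)) L)%N.
Proof.
pose G (a : L) := if a is inl i then (if o then ordS (partner p0 o k i) else partner p0 o k i)
  else label o k a.
have GE a b : index_rel next (spoke p0 o k) a b -> G a = G b.
  case/index_relP => -[x c] [[y c'] [+ <- <-]]; rewrite in_spoke /= /idx /G /=.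
  case: x y => i [] j /andP[/eqP /= e /eqP].
  - by rewrite (partner_injr e); case: c; case: c'.
  - rewrite /= -e; case: c; case: c'; case: (o) e => //= e _; rewrite ?partnerS ?ord_predK //.
  - rewrite /= e; case: c; case: c'; case: (o) e => //= e _; rewrite ?partnerS ?ord_predK //.
  - by rewrite e; case: c; case: c'.
have GC a b : connect (index_rel next (spoke p0 o k)) a b -> G a = G b.
  case/connectP => s; elim: s a => [a _ -> //|c s IH] a /= /andP[/GE -> sp]; exact: IH.
pose e0 : rel 'I_p := fun _ _ => false.
have ce0 i j : connect e0 i j = (i == j).
  apply/idP/eqP => [/connectP[[|? ?]] //=|->]; exact: connect0.
have se0 : connect_sym e0 by move=> i j; rewrite !ce0 eq_sym.
rewrite [leqLHS](_ : p = n_comp e0 'I_p); last first.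
  rewrite -[LHS]card_ord; apply: eq_card => i; rewrite !inE andbT.
  by have := connect_root e0 i; rewrite ce0 eq_sym.
apply: (@n_comp_le _ _ _ _ _ _ (fun j => inr j : L)) => //.
  exact: index_rel_sym (spoke_valid p0 o k).
by move=> i j _ _ /GC /= ->; apply: connect0.
Qed.

Variables (K : finType) (col : L -> K).
Hypothesis alt : forall k, col k != col (next k).
Variable sh : shadow L.
Hypotheses (V : valid [set: L] sh) (rs : respects col sh) (ni : forall k, ~~ lone sh k).
Hypothesis lead : excess next sh = 0.

(** A single crossing pair determines the sense and the rotation, and
    [lead_next] carries both around the circle. *)
Lemma lead_spoke : ~~ splits (sideA p p) sh -> exists o k, sh = spoke p0 o k.
Proof.
case/(lead_crossing alt V rs ni lead) => i0 [j0 [b h0]].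
have [k kE] := partner_onto p0 b i0 j0.
exists b, k.
have h i : ((inl i : L, false), (inr (partner p0 b k i) : L, b)) \in sh.1.
  have : fconnect (@ordS p) i0 i by rewrite (fconnect_cycle (fcycle_ordS p)) ?mem_enum.
  rewrite -{j0}kE in h0.
  case/connectP => s; elim: s i0 h0 => [|i1 s IH] i1' h1 /=; first by move=> _ ->.
  case/andP => /eqP <-; apply: IH; rewrite partnerS.
  by have := lead_next (@nextLK p p) alt V rs ni lead _ h1; case: (b) => /=; apply.
have pairs a c : a != c -> label b k a = label b k c -> ((a, false), (c, b)) \in sh.1.
  case: a c => i [] j //= ne e.
  - by rewrite (partner_injr e) eqxx in ne.
  - by rewrite -e.
  - by rewrite e; apply: (lead_swap alt V rs ni lead _ (h j)).
  - by rewrite e eqxx in ne.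
have pairs' u c : u.1 != c -> label b k u.1 = label b k c -> (u, (c, u.2 (+) b)) \in sh.1.
  case: u => a [] /= ne e; last exact: pairs.
  have := pairs _ _ ne e; rewrite eq_sym in ne.
  exact: (lead_flip (@nextLK p p) alt V rs ni lead ne).
have rhoE a c : ((a, c) \in sh.2) = (label b k a == label b k c).
  apply/idP/eqP => [ac|e].
    have [-> //|ne] := eqVneq a c.
    have [c' c'a e] := spoke_other p0 b k a.
    rewrite e; congr (label _ _ _); apply: (lead_rho (@nextLK p p) alt V rs ni lead _ ac c'a).
      by apply: (valid_fine V (u := (a, false)) (v := (c', b))); apply: pairs e; rewrite eq_sym.
    by rewrite eq_sym.
  have [->|ne] := eqVneq a c; first by apply: (valid_rrefl V); rewrite inE.
  exact: (valid_fine V (pairs _ _ ne e)).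
rewrite [LHS]surjective_pairing; congr (_, _); apply/setP => -[u v]; rewrite ?inE //=.
apply/idP/andP => [uv|[/eqP e]].
  have e : label b k u.1 = label b k v.1 by apply/eqP; rewrite -rhoE; apply: (valid_fine V uv).
  rewrite e eqxx; split=> //; have [uE|ne] := eqVneq u.1 v.1.
    have [-> |vu] := eqVneq v u; first by rewrite addbb.
    by have := lead_neq (@nextLK p p) alt V rs ni lead uv vu; rewrite uE eqxx.
  have h1 := pairs' _ _ ne e.
  have ne1 : v != u by apply: contraNneq ne => ->.
  have ne2 : (v.1, u.2 (+) b) != u by apply: contraNneq ne => <-.
  by rewrite (lead_tau (@nextLK p p) alt V rs ni lead uv h1 ne1 ne2) /= addbA addbb.
have [uE|ne] := eqVneq u.1 v.1 => /eqP /= h1.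
  have -> : v = u; last by apply: (valid_refl V); rewrite inE.
  by case: u v uE h1 {e} => a [] [c []] /= -> .
have -> : v = (v.1, u.2 (+) b) by rewrite -h1 addbA addbb -surjective_pairing.
exact: pairs'.
Qed.

End Spokes.

(** * The covariance of two centred words *)

Lemma word_trace (F : fieldType) (N p : nat) (M : 'I_p -> 'M[F]_N) : (0 < N)%N -> (0 < p)%N ->
  \tr (\prod_(k < p) M k) =
  \sum_(g : {ffun 'I_p -> 'I_N}) \prod_(k < p) M k (g k) (g (ordS k)).
Proof.
move=> N0 p0; pose i0 := Ordinal N0.
have ne : enum 'I_p != [::] by rewrite -size_eq0 size_enum_ord -lt0n.
have := tr_cycle M i0 (enum_uniq 'I_p) (fcycle_ordS p) ne.
rewrite !enum_index_enum => ->; apply: eq_bigl => g; rewrite inE.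
by apply/forallP => x; apply/implyP => /negP[]; apply: mem_index_enum.
Qed.

Section Covariance.
Variables (R : realType) (d : nat -> measure_display)
    (T : forall N : nat, measurableType (d N)) (P : forall N : nat, probability (T N) R)
    (p q : nat).
Hypotheses (hp : (0 < p)%N) (hq : (0 < q)%N).
Let L : finType := ('I_p + 'I_q)%type.
Variables (A : forall N : nat, L -> T N -> 'M[R[i]]_N)
    (W : {set L} -> nat -> shadow L -> R[i]).
Hypothesis HW : weights P A [set: L] W.
Variable N : nat.
Hypothesis N0 : (0 < N)%N.
Hypothesis intA : forall (S : {set L}) (phi : L * bool -> 'I_N),
  cintegrable (P N) (fun w => \prod_(k in S) A k w (phi (k, false)) (phi (k, true))).

Local Notation ctr := (fun phi r w =>
  \prod_(k <- r) centered (P N) (A k) w (phi (k, false)) (phi (k, true))).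

Lemma centered_product (r : seq L) (phi : L * bool -> 'I_N) : uniq r ->
  cintegrable (P N) (ctr phi r) /\ cexp (P N) (ctr phi r) =
  \sum_(sh | all (fun k => ~~ lone sh k) r) W [set k in r] N sh * (compat phi sh)%:R.
Proof.
move=> ur; have [|h1 h2] := @centered_moment _ _ _ _ _ _ _ HW _ N0 intA r finset.set0 phi ur.
  by move=> k; rewrite inE.
have E : (fun w => (\prod_(k in finset.set0) A k w (phi (k, false)) (phi (k, true))) *
     ctr phi r w) = ctr phi r.
  by apply/funext => w; rewrite big_set0 mul1r.
by rewrite E in h1 h2; split=> //; rewrite h2 finset.set0U.
Qed.

Let rA : seq L := [seq inl i | i <- enum 'I_p].
Let rB : seq L := [seq inr i | i <- enum 'I_q].

Let urA : uniq rA. Proof. by rewrite map_inj_uniq ?enum_uniq // => ? ? []. Qed.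
Let urB : uniq rB. Proof. by rewrite map_inj_uniq ?enum_uniq // => ? ? []. Qed.
Let inA k : (k \in rA) = (k \in sideA p q).
Proof.
rewrite inE; case: k => [i|j]; first by rewrite mem_map ?mem_enum // => ? ? [].
by apply/negP => /mapP[].
Qed.
Let inB k : (k \in rB) = (k \notin sideA p q).
Proof.
rewrite inE; case: k => [i|j]; last by rewrite mem_map ?mem_enum // => ? ? [].
by apply/negP => /mapP[].
Qed.

Definition crossing (sh : shadow L) : bool :=
  [forall k, ~~ lone sh k] && ~~ splits (sideA p q) sh.

(** The product of the two expectations is the part of the expansion over
    the shadows that do not join the two words. *)
Lemma cov_product (phi : L * bool -> 'I_N) :
  cexp (P N) (fun w => ctr phi rA w * ctr phi rB w)
    - cexp (P N) (ctr phi rA) * cexp (P N) (ctr phi rB) =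
  \sum_(sh | crossing sh) W [set: L] N sh * (compat phi sh)%:R.
Proof.
have uAB : uniq (rA ++ rB).
  rewrite cat_uniq urA urB andbT /=; apply/hasPn => k; rewrite inB => kB.
  by apply: contra kB; rewrite -inA.
have [_ eAB] := centered_product phi uAB.
have [_ eA] := centered_product phi urA; have [_ eB] := centered_product phi urB.
set SA := [set k in rA]%SET in eA; set SB := [set k in rB]%SET in eB.
have SAB : SA :|: SB = [set: L]%SET.
  by apply/setP => k; rewrite !inE inA inB orbN.
have dis : [disjoint SA & SB].
  rewrite -finset.setI_eq0; apply/eqP/setP => k; rewrite !inE inA inB.
  by rewrite andbN.
have SAE : SA = sideA p q by apply/setP => k; rewrite inE inA.
rewrite (eq_cexp _ (W := ctr phi (rA ++ rB))); last by move=> w; rewrite big_cat.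
rewrite eAB eA eB.
have -> : [set k in rA ++ rB]%SET = [set: L]%SET.
  by apply/setP => k; rewrite !inE mem_cat inA inB orbN.
have allE (r : seq L) (H : shadow L -> R[i]) (S : {set L}) : S \subset [set: L]%SET ->
    \sum_(sh | all (fun k => ~~ lone sh k) r) W S N sh * H sh =
    \sum_(sh | `[< valid S sh >]) W S N sh * ((all (fun k => ~~ lone sh k) r)%:R * H sh).
  move=> ST; rewrite -(sum_valid HW) big_mkcond; apply: eq_bigr => sh _.
  by case: (all _ r); rewrite ?mul1r // mul0r mulr0.
pose H sh : R[i] := (all (fun k => ~~ lone sh k) (rA ++ rB))%:R * (compat phi sh)%:R.
have -> : (\sum_(sh | all (fun k => ~~ lone sh k) rA) W SA N sh * (compat phi sh)%:R) *
   (\sum_(sh | all (fun k => ~~ lone sh k) rB) W SB N sh * (compat phi sh)%:R) =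
   \sum_(sh | `[< valid [set: L] sh >] && splits SA sh) W [set: L] N sh * H sh.
  rewrite !allE ?finset.subsetT // -SAB sum_split // mulr_suml.
  apply: eq_bigr => a /asboolP Va; rewrite mulr_sumr; apply: eq_bigr => b /asboolP Vb.
  rewrite (weights_split HW) ?finset.subsetT // /H compat_shadowU all_cat.
  rewrite (@eq_in_all _ (fun k => ~~ lone (shadowU a b) k) (fun k => ~~ lone a k) rA); last first.
    move=> k; rewrite inA => kA; congr (~~ _); apply: eq_forallb => l; rewrite inE.
    case: (boolP (_ \in b.2)) => [h|_]; last by rewrite orbF.
    by have := valid_rin Vb h; rewrite inE inB kA.
  rewrite (@eq_in_all _ (fun k => ~~ lone (shadowU a b) k) (fun k => ~~ lone b k) rB); last first.
    by move=> k; rewrite inB -SAE => kB; rewrite (lone_shadowUr _ _ Va).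
  by rewrite -!mulnb !natrM mulrACA [X in _ * X]mulrACA.
rewrite allE ?finset.subsetT // -/H (bigID (splits SA)) /= addrAC subrr add0r.
rewrite big_mkcond /= [RHS]big_mkcond; apply: eq_bigr => sh _.
rewrite /crossing -SAE; have [V|nV] := asboolP (valid [set: L] sh); last first.
  have [->|/(weights_valid HW (finset.subsetT _)) //] := eqVneq (W [set: L] N sh) 0.
  by rewrite /= !mul0r; case: (_ && _).
have -> : all (fun k => ~~ lone sh k) (rA ++ rB) = [forall k, ~~ lone sh k].
  apply/allP/forallP => [h k|h k _ //]; apply: h.
  by rewrite mem_cat inA inB orbN.
rewrite /=; case: (splits SA sh); rewrite ?andbF ?andbT //=.
by case: [forall k, _]; rewrite ?mul1r // mul0r mulr0.
Qed.

Let glue (g : 'I_p -> 'I_N) (h : 'I_q -> 'I_N) (k : L) : 'I_N :=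
  match k with inl i => g i | inr j => h j end.
Let ends g h (u : L * bool) := glue g h (idx (@nextL p q) u).

(** The ties of ends become ties of indices; each class of indices is free. *)
Lemma count_maps (sh : shadow L) : valid [set: L] sh ->
  \sum_(g : {ffun 'I_p -> 'I_N}) \sum_(h : {ffun 'I_q -> 'I_N})
     (compat (ends g h) sh)%:R = N%:R ^+ n_comp (index_rel (@nextL p q) sh) L :> R[i].
Proof.
move=> V; rewrite pair_big /=.
pose up (gh : {ffun 'I_p -> 'I_N} * {ffun 'I_q -> 'I_N}) := [ffun k => glue gh.1 gh.2 k].
pose dn (psi : {ffun L -> 'I_N}) :=
  ([ffun i => psi (inl i : L)] : {ffun 'I_p -> 'I_N}, [ffun j => psi (inr j : L)] : {ffun 'I_q -> 'I_N}).
have dnK : cancel dn up by move=> psi; apply/ffunP => -[i|j]; rewrite !ffunE /= ffunE.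
have upK : cancel up dn by move=> [g h]; congr (_, _); apply/ffunP => i; rewrite !ffunE.
rewrite (reindex dn) /=; last by exists up => ? _; [apply: dnK|apply: upK].
have := @card_class_maps L _ pred0 N (fun=> Ordinal N0) (index_rel_sym (@nextL p q) V) N0.
case: ifP => [_|/negP[]]; last by apply/forallP => x; rewrite inE.
rewrite (eq_n_comp_r (a' := L)); last first.
  by move=> x; rewrite !inE; apply/forallP => y; rewrite inE.
rewrite -natrX => <-; rewrite -sum1_card natr_sum [RHS]big_mkcond; apply: eq_bigr => psi _.
set b := psi \in _.
have {b} -> : b = [forall x, forall y, index_rel (@nextL p q) sh x y ==> (psi x == psi y)].
  by rewrite /b inE andbT.
suff -> : compat (ends (dn psi).1 (dn psi).2) sh =
  [forall x, forall y, index_rel (@nextL p q) sh x y ==> (psi x == psi y)] by case: [forall x, _].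
have E u : ends (dn psi).1 (dn psi).2 u = psi (idx (@nextL p q) u).
  by rewrite /ends /glue; case: (idx _ u) => x; rewrite ffunE.
apply/forall_inP/forallP => [h x|h [u v] uv].
  apply/forallP => y; apply/implyP => /index_relP[u [v [uv <- <-]]].
  by have := h _ uv; rewrite !E.
rewrite !E; have /forallP/(_ (idx (@nextL p q) v))/implyP := h (idx (@nextL p q) u).
by apply; apply/index_relP; exists u, v.
Qed.

Lemma cov_expansion :
  k2 (P N) (centered_trace (P N) (fun i : 'I_p => A (inl i : L)))
           (centered_trace (P N) (fun j : 'I_q => A (inr j : L))) =
  \sum_(sh | crossing sh) W [set: L] N sh * N%:R ^+ n_comp (index_rel (@nextL p q) sh) L.
Proof.
pose h0 : 'I_q -> 'I_N := fun=> Ordinal N0; pose g0 : 'I_p -> 'I_N := fun=> Ordinal N0.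
have EA h w : centered_trace (P N) (fun i : 'I_p => A (inl i : L)) w =
    \sum_(g : {ffun 'I_p -> 'I_N}) ctr (ends g h) rA w.
  rewrite /centered_trace word_trace //; apply: eq_bigr => g _.
  by rewrite big_map enum_index_enum.
have EB g w : centered_trace (P N) (fun j : 'I_q => A (inr j : L)) w =
    \sum_(h : {ffun 'I_q -> 'I_N}) ctr (ends g h) rB w.
  rewrite /centered_trace word_trace //; apply: eq_bigr => h _.
  by rewrite big_map enum_index_enum.
have ctrA g h h' w : ctr (ends g h) rA w = ctr (ends g h') rA w by rewrite !big_map.
have ctrB g g' h w : ctr (ends g h) rB w = ctr (ends g' h) rB w by rewrite !big_map.
have iAB g h : cintegrable (P N) (fun w => ctr (ends g h) rA w * ctr (ends g h) rB w).
  have uAB : uniq (rA ++ rB).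
    rewrite cat_uniq urA urB andbT /=; apply/hasPn => k; rewrite inB => kB.
    by apply: contra kB; rewrite -inA.
  have [h1 _] := centered_product (ends g h) uAB; move: h1; congr cintegrable.
  by apply/funext => w; rewrite big_cat.
rewrite /k2.
have -> : (fun w => centered_trace (P N) (fun i : 'I_p => A (inl i : L)) w *
   centered_trace (P N) (fun j : 'I_q => A (inr j : L)) w) =
   (fun w => \sum_(g : {ffun 'I_p -> 'I_N}) \sum_(h : {ffun 'I_q -> 'I_N})
     ctr (ends g h) rA w * ctr (ends g h) rB w).
  apply/funext => w; rewrite (EA h0) mulr_suml; apply: eq_bigr => g _.
  by rewrite (EB g) mulr_sumr; apply: eq_bigr => h _; rewrite (ctrA g h0 h).
rewrite cexp_sum; last by move=> g _; apply: cintegrable_sum => h _; apply: iAB.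
rewrite (eq_cexp _ (EA h0)) (eq_cexp _ (EB g0)).
rewrite [cexp _ (fun w => \sum_(g : {ffun 'I_p -> 'I_N}) ctr (ends g h0) rA w)]cexp_sum; last first.
  by move=> g _; have [] := centered_product (ends g h0) urA.
rewrite [cexp _ (fun w => \sum_(h : {ffun 'I_q -> 'I_N}) ctr (ends g0 h) rB w)]cexp_sum; last first.
  by move=> h _; have [] := centered_product (ends g0 h) urB.
rewrite mulr_suml -sumrB.
rewrite (eq_bigr (fun g : {ffun 'I_p -> 'I_N} => \sum_(h : {ffun 'I_q -> 'I_N})
   \sum_(sh | crossing sh) W [set: L] N sh * (compat (ends g h) sh)%:R)); last first.
  move=> g _; rewrite cexp_sum // mulr_sumr -sumrB; apply: eq_bigr => h _.
  by rewrite -cov_product; congr (_ - _ * _); apply: eq_cexp => w; [apply: ctrA|apply: ctrB].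
under eq_bigr do rewrite exchange_big.
rewrite exchange_big; apply: eq_bigr => sh _.
under eq_bigr do rewrite -mulr_sumr.
rewrite -mulr_sumr; have [->|/(weights_valid HW (finset.subsetT _)) V] := eqVneq (W [set: L] N sh) 0.
  by rewrite !mul0r.
by rewrite count_maps.
Qed.

End Covariance.

(** * The limit of the covariance *)

Lemma powN_lt0 (R : realType) (z : int) : z < 0 ->
  ccvg_to (fun N => (N%:R : R[i]) ^ z) 0.
Proof. by move=> z0; have := @powN_le0 R _ (ltW z0); rewrite lt_eqF. Qed.

Lemma n_comp_gt0 (T : finType) (e : rel T) (S : {pred T}) x :
  connect_sym e -> fingraph.closed e S -> x \in S -> (0 < n_comp e S)%N.
Proof.
move=> se cl xS; rewrite /n_comp_mem; apply/card_gt0P; exists (fingraph.root e x).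
apply/andP; split; first exact: roots_root.
by rewrite /= -(closed_connect cl (connect_root e x)).
Qed.

Lemma n_comp_one (T : finType) (e : rel T) (S : {pred T}) x :
  connect_sym e -> fingraph.closed e S -> x \in S -> {in S, forall y, connect e x y} ->
  n_comp e S = 1%N.
Proof.
move=> se cl xS h; rewrite -(n_comp_connect se x); apply: eq_n_comp_r => y.
apply/idP/idP => [/h //|xy]; by rewrite -(closed_connect cl xy).
Qed.

Section Pair.
Variables (L : finType) (x y : L) (o : bool).
Hypothesis xy : x != y.
Let S : {set L} := [set x; y]%SET.

Definition pair_shadow : shadow L := oriented (finset.setX S S) o.

Let side (u : L * bool) : bool := u.2 (+) ((u.1 == y) && o).

Let inS k : (k \in S) = (k == x) || (k == y). Proof. by rewrite !inE. Qed.

Let yx : (x == y) = false. Proof. exact: negbTE. Qed.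

Let sideE u v : u.1 \in S -> v.1 \in S ->
  (side u == side v) = (u.2 (+) v.2 == (u.1 != v.1) && o).
Proof.
case: u v => a b [c b']; rewrite /side /= !inS => /orP[] /eqP -> /orP[] /eqP ->;
by rewrite ?eqxx ?[y == x]eq_sym ?yx /=; case: b; case: b'; case: (o).
Qed.

Let rhoE k l : ((k, l) \in pair_shadow.2) = (k \in S) && (l \in S).
Proof. by rewrite finset.in_setX. Qed.

Let tauE u v : ((u, v) \in pair_shadow.1) = [&& u.1 \in S, v.1 \in S & side u == side v].
Proof.
rewrite finset.inE finset.in_setX -andbA /=.
have [uS|//] := boolP (u.1 \in S); have [vS|//] := boolP (v.1 \in S).
by rewrite sideE.
Qed.

Lemma pair_shadowE (sh : shadow L) : valid S sh -> ~~ lone sh x ->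
  (sh == pair_shadow) = [forall uv in sh.1, side uv.1 == side uv.2].
Proof.
move=> V nx; have tS u v : (u, v) \in sh.1 -> (u.1 \in S) && (v.1 \in S).
  by move=> h; rewrite (valid_in V h) (valid_in V (valid_sym V h)).
apply/eqP/forall_inP => [-> [u v]|h].
  by rewrite tauE => /and3P[].
have xyr : (x, y) \in sh.2.
  have /forallPn[l] := nx; rewrite negb_imply => /andP[xl lx].
  have := valid_rin V (valid_rsym V xl); rewrite inS (negPf lx) => /eqP ly.
  by rewrite -ly.
rewrite [LHS]surjective_pairing; congr (_, _); apply/setP => -[u v]; last first.
  rewrite rhoE; apply/idP/andP => [uv|].
    by rewrite (valid_rin V uv) (valid_rin V (valid_rsym V uv)).
  rewrite !inS => -[] /orP[] /eqP uE /orP[] /eqP vE; rewrite uE vE ?xyr ?(valid_rsym V xyr) //;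
    by apply: (valid_rrefl V); rewrite inS eqxx ?orbT.
rewrite tauE; apply/idP/and3P => [uv|[uS vS /eqP suv]].
  by have /andP[uS vS] := tS _ _ uv; rewrite uS vS (h _ uv).
have [uvE|ne] := eqVneq u.1 v.1.
  suff -> : v = u by apply: (valid_refl V).
  move: suv uvE; rewrite /side; case: u v {uS vS} => a b [c b'] /= + ac; rewrite ac.
  by move=> /addIb ->.
have [u' u'u uu'] := valid_mate V uS; have /andP[_ u'S] := tS _ _ uu'.
have /eqP /= su := h _ uu'.
suff -> : v = u' by [].
have ne' : u'.1 != u.1.
  apply: contra u'u => /eqP e; move: su e; rewrite /side; case: u u' {uS u'S uu' suv ne} => a b [c b'] /= + ca.
  by rewrite ca => /addIb ->.
have l1 : u'.1 = v.1.
  move: uS vS u'S ne ne'; rewrite !inS => /orP[] /eqP -> /orP[] /eqP -> /orP[] /eqP ->;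
  by rewrite ?eqxx.
move: suv su; rewrite /side; case: v u' l1 {u'u uu' ne ne' u'S vS} => a b [c b'] /= -> -> .
by move=> /addIb ->.
Qed.

Lemma pair_count (F : nzRingType) (N : nat) (sh : shadow L) : valid S sh -> ~~ lone sh x ->
  \sum_(a < N) \sum_(b < N) (compat (fun u => if side u then b else a) sh)%:R =
  (if sh == pair_shadow then N%:R * N%:R else N%:R) :> F.
Proof.
move=> V nx; rewrite (pair_shadowE V nx); case: ifP => [/forall_inP h|/negbT/forall_inPn[[u v] uv ne]].
  rewrite (eq_bigr (fun=> N%:R)); first by rewrite sumr_const card_ord -[_ *+ N]mulr_natr.
  move=> a _.
  rewrite (eq_bigr (fun=> 1)) ?sumr_const ?card_ord // => b _.
  rewrite (_ : compat _ _ = true) //; apply/forall_inP => uv /h /eqP ->; exact: eqxx.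
rewrite (eq_bigr (fun=> 1)) ?sumr_const ?card_ord // => a _.
rewrite (bigD1 a) //= big1 ?addr0 => [|b ba].
  rewrite (_ : compat _ _ = true) //; apply/forall_inP => w _.
  by case: (side _); case: (side _).
rewrite (_ : compat _ _ = false) //; apply/negbTE/forall_inPn; exists (u, v) => //=.
by move: ne => /=; case: (side u); case: (side v) => //= _; rewrite // eq_sym.
Qed.

Lemma pair_shadow_valid : valid S pair_shadow.
Proof.
split=> [u v|u uS|u v|u v w|u uS|a b|a aS|a b|a b c|u v]; rewrite ?tauE ?rhoE.
- by case/and3P.
- by rewrite uS eqxx.
- by case/and3P => -> -> /eqP ->; rewrite eqxx.
- by case/and3P => -> _ /eqP -> /and3P[_ -> /eqP ->]; rewrite eqxx.
- pose l := if u.1 == x then y else x.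
  have lu : l != u.1 by rewrite /l; case: (u.1 =P x) => [->|/eqP]; rewrite eq_sym.
  have lS : l \in S by rewrite inS /l; case: ifP; rewrite eqxx ?orbT.
  exists (l, u.2 (+) o); first by apply: contraNneq lu => <-.
  by rewrite tauE uS lS sideE //= [u.1 == _]eq_sym lu addbA addbb eqxx.
- by case/andP.
- by rewrite aS.
- by case/andP => -> ->.
- by case/andP => -> _ /andP[_ ->].
by case/and3P => -> ->.
Qed.

Lemma pair_nloops : nloops S pair_shadow = 1%N.
Proof.
have V := pair_shadow_valid.
have cl : fingraph.closed (label_rel pair_shadow) S.
  move=> a b /existsP[c /existsP[c' h]]; rewrite (valid_in V h).
  by rewrite (valid_in V (valid_sym V h)).
apply: (n_comp_one (label_rel_sym V) cl (x := x)); first by rewrite inS eqxx.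
move=> k; rewrite -[k \in mem S]/(k \in S) inS => /orP[] /eqP ->; first exact: connect0.
apply: connect1; apply/existsP; exists false; apply/existsP; exists o.
by rewrite tauE /= !inS !eqxx orbT /side /= yx eqxx; case: (o).
Qed.

End Pair.

Lemma pair_nclasses (L : finType) (x y : L) (sh : shadow L) :
  valid [set x; y]%SET sh -> ~~ lone sh x -> nclasses [set x; y]%SET sh = 1%N.
Proof.
move=> V nx.
have cl : fingraph.closed (class_rel sh) [set x; y]%SET.
  by move=> a b h; rewrite (valid_rin V h) (valid_rin V (valid_rsym V h)).
apply: (n_comp_one (class_rel_sym V) cl (x := x)); first by rewrite !inE eqxx.
move=> k; rewrite !inE => /orP[] /eqP ->; first exact: connect0.
have /forallPn[l] := nx; rewrite negb_imply => /andP[xl lx].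
have := valid_rin V (valid_rsym V xl); rewrite !inE (negPf lx) => /eqP ly.
by rewrite -ly; apply: connect1.
Qed.

Lemma nloops_gt0 (L : finType) (S : {set L}) (sh : shadow L) x :
  valid S sh -> x \in S -> (0 < nloops S sh)%N.
Proof.
move=> V; apply: n_comp_gt0; first exact: label_rel_sym V.
move=> a b /existsP[c /existsP[c' h]]; rewrite (valid_in V h).
by rewrite (valid_in V (valid_sym V h)).
Qed.

Section Limits.
Variables (L : finType) (R : realType) (d : nat -> measure_display)
    (T : forall N : nat, measurableType (d N)) (P : forall N : nat, probability (T N) R)
    (A : forall N : nat, L -> T N -> 'M[R[i]]_N)
    (W : {set L} -> nat -> shadow L -> R[i]).
Hypothesis HW : weights P A [set: L] W.
Hypothesis intA : forall N, (0 < N)%N -> forall (S : {set L}) (phi : L * bool -> 'I_N),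
  cintegrable (P N) (fun w => \prod_(k in S) A k w (phi (k, false)) (phi (k, true))).

Let subT (S : {set L}) : S \subset [set: L]. Proof. exact: finset.subsetT. Qed.

Section PairLimit.
Variables (x y : L) (o : bool).
Hypothesis xy : x != y.
Let S : {set L} := [set x; y]%SET.
Let cov N := tr_cov (P N) (A x) (fun t => sgn_mx (~~ o) (A y t)).

(** Centering one of two random variables is enough to get their covariance,
    so that [centered_moment] applies to the single block [x]. *)
Lemma pair_expansion N : (0 < N)%N -> cov N =
  \sum_(sh | ~~ lone sh x) W S N sh * (if sh == pair_shadow x y o then N%:R else 1).
Proof.
move=> N0; have N0' : N%:R != 0 :> R[i] by rewrite pnatr_eq0 -lt0n.
pose phi (a b : 'I_N) (u : L * bool) := if u.2 (+) ((u.1 == y) && o) then b else a.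
have phix a b : (phi a b (x, false) = a) * (phi a b (x, true) = b).
  by rewrite /phi /= (negPf xy).
pose my := cexp (P N) (fun w => ntr (A y w)); pose mx := cexp (P N) (fun w => ntr (A x w)).
pose Ay a b w := A y w (phi a b (y, false)) (phi a b (y, true)).
have moment := entry_moment HW N0 (intA N0).
have intk k a b : cintegrable (P N) (fun w => A k w a b).
  have := intA N0 [set k] (fun u => if u.2 then b else a); congr cintegrable.
  by apply/funext => w; rewrite big_set1.
have intxy a b : cintegrable (P N) (fun w => A x w a b * Ay a b w).
  have := intA N0 S (phi a b); congr cintegrable.
  apply/funext => w; rewrite big_setU1 /= ?inE // big_set1 !phix //.
have phiy a b : (phi a b (y, false) == phi a b (y, true)) = (a == b).
  by rewrite /phi /= eqxx; case: (o) => //=; rewrite eq_sym.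
have eAA w : ntr (A x w *m sgn_mx (~~ o) (A y w)) =
    N%:R^-1 * \sum_(a < N) \sum_(b < N) A x w a b * Ay a b w.
  rewrite /ntr /mxtrace; congr (_ * _); apply: eq_bigr => a _; rewrite mxE.
  apply: eq_bigr => b _; congr (_ * _).
  by rewrite /Ay /phi /= eqxx; case: (o) => //=; rewrite mxE.
have eY : cexp (P N) (fun w => ntr (sgn_mx (~~ o) (A y w))) = my.
  by apply: eq_cexp => w; rewrite /ntr; case: (o); rewrite //= mxtrace_tr.
rewrite /cov /tr_cov eY -/mx (eq_cexp _ eAA) cexpZ; last first.
  by do 2 (apply: cintegrable_sum => ? _); apply: intxy.
rewrite cexp_sum; last by move=> a _; apply: cintegrable_sum => b _; apply: intxy.
have -> : mx * my = N%:R^-1 * \sum_(a < N) \sum_(b < N) mx * (a == b)%:R * cexp (P N) (Ay a b).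
  rewrite (eq_bigr (fun=> mx * my)); last first.
    move=> a _; rewrite (bigD1 a) //= big1 ?addr0 => [|b ba].
      by rewrite eqxx mulr1 /Ay moment phiy eqxx mulr1.
    by rewrite eq_sym (negPf ba) mulr0 mul0r.
  by rewrite sumr_const card_ord -[(mx * my) *+ N]mulr_natl mulKf.
rewrite -mulrBr -sumrB.
have key a b : cexp (P N) (fun w => A x w a b * Ay a b w) -
   mx * (a == b)%:R * cexp (P N) (Ay a b) =
   \sum_(sh | ~~ lone sh x) W S N sh * (compat (phi a b) sh)%:R.
  have [|h1 h2] := @centered_moment _ _ _ _ _ _ _ HW _ N0 (intA N0) [:: x] [set y] (phi a b) isT.
    by move=> k; rewrite !inE => /eqP ->.
  have SE : [set y] :|: [set k in [:: x]]%SET = S by apply/setP => k; rewrite !inE orbC.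
  rewrite SE in h2; rewrite (eq_bigl (fun sh => all (fun k => ~~ lone sh k) [:: x])); last first.
    by move=> sh; rewrite /= andbT.
  rewrite -h2 -mulNr -cexpZ //; last exact: intk.
  rewrite -cexpD //; last by apply: cintegrableZ; exact: intk.
  apply: eq_cexp => w; rewrite big_set1 big_seq1 !phix /centered !mxE -/mx -/(Ay a b w).
  by rewrite -[mx *+ _]mulr_natr [RHS]mulrC mulrBl mulNr.
rewrite (eq_bigr (fun a => \sum_(sh | ~~ lone sh x) W S N sh *
    \sum_(b < N) (compat (phi a b) sh)%:R)); last first.
  move=> a _; rewrite cexp_sum // -sumrB.
  under eq_bigr do rewrite key.
  by rewrite exchange_big; apply: eq_bigr => sh _; rewrite mulr_sumr.
rewrite exchange_big mulr_sumr; apply: eq_bigr => sh nx.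
rewrite -mulr_sumr.
have [->|/(weights_valid HW (subT S)) V] := eqVneq (W S N sh) 0; first by rewrite !mul0r mulr0.
have := @pair_count L x y o xy R[i] N sh V nx; rewrite /phi => ->.
by rewrite mulrCA; congr (_ * _); case: ifP => _; rewrite ?mulrA mulVf ?mul1r.
Qed.

Lemma pair_weight_cvg : ccvg (fun N => N%:R * W S N (pair_shadow x y o)).
Proof.
have V := pair_shadow_valid o xy.
have nx : ~~ lone (pair_shadow x y o) x.
  by apply/forallPn; exists y; rewrite !inE /= !eqxx orbT /= eq_sym.
have := weights_limit HW (sh := pair_shadow x y o) (subT S).
rewrite (pair_nloops o xy) (pair_nclasses V nx) cards2 xy.
rewrite (_ : (fun N => _) = (fun N => N%:R * W S N (pair_shadow x y o))); first exact.
by apply/funext => N; congr (_ * _); rewrite -[RHS]expr1z; congr (_ ^ _).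
Qed.

(** Two free indices compensate the normalisation of the trace and leave a
    factor [N] for [pair_shadow].  The other shadows leave one free index and
    no factor, and their weights tend to 0, since a shadow has at least one
    class of tied blocks. *)
Lemma pair_limit : ccvg_to cov (clim (fun N => N%:R * W S N (pair_shadow x y o))).
Proof.
apply: (@ccvg_to_eventually _ (fun N => \sum_(sh | ~~ lone sh x) W S N sh *
   (if sh == pair_shadow x y o then N%:R else 1))).
  by move=> N N0; rewrite pair_expansion.
have nx : ~~ lone (pair_shadow x y o) x.
  by apply/forallPn; exists y; rewrite !inE /= !eqxx orbT /= eq_sym.
pose l sh : R[i] := if sh == pair_shadow x y o then
  clim (fun N => N%:R * W S N (pair_shadow x y o)) else 0.
have -> : clim (fun N => N%:R * W S N (pair_shadow x y o)) = \sum_(sh | ~~ lone sh x) l sh.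
  rewrite (bigD1 (pair_shadow x y o)) //= /l eqxx big1 ?addr0 // => sh /andP[_ /negPf ->] //.
apply: ccvg_to_sum => sh shx; rewrite /l; have [->|ne] := eqVneq sh (pair_shadow x y o).
  rewrite (_ : (fun N => _) = (fun N => N%:R * W S N (pair_shadow x y o))).
    exact/ccvgP/pair_weight_cvg.
  by apply/funext => N; rewrite mulrC.
have [V|nV] := pselect (valid S sh); last first.
  rewrite (_ : (fun N => _) = (fun=> 0)); first exact: ccvg_to_cst.
  apply/funext => N; have [->|/(weights_valid HW (subT S)) //] := eqVneq (W S N sh) 0.
  by rewrite mul0r.
have := weights_limit HW (sh := sh) (subT S); rewrite (pair_nclasses V shx) cards2 xy.
move=> /ccvgP h; have nl : (0 < nloops S sh)%N := nloops_gt0 V (setU11 x [set y]).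
have n0 : - (nloops S sh)%:Z < 0 by lia.
have h0 := ccvg_toM (@powN_lt0 R _ n0) h; rewrite mul0r in h0; move: h0.
apply: ccvg_to_eventually => N N0; have N0' : N%:R != 0 :> R[i] by rewrite pnatr_eq0 -lt0n.
by rewrite mulrA -expfzDr // mulr1 (_ : _ + _ = 0) ?expr0z ?mul1r //; lia.
Qed.

End PairLimit.

Lemma weights_empty N : (0 < N)%N -> W finset.set0 N (finset.set0, finset.set0) = 1.
Proof.
move=> N0; pose phi (u : L * bool) := Ordinal N0.
have := weights_moment HW phi N0 (subT finset.set0).
rewrite /block_moment (eq_cexp _ (W := fun=> 1)); last by move=> w; rewrite big_set0.
rewrite cexp_cst (bigD1 (finset.set0, finset.set0)) //= (_ : compat _ _ = true); last first.
  by apply/forall_inP => u; rewrite inE.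
rewrite mulr1 big1 ?addr0 // => sh ne.
have [->|/(weights_valid HW (subT _)) V] := eqVneq (W finset.set0 N sh) 0; first by rewrite mul0r.
case/eqP: ne; rewrite [LHS]surjective_pairing; congr (_, _); apply/setP => -[u v]; rewrite inE.
  by apply/negP => /(valid_in V); rewrite inE.
by apply/negP => /(valid_rin V); rewrite inE.
Qed.

(** [weights_split] iterated over the values of [g]. *)
Lemma weights_classes (K : finType) (g : L -> K) N sh : (0 < N)%N ->
  valid [set: L] sh -> respects g sh ->
  W [set: L] N sh = \prod_c W (colour_class g c) N (sh_restr g c sh).
Proof.
move=> N0 V rs.
have gE k l : (k, l) \in sh.2 -> g k = g l by move=> h; move/forall_inP: rs => /(_ _ h) /eqP.
pose mem_r (r : seq K) k := g k \in r.
have rr r : respects (mem_r r) sh.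
  by apply/forall_inP => -[k l] /gE /= e; rewrite /mem_r e.
have Vr r := valid_restr V (rr r) true; have Vc c := valid_restr V rs c.
have TI (B : {set L}) : [set: L] :&: B = B by apply/setP => k; rewrite !inE.
have main (r : seq K) : uniq r -> W (colour_class (mem_r r) true) N (sh_restr (mem_r r) true sh) =
    \prod_(c <- r) W (colour_class g c) N (sh_restr g c sh).
  elim: r => [_|c r IH /andP[cr ur]].
    rewrite big_nil -[RHS](weights_empty N0).
    have -> : colour_class (mem_r [::]) true = finset.set0 by apply/setP => k; rewrite !inE.
    congr (W _ _ _).
    by congr (_, _); apply/setP => -[u v]; rewrite !inE /mem_r /= andbF.
  rewrite big_cons -IH //.
  have := Vr r; have := Vc c; rewrite !TI => V1 V2.
  rewrite -(weights_split HW N0 (subT _) (subT _) _ V1 V2); last first.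
    rewrite -finset.setI_eq0; apply/eqP/setP => k; rewrite !inE /mem_r.
    by apply/negP => /andP[/eqP -> h]; rewrite eqb_id (negPf cr) in h.
  congr (W _ _ _); first by apply/setP => k; rewrite !inE /mem_r !eqb_id inE.
  by congr (_, _); apply/setP => -[u v]; rewrite !inE /mem_r /= !eqb_id inE andb_orr.
rewrite -(main _ (index_enum_uniq K)); congr (W _ _ _).
  by apply/setP => k; rewrite !inE /mem_r mem_index_enum.
rewrite [LHS]surjective_pairing; congr (_, _); apply/setP => -[u v];
  by rewrite inE /mem_r mem_index_enum andbT.
Qed.

End Limits.

Section CovarianceLimit.
Variables (R : realType) (d : nat -> measure_display)
    (T : forall N : nat, measurableType (d N)) (P : forall N : nat, probability (T N) R)
    (p q : nat).
Hypotheses (hp : (0 < p)%N) (hq : (0 < q)%N).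
Let L : finType := ('I_p + 'I_q)%type.
Variables (A : forall N : nat, L -> T N -> 'M[R[i]]_N)
    (W : {set L} -> nat -> shadow L -> R[i]).
Hypothesis HW : weights P A [set: L] W.
Hypothesis intA : forall N, (0 < N)%N -> forall (S : {set L}) (phi : L * bool -> 'I_N),
  cintegrable (P N) (fun w => \prod_(k in S) A k w (phi (k, false)) (phi (k, true))).
Variables (K : finType) (col : L -> K).
Hypothesis alt : forall k, col k != col (nextL k).
Hypothesis WE : forall N sh, W [set: L] N sh != 0 -> respects col sh.

Definition word_cov (N : nat) : R[i] :=
  k2 (P N) (centered_trace (P N) (fun i : 'I_p => @A N (inl i)))
           (centered_trace (P N) (fun j : 'I_q => @A N (inr j))).

Definition term (sh : shadow L) (N : nat) : R[i] :=
  W [set: L] N sh * N%:R ^+ n_comp (index_rel (@nextL p q) sh) L.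

Lemma term_cvg0 sh : ~ (valid [set: L] sh /\ respects col sh) -> ccvg_to (term sh) 0.
Proof.
move=> h; rewrite (_ : term sh = fun=> 0); first exact: ccvg_to_cst.
apply/funext => N; rewrite /term; have [->|nz] := eqVneq (W [set: L] N sh) 0.
  by rewrite mul0r.
by case: h; split; [apply: (weights_valid HW _ nz); apply: finset.subsetT|apply: WE nz].
Qed.

Lemma term_cvg_excess sh : excess (@nextL p q) sh < 0 -> ccvg_to (term sh) 0.
Proof.
move=> e0; clear hp hq.
have /ccvgP h := weights_limit HW (sh := sh) (finset.subsetT [set: L]).
have h0 := ccvg_toM (@powN_lt0 R _ e0) h; rewrite mul0r in h0; move: h0.
apply: ccvg_to_eventually => N N0; have N0' : N%:R != 0 :> R[i] by rewrite pnatr_eq0 -lt0n.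
rewrite mulrA -expfzDr // /term mulrC; congr (_ * _); rewrite exprnP; congr (_ ^ _).
rewrite /excess cardsT -/L; lia.
Qed.

Lemma word_cov_cvg (l : shadow L -> R[i]) :
  (forall sh, crossing sh -> ccvg_to (term sh) (l sh)) ->
  ccvg_to word_cov (\sum_(sh | crossing sh) l sh).
Proof.
move=> h; apply: (@ccvg_to_eventually _ (fun N => \sum_(sh | crossing sh) term sh N)).
  by move=> N N0; rewrite /word_cov (cov_expansion hp hq HW N0 (intA N0)).
exact: ccvg_to_sum.
Qed.

(** A crossing shadow of excess 0 needs words of the same length. *)
Lemma cov_limit_neq : p <> q -> ccvg_to word_cov 0.
Proof.
move=> pq; rewrite (_ : 0 = \sum_(sh : shadow L | crossing sh) 0); last by rewrite big1.
apply: word_cov_cvg => sh /andP[/forallP ni nsp].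
have [[V rs]|] := pselect (valid [set: L] sh /\ respects col sh); last exact: term_cvg0.
apply: term_cvg_excess; rewrite lt_neqAle (excess_le0 (@nextLK p q) alt V rs ni) andbT.
apply/negP => /eqP lead; apply: pq.
exact: (lead_same_length alt V rs ni lead nsp).
Qed.

End CovarianceLimit.

Section EqualLengths.
Variables (R : realType) (d : nat -> measure_display)
    (T : forall N : nat, measurableType (d N)) (P : forall N : nat, probability (T N) R)
    (p : nat).
Hypothesis p0 : (0 < p)%N.
Let L : finType := ('I_p + 'I_p)%type.
Variables (A : forall N : nat, L -> T N -> 'M[R[i]]_N)
    (W : {set L} -> nat -> shadow L -> R[i]).
Hypothesis HW : weights P A [set: L] W.
Hypothesis intA : forall N, (0 < N)%N -> forall (S : {set L}) (phi : L * bool -> 'I_N),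
  cintegrable (P N) (fun w => \prod_(k in S) A k w (phi (k, false)) (phi (k, true))).
Variables (K : finType) (col : L -> K).
Hypothesis alt : forall k, col k != col (nextL k).
Hypothesis WE : forall N sh, W [set: L] N sh != 0 -> respects col sh.

Let pairW (o : bool) (k i : 'I_p) (N : nat) : R[i] :=
  let x : L := inl i in let y : L := inr (partner p0 o k i) in
  N%:R * W [set x; y]%SET N (pair_shadow x y o).

(** A spoke diagram has exactly [p] classes of indices if it respects the
    colours; otherwise both sides vanish. *)
Lemma spoke_term o k N : (0 < N)%N -> \prod_i pairW o k i N = term W (spoke p0 o k) N.
Proof.
move=> N0; have V := spoke_valid p0 o k.
have WE' : W [set: L] N (spoke p0 o k) =
    \prod_i W [set (inl i : L); inr (partner p0 o k i)]%SET N
              (pair_shadow (inl i) (inr (partner p0 o k i)) o).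
  rewrite (weights_classes HW N0 V (spoke_respects p0 o k)).
  rewrite (reindex_inj (@partner_injr p p0 o k)); apply: eq_bigr => i _.
  by rewrite spoke_restr spoke_class.
rewrite /pairW big_split /= -WE' prodr_const card_ord /term mulrC.
have [->|/WE rs] := eqVneq (W [set: L] N (spoke p0 o k)) 0; first by rewrite !mul0r.
congr (_ * _ ^+ _); apply/eqP; rewrite eqn_leq spoke_index_classes /=.
have [h _] := index_bound (@nextLK p p) alt V rs.
by rewrite -leq_double; apply: leq_trans h _; rewrite card_sum card_ord addnn.
Qed.

(** Only the spoke diagrams have excess 0. *)
Lemma cov_limit_eq : ccvg_to (word_cov P A)
  (\sum_(k < p) \prod_(i < p) clim (pairW true k i) +
   \sum_(k < p) \prod_(i < p) clim (pairW false k i)).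
Proof.
pose lim ok := \prod_(i < p) clim (pairW ok.1 ok.2 i).
pose l (sh : shadow L) := \sum_(ok : bool * 'I_p | spoke p0 ok.1 ok.2 == sh) lim ok.
have lE o k : l (spoke p0 o k) = lim (o, k).
  rewrite /l (big_pred1 (o, k)) // => -[b k'] /=.
  by apply/eqP/eqP => [e|[-> ->] //]; apply: (@spoke_inj p p0).
have cr o k : crossing (spoke p0 o k).
  by rewrite /crossing spoke_crosses andbT; apply/forallP => a; apply: spoke_not_lone.
have -> : \sum_(k < p) \prod_(i < p) clim (pairW true k i) +
   \sum_(k < p) \prod_(i < p) clim (pairW false k i) = \sum_(sh | crossing sh) l sh.
  rewrite /l (exchange_big_dep predT) //=.
  rewrite (eq_bigr lim); last first.
    move=> [b k] _; rewrite /= (big_pred1 (spoke p0 b k)) // => sh /=.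
    by rewrite eq_sym; case: eqP => [->|]; rewrite ?andbT ?andbF ?cr.
  rewrite -(pair_bigA _ (fun o k => lim (o, k))) /=.
  by rewrite big_bool.
apply: (word_cov_cvg p0 p0 HW intA) => sh /andP[/forallP ni nsp].
have [[b k] /= /eqP <-|no] := pickP (fun ok : bool * 'I_p => spoke p0 ok.1 ok.2 == sh).
  rewrite lE; apply: (@ccvg_to_eventually _ (fun N => \prod_(i < p) pairW b k i N)).
    by move=> N N0; apply: spoke_term.
  by apply: ccvg_to_prod => i _; apply/ccvgP/(pair_weight_cvg HW).
have -> : l sh = 0 by rewrite /l big_pred0.
have [[V rs]|nV] := pselect (valid [set: L] sh /\ respects col sh); last exact: (term_cvg0 HW WE).
apply: (term_cvg_excess HW); rewrite lt_neqAle (excess_le0 (@nextLK p p) alt V rs ni) andbT.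
apply/negP => /eqP lead.
have [b [k e]] := lead_spoke p0 alt V rs ni lead nsp.
by have := no (b, k); rewrite /= -e eqxx.
Qed.

Lemma pairW_limit o k i : ccvg_to (fun N => tr_cov (P N) (@A N (inl i))
    (fun t => sgn_mx (~~ o) (A (inr (partner p0 o k i)) t))) (clim (pairW o k i)).
Proof. exact: (pair_limit HW intA). Qed.

End EqualLengths.

(** * Words in several ensembles *)

Lemma weights_sub (L : finType) (R : realType) (d : nat -> measure_display)
    (T : forall N : nat, measurableType (d N)) (P : forall N : nat, probability (T N) R)
    (A A' : forall N : nat, L -> T N -> 'M[R[i]]_N) (Lc : {set L}) W :
  (forall N k, k \in Lc -> @A N k = @A' N k) ->
  weights P A' [set: L] W -> weights P A Lc W.
Proof.
move=> AA' [w1 w2 w3 w4]; have subT (S : {set L}) : S \subset [set: L] := finset.subsetT S.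
split=> [S N phi N0 SL|S1 S2 N sh1 sh2 N0 _ _|S sh _|S N sh _].
- rewrite -w1 //; apply: eq_cexp => w; apply: eq_bigr => k kS.
  by rewrite AA' //; apply: (fintype.subsetP SL).
- exact: w2.
- exact: w3.
exact: w4.
Qed.

Section Ensembles.
Variables (R : realType) (d : nat -> measure_display)
  (T : forall N : nat, measurableType (d N))
  (P : forall N : nat, probability (T N) R)
  (K : finType) (Lam : K -> Type)
  (X : forall (c : K) (N : nat), Lam c -> T N -> 'M[R[i]]_N)
  (PM : K -> premap_data) (f : forall c : K, weight_data R (Lam c)).
Arguments X : clear implicits.
Hypothesis hG : forall c, condition_G P (X c) (PM c) (@f c).
Hypothesis hindep : forall N : nat, (0 < N)%N ->
  mutually_indep (P N) (fun c => sigma_mx (X c N)).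
Variables (L : finType) (len : L -> nat) (col : L -> K).
Hypothesis len_gt0 : forall k, (0 < len k)%N.
Variables (eps : forall k, 'I_(len k) -> bool) (lam : forall k, 'I_(len k) -> Lam (col k)).
Arguments eps : clear implicits.
Arguments lam : clear implicits.

Definition word_block N (k : L) (t : T N) : 'M[R[i]]_N :=
  block (fun l => X (col k) N l t) (eps k) (lam k).

Lemma block_cast c k (e : col k = c) N t :
  word_block k t = block (fun l => X c N l t) (eps k) (fun j => ecast x (Lam x) e (lam k j)).
Proof. by case: _ / e. Qed.

Lemma one_colour_weights c : exists W, weights P word_block (colour_class col c) W.
Proof.
have [Lc0|[k0 k0c]] := set_0Vmem (colour_class col c).
  by exists (fun S N sh => (sh == (finset.set0, finset.set0))%:R); apply: trivial_weights.
have e0 : col k0 = c by move: k0c; rewrite inE => /eqP.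
pose l0 : Lam c := ecast x (Lam x) e0 (lam k0 (Ordinal (len_gt0 k0))).
(* Blocks of other colours get an arbitrary label. *)
pose lamc k : 'I_(len k) -> Lam c := fun j =>
  if col k =P c is ReflectT e then ecast x (Lam x) e (lam k j) else l0.
have [W HW] : exists W, weights P (fun N k t => block (fun l => X c N l t) (eps k) (lamc k))
    [set: L] W.
  by eexists; apply: (ensemble_weights (hG c) len_gt0 k0 eps lamc).
exists W; apply: weights_sub HW => N k; rewrite inE => /eqP kc; apply/funext => t.
rewrite (block_cast kc); congr block; apply/funext => j; rewrite /lamc.
by case: eqP => // e; rewrite (eq_irrelevance e kc).
Qed.

Lemma colour_poly N c (S : {set L}) (phi : L * bool -> 'I_N) :
  poly_rv (X c N) (fun w => \prod_(k in S :&: colour_class col c)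
     word_block k w (phi (k, false)) (phi (k, true))).
Proof.
rewrite (_ : (fun w => _) = fun w => \prod_k if k \in S :&: colour_class col c then
  word_block k w (phi (k, false)) (phi (k, true)) else 1); last first.
  by apply/funext => w; rewrite big_mkcond.
apply: poly_rv_prod => k; have [|_] := boolP (k \in _); last exact: poly_rv_cst.
rewrite !inE => /andP[_ /eqP kc].
rewrite (_ : (fun w => _) = fun w => block (fun l => X c N l w) (eps k)
  (fun j => ecast x (Lam x) kc (lam k j)) (phi (k, false)) (phi (k, true))).
  exact: poly_rv_block.
by apply/funext => w; rewrite (block_cast kc).
Qed.

Lemma colours_independent N (S : {set L}) (phi : L * bool -> 'I_N) : (0 < N)%N ->
  cintegrable (P N) (fun w => \prod_(k in S) word_block k w (phi (k, false)) (phi (k, true))) /\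
  block_moment (P N) (@word_block N) S phi =
    \prod_c block_moment (P N) (@word_block N) (S :&: colour_class col c) phi.
Proof.
move=> N0.
pose E c : set (set (T N)) := [set A | exists (j : Lam c) (a b : 'I_N) (B : set R),
   measurable B /\ (A = (fun w => complex.Re (X c N j w a b)) @^-1` B \/
         A = (fun w => complex.Im (X c N j w a b)) @^-1` B)]%classic.
have mX c : (forall l, random_matrix (X c N l)) /\ all_moments (P N) (X c N).
  by have [h _ _ _ _] := hG c; apply: h.
pose Z c w := \prod_(k in S :&: colour_class col c)
     word_block k w (phi (k, false)) (phi (k, true)).
have := @cexp_prod_indep _ _ _ (P N) K E (fun c => sigma_mx_measurable (mX c).1) (hindep N0)
  Z (index_enum K) (fun c => poly_rv_meas (@colour_poly N c S phi))
  (fun c => poly_rv_integrable (mX c).2 (@colour_poly N c S phi)) (index_enum_uniq K).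
have ZE : (fun w => \prod_c Z c w) =
    (fun w => \prod_(k in S) word_block k w (phi (k, false)) (phi (k, true))).
  apply/funext => w; rewrite [RHS](partition_big col predT) //=; apply: eq_bigr => c _.
  by apply: eq_bigl => k; rewrite !inE.
by rewrite ZE.
Qed.

Lemma word_weights : exists W, [/\ weights P word_block [set: L] W,
  forall N sh, W [set: L] N sh != 0 -> respects col sh &
  forall N, (0 < N)%N -> forall (S : {set L}) (phi : L * bool -> 'I_N),
    cintegrable (P N) (fun w => \prod_(k in S) word_block k w (phi (k, false)) (phi (k, true)))].
Proof.
have [W HW] := fin_all_exists one_colour_weights.
exists (colour_weight col W); split.
- by apply: colour_weights => // N S phi N0; have [] := colours_independent S phi N0.
- by move=> N sh /(colour_weight_neq0 HW)[].
by move=> N N0 S phi; have [] := colours_independent S phi N0.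
Qed.

End Ensembles.

Theorem theorem6p2 (R : realType)
  (d : nat -> measure_display)
  (T : forall N : nat, measurableType (d N))
  (P : forall N : nat, probability (T N) R)
  (C : nat) (Lam : 'I_C -> Type)
  (X : forall (c : 'I_C) (N : nat), Lam c -> T N -> 'M[R[i]]_N)
  (PM : 'I_C -> premap_data)
  (f : forall c : 'I_C, weight_data R (Lam c))
  (hG : forall c : 'I_C, condition_G P (X c) (PM c) (f c))
  (hindep : forall N : nat, (0 < N)%N ->
     mutually_indep (P N) (fun c : 'I_C => sigma_mx (X c N)))
  (p q : nat) (hp : (0 < p)%N) (hq : (0 < q)%N)
  (v : 'I_p -> 'I_C) (w : 'I_q -> 'I_C)
  (hv : cyclically_alternating v) (hw : cyclically_alternating w)
  (m : 'I_p -> nat) (n : 'I_q -> nat)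
  (hm : forall k, (0 < m k)%N) (hn : forall k, (0 < n k)%N)
  (epsA : forall k : 'I_p, 'I_(m k) -> bool)
  (epsB : forall k : 'I_q, 'I_(n k) -> bool)
  (lamA : forall k : 'I_p, 'I_(m k) -> Lam (v k))
  (lamB : forall k : 'I_q, 'I_(n k) -> Lam (w k)) :
  let A (N : nat) (k : 'I_p) (t : T N) : 'M[R[i]]_N :=
    block (fun l => X (v k) N l t) (epsA k) (lamA k) in
  let B (N : nat) (k : 'I_q) (t : T N) : 'M[R[i]]_N :=
    block (fun l => X (w k) N l t) (epsB k) (lamB k) in
  let cov (N : nat) : R[i] :=
    k2 (P N) (centered_trace (P N) (A N)) (centered_trace (P N) (B N)) in
  let u (k i : 'I_p) (N : nat) : R[i] :=
    tr_cov (P N) (A N i) (B N (cyc_idx hq (k%:Z - i.+1%:Z))) in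
  let uT (k i : 'I_p) (N : nat) : R[i] :=
    tr_cov (P N) (A N i)
           (fun t => (B N (cyc_idx hq (k%:Z + i.+1%:Z)) t)^T) in
  (p <> q -> ccvg_to cov 0) /\
  (p = q -> (2 <= p)%N ->
     [/\ forall k i, ccvg (u k i),
         forall k i, ccvg (uT k i)
       & ccvg_to cov (\sum_(k < p) \prod_(i < p) clim (u k i)
                      + \sum_(k < p) \prod_(i < p) clim (uT k i))]).
Proof.
move=> A B cov u uT.
pose L : finType := ('I_p + 'I_q)%type.
pose col (k : L) : 'I_C := match k with inl i => v i | inr j => w j end.
pose len (k : L) : nat := match k with inl i => m i | inr j => n j end.
pose eps (k : L) : 'I_(len k) -> bool :=
  match k with inl i => epsA i | inr j => epsB j end.
pose lam (k : L) : 'I_(len k) -> Lam (col k) :=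
  match k with inl i => lamA i | inr j => lamB j end.
have len_gt0 k : (0 < len k)%N by case: k.
have alt k : col k != col (nextL k) by case: k => i; [apply: hv|apply: hw].
have [W [HW WE intA]] := word_weights hG hindep len_gt0 eps lam.
split=> [pq|pq _]; first exact: (cov_limit_neq hp hq HW intA alt WE pq).
subst q.
have hu (o : bool) (k i : 'I_p) := pairW_limit (p0 := hq) HW intA (o := o) (k := k) (i := i).
have lu k i := clim_eq (hu true k i); have luT k i := clim_eq (hu false k i).
split=> [k i|k i|].
- exact: ccvg_to_ccvg (hu true k i).
- exact: ccvg_to_ccvg (hu false k i).
have := cov_limit_eq (p0 := hq) HW intA alt WE.
congr ccvg_to; congr (_ + _); apply: eq_bigr => k _; apply: eq_bigr => i _; apply/esym.
  exact: lu.
exact: luT.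
Qed.
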